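(* Let $r\ge3$ and let $m_1,\dots,m_r$ be integers with $2\le m_j<\infty$. Let $R=\mathbb C[q_{jk}^{\pm1}]$, $1\le j\le r$, $1\le k\le m_j$, and let $\mathscr H$ be the $R$-algebra generated by invertible elements $c_1,\dots,c_r$ with defining relations $$\prod_{k=1}^{m_j}\bigl(c_j-\exp(2\pi\mathbf ik/m_j)\,q_{jk}\bigr)=0\quad(j=1,\dots,r),\qquad c_1c_2\cdots c_r=1 .$$ Then $\mathscr H$ is free as a left module over $R$ if and only if $\sum_{j=1}^r(1-1/m_j)\ge2$.
   Context: $\mathscr H=\mathscr H_\tau(\Gamma,H)$ is the Hecke algebra (with $q_{jk}=\exp(\tau_{jk})$) of the Fuchsian group $\Gamma=\Gamma(m_1,\dots,m_r)$ with generators $c_1,\dots,c_r$ and relations $c_j^{m_j}=1$, $\prod_jc_j=1$, acting on a simply connected Riemann surface $H$; the condition $\sum_j(1-1/m_j)\ge2$ is equivalent to $H$ being Euclidean or hyperbolic. The variables $q_{jk}$ are algebraically independent and central. *)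

(* Defs.v *)
From HB Require Import structures.
From mathcomp Require Import all_boot all_order all_algebra.
From mathcomp Require Import boolp reals trigo.
From mathcomp Require Import complex.
From mathcomp Require Import monalg mpoly.

Set Implicit Arguments.
Unset Strict Implicit.
Unset Printing Implicit Defensive.

Import GRing.Theory.
Local Open Scope ring_scope.
Local Open Scope quotient_scope.

(* The Laurent polynomial ring F[x_i^{+-1} : i in I] is the subring of the     *)
(* fraction field of F[x_i : i in I] consisting of the quotients of a          *)
(* polynomial by a monomial. Elements of I are numbered by enum_rank because   *)
(* the variables of mpoly are indexed by ordinals.                             *)
Section Laurent.

Variables (I : finType) (F : fieldType).

Definition laurent_pred : {pred {fraction (mpoly #|I| F)}} :=
  fun x => `[< exists (e : multinom #|I|) (p : mpoly #|I| F),
                 x * tofrac 'X_[e] = tofrac p >].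

Lemma laurent_pred_subring_closed : subring_closed laurent_pred.
Proof.
split=> [|x y|x y].
- by apply/asboolP; exists 0%MM, 1; rewrite mpolyX0 mul1r.
- move=> /asboolP[e [p xE]] /asboolP[f [q yE]]; apply/asboolP.
  exists (e + f)%MM, (p * 'X_[f] - q * 'X_[e]).
  rewrite mpolyXD rmorphB !rmorphM /= -xE -yE mulrBl; congr (_ - _).
    by rewrite mulrA.
  by rewrite [tofrac _ * tofrac _]mulrC mulrA.
- move=> /asboolP[e [p xE]] /asboolP[f [q yE]]; apply/asboolP.
  exists (e + f)%MM, (p * q).
  by rewrite mpolyXD !rmorphM /= -xE -yE mulrACA.
Qed.

HB.instance Definition _ :=
  GRing.isSubringClosed.Build {fraction (mpoly #|I| F)} laurent_pred
    laurent_pred_subring_closed.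

Record laurent : predArgType := Laurent {
  laurent_val :> {fraction (mpoly #|I| F)};
  _ : laurent_val \in laurent_pred }.

HB.instance Definition _ := [isSub for laurent_val].
HB.instance Definition _ := [Choice of laurent by <:].
HB.instance Definition _ := [SubChoice_isSubComNzRing of laurent by <:].

Lemma laurent_poly_proof (p : mpoly #|I| F) : tofrac p \in laurent_pred.
Proof. by apply/asboolP; exists 0%MM, p; rewrite mpolyX0 rmorph1 mulr1. Qed.

Definition laurent_poly (p : mpoly #|I| F) : laurent :=
  Laurent (laurent_poly_proof p).

Definition laurentC (c : F) : laurent := laurent_poly (mpolyC #|I| c).

Definition laurentX (i : I) : laurent := laurent_poly 'X_(enum_rank i).

Lemma laurentX_invertible (i : I) : exists y : laurent, laurentX i * y = 1.
Proof.
pose x := tofrac ('X_(enum_rank i) : mpoly #|I| F).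
have x0 : x != 0 by rewrite tofrac_eq0 -msupp_eq0 msuppX.
have yP : x^-1 \in laurent_pred.
  by apply/asboolP; exists U_(enum_rank i)%MM, 1; rewrite mulVf // rmorph1.
by exists (Laurent yP); apply/val_inj; rewrite /= mulfV.
Qed.

End Laurent.

(* The free associative unital R-algebra on T: the monoid algebra of the free  *)
(* monoid on T.                                                                *)
Section FreeAlgebra.

Variables (R : comNzRingType) (T : choiceType).

Definition freealg := {malg R[{fmonom T}]}.

HB.instance Definition _ := GRing.Lalgebra.on freealg.

Lemma freealg_mulrC_scale (a : R) (x : freealg) : x * malgC a = a *: x.
Proof.
rewrite malgM_def fgmulgU malgZ_def; apply/eq_bigr => k _.
by rewrite mulm1 mulrC.
Qed.

Lemma freealg_scalerAr (a : R) (x y : freealg) : a *: (x * y) = x * (a *: y).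
Proof.
by rewrite -[a *: y]mul_malgC mulrA freealg_mulrC_scale scalerAl.
Qed.

HB.instance Definition _ :=
  GRing.Lalgebra_isAlgebra.Build R freealg freealg_scalerAr.

Definition freegen (t : T) : freealg := mkmalgU (fmu t) 1.

End FreeAlgebra.

Section QuotientAlgebra.

Variables (R : comNzRingType) (A : algType R).

(* The two-sided ideal generated by S: finite sums of elements a s b, s in S.  *)
Definition ideal_gen (S : A -> Prop) : {pred A} :=
  fun x => `[< exists s : seq (A * A * A),
                 (forall t, t \in s -> S t.1.2) /\
                 x = \sum_(t <- s) t.1.1 * t.1.2 * t.2 >].

Variable S : A -> Prop.

Lemma ideal_genMl (a x : A) : x \in ideal_gen S -> a * x \in ideal_gen S.
Proof.
move=> /asboolP[s [sS ->]]; apply/asboolP.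
exists [seq (a * t.1.1, t.1.2, t.2) | t <- s]; split.
  by move=> _ /mapP[t ts ->]; exact: (sS _ ts).
by rewrite big_map mulr_sumr; apply: eq_bigr => t _; rewrite !mulrA.
Qed.

Lemma ideal_genMr (a x : A) : x \in ideal_gen S -> x * a \in ideal_gen S.
Proof.
move=> /asboolP[s [sS ->]]; apply/asboolP.
exists [seq (t.1.1, t.1.2, t.2 * a) | t <- s]; split.
  by move=> _ /mapP[t ts ->]; exact: (sS _ ts).
by rewrite big_map mulr_suml; apply: eq_bigr => t _; rewrite !mulrA.
Qed.

Lemma ideal_gen_zmod_closed : zmod_closed (ideal_gen S).
Proof.
split=> [|x y]; first by apply/asboolP; exists [::]; rewrite big_nil.
move=> xS; rewrite -mulN1r => /(ideal_genMl (-1)).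
move: xS => /asboolP[s [sS ->]] /asboolP[s' [s'S ->]]; apply/asboolP.
exists (s ++ s'); rewrite big_cat; split=> // t.
by rewrite mem_cat => /orP[/sS|/s'S].
Qed.

HB.instance Definition _ :=
  GRing.isZmodClosed.Build A (ideal_gen S) ideal_gen_zmod_closed.

Lemma ideal_genZ (a : R) (x : A) : x \in ideal_gen S -> a *: x \in ideal_gen S.
Proof. by rewrite -[a *: x]mulr_algl; exact: ideal_genMl. Qed.

Lemma ideal_gen_rel (x : A) : S x -> x \in ideal_gen S.
Proof.
move=> Sx; apply/asboolP; exists [:: (1, x, 1)].
by rewrite big_seq1 mul1r mulr1; split=> // t; rewrite inE => /eqP ->.
Qed.

Definition quotalg := Quotient.quot (ideal_gen S).

HB.instance Definition _ := GRing.Zmodule.on quotalg.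

Definition quot_pi (x : A) : quotalg := \pi_quotalg x.

Lemma quot_piP (x y : A) : quot_pi x = quot_pi y <-> x - y \in ideal_gen S.
Proof. by rewrite Quotient.idealrBE; split=> [xy|/eqP]; first exact/eqP. Qed.

Lemma quot_piB : {morph quot_pi : x y / x - y}.
Proof. exact: raddfB. Qed.

Lemma quot_piD : {morph quot_pi : x y / x + y}.
Proof. exact: raddfD. Qed.

Lemma quot_pi_repr (x : quotalg) : quot_pi (repr x) = x.
Proof. exact: reprK. Qed.

Definition quotalg_one : quotalg := quot_pi 1.
Definition quotalg_mul (x y : quotalg) : quotalg := quot_pi (repr x * repr y).
Definition quotalg_scale (a : R) (x : quotalg) : quotalg := quot_pi (a *: repr x).

Lemma quot_piM : {morph quot_pi : x y / x * y >-> quotalg_mul x y}.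
Proof.
move=> x y; apply/quot_piP.
have [hx hy] : x - repr (quot_pi x) \in ideal_gen S /\
               y - repr (quot_pi y) \in ideal_gen S.
  by split; apply/quot_piP; rewrite quot_pi_repr.
rewrite -[_ - _](subrKA (repr (quot_pi x) * y)) -mulrBl -mulrBr.
by apply: rpredD; [exact: ideal_genMr | exact: ideal_genMl].
Qed.

Lemma quot_piZ (a : R) :
  {morph quot_pi : x / a *: x >-> quotalg_scale a x}.
Proof.
move=> x; apply/quot_piP; rewrite -scalerBr; apply/ideal_genZ/quot_piP.
by rewrite quot_pi_repr.
Qed.

Lemma quotalg_mulA : associative quotalg_mul.
Proof.
move=> x y z; rewrite -[x]quot_pi_repr -[y]quot_pi_repr -[z]quot_pi_repr.
by rewrite -!quot_piM mulrA.
Qed.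

Lemma quotalg_mul1q : left_id quotalg_one quotalg_mul.
Proof. by move=> x; rewrite -[x]quot_pi_repr -quot_piM mul1r. Qed.

Lemma quotalg_mulq1 : right_id quotalg_one quotalg_mul.
Proof. by move=> x; rewrite -[x]quot_pi_repr -quot_piM mulr1. Qed.

Lemma quotalg_mulDl : left_distributive quotalg_mul +%R.
Proof.
move=> x y z; rewrite -[x]quot_pi_repr -[y]quot_pi_repr -[z]quot_pi_repr.
by rewrite -quot_piD -!quot_piM -quot_piD mulrDl.
Qed.

Lemma quotalg_mulDr : right_distributive quotalg_mul +%R.
Proof.
move=> x y z; rewrite -[x]quot_pi_repr -[y]quot_pi_repr -[z]quot_pi_repr.
by rewrite -quot_piD -!quot_piM -quot_piD mulrDr.
Qed.

(* Only a pzRingType: the quotient may be the zero ring for a general S.       *)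
HB.instance Definition _ := GRing.Zmodule_isPzRing.Build quotalg
  quotalg_mulA quotalg_mul1q quotalg_mulq1 quotalg_mulDl quotalg_mulDr.

Lemma quotalg_scaleA (a b : R) (x : quotalg) :
  quotalg_scale a (quotalg_scale b x) = quotalg_scale (a * b) x.
Proof. by rewrite -[x]quot_pi_repr -!quot_piZ scalerA. Qed.

Lemma quotalg_scale1 : left_id 1 quotalg_scale.
Proof. by move=> x; rewrite -[x]quot_pi_repr -quot_piZ scale1r. Qed.

Lemma quotalg_scaleDr : right_distributive quotalg_scale +%R.
Proof.
move=> a x y; rewrite -[x]quot_pi_repr -[y]quot_pi_repr.
by rewrite -quot_piD -!quot_piZ -quot_piD scalerDr.
Qed.

Lemma quotalg_scaleDl (x : quotalg) :
  {morph quotalg_scale^~ x : a b / a + b}.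
Proof.
by move=> a b; rewrite -[x]quot_pi_repr -!quot_piZ -quot_piD scalerDl.
Qed.

HB.instance Definition _ := GRing.Zmodule_isLmodule.Build R quotalg
  quotalg_scaleA quotalg_scale1 quotalg_scaleDr quotalg_scaleDl.

Lemma quot_piM_ring : {morph quot_pi : x y / x * y}.
Proof. exact: quot_piM. Qed.

Lemma quot_piZ_lmod (a : R) : {morph quot_pi : x / a *: x}.
Proof. exact: quot_piZ. Qed.

Lemma quotalg_scalerAl (a : R) (x y : quotalg) : a *: (x * y) = a *: x * y.
Proof.
rewrite -[x]quot_pi_repr -[y]quot_pi_repr.
by rewrite -!(quot_piM_ring, quot_piZ_lmod) scalerAl.
Qed.

Lemma quotalg_scalerAr (a : R) (x y : quotalg) : a *: (x * y) = x * (a *: y).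
Proof.
rewrite -[x]quot_pi_repr -[y]quot_pi_repr.
by rewrite -!(quot_piM_ring, quot_piZ_lmod) scalerAr.
Qed.

End QuotientAlgebra.

(* A basis is a set B of vectors, possibly infinite: any finite family of      *)
(* distinct elements of B is linearly independent, and B spans.                *)
Definition lin_indep (R : nzRingType) (V : lmodType R) (B : V -> Prop) : Prop :=
  forall (s : seq V) (a : V -> R),
    uniq s -> (forall v, v \in s -> B v) ->
    \sum_(v <- s) a v *: v = 0 -> forall v, v \in s -> a v = 0.

Definition spanning (R : nzRingType) (V : lmodType R) (B : V -> Prop) : Prop :=
  forall x : V, exists (s : seq V) (a : V -> R),
    (forall v, v \in s -> B v) /\ x = \sum_(v <- s) a v *: v.

Definition free_module (R : nzRingType) (V : lmodType R) : Prop :=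
  exists B : V -> Prop, lin_indep B /\ spanning B.

Arguments free_module R V : clear implicits.

(* exp(2 pi i k / m) *)
Definition root_exp (K : realType) (k m : nat) : K[i] :=
  let t := 2 * pi * k%:R / m%:R in (cos t +i* sin t)%C.

Section Hecke.

Variables (K : realType) (r : nat) (m : 'I_r -> nat).

(* The pairs (j, k); 0-based indices, so that k : 'I_(m j) stands for the      *)
(* index k.+1 between 1 and m j.                                               *)
Definition qindex : finType := {j : 'I_r & 'I_(m j)}.

Definition qring : comNzRingType := laurent qindex K[i].

Definition qvar (j : 'I_r) (k : 'I_(m j)) : qring :=
  laurentX K[i] (Tagged (fun j => 'I_(m j)) k).

(* inl j is the generator c_j and inr j its inverse.                           *)
Definition hecke_free : algType qring := freealg qring ('I_r + 'I_r)%type.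

Definition cgen (j : 'I_r) : hecke_free := freegen qring (inl j).
Definition cgenV (j : 'I_r) : hecke_free := freegen qring (inr j).

Variant hecke_rel : hecke_free -> Prop :=
| hecke_rel_invr j : hecke_rel (cgen j * cgenV j - 1)
| hecke_rel_invl j : hecke_rel (cgenV j * cgen j - 1)
| hecke_rel_poly j : hecke_rel
    (\prod_(k < m j) (cgen j - (laurentC _ (root_exp K k.+1 (m j)) * qvar k)%:A))
| hecke_rel_prod : hecke_rel (\prod_(j < r) cgen j - 1).

Definition hecke := quotalg hecke_rel.

HB.instance Definition _ := GRing.PzRing.on hecke.
HB.instance Definition _ := GRing.Lmodule.on hecke.

End Hecke.

(* Main.v *)
(** Let W be the group with an involution s_i for each side of an r-gon and
the relations (s_i s_(i+1))^(m_i) = 1 at its corners; with c_i = s_i s_(i+1),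
the group Gamma is its subgroup of even elements.

If the angle sum is that of a Euclidean or hyperbolic polygon, the geometric
representation shows that the descents of an element of W are at most two, and
adjacent.  This is what is needed to deform the regular representation of W:
on the free R-module with basis W one defines involutions S_i by recursion on
the length, the value at an element below two descents being dictated by the
polynomial relation around the corresponding corner.  Then c_k acts on even
elements as S_k S_(k+1), all relations of the Hecke algebra hold, and applying
the Hecke algebra to the neutral element identifies it with the span of the
even elements.

Otherwise r = 3 and W is finite.  Rewriting words then shows that the Hecke
algebra is spanned over R by finitely many words, so if it is free it has a
finite basis.  Over the field of fractions c_j is diagonalizable with
eigenvalues among the roots exp(2 pi i k / m_j) q_jk, so its determinant is a
monomial of positive degree unless the rank is zero.  The product of these
determinants is 1, hence the rank is zero; but the algebra is not zero, because
at q = 1 it acts on a line by c_j = 1. *)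

From HB Require Import structures.
From mathcomp Require Import all_boot all_order all_algebra finmap.
From mathcomp Require Import boolp reals trigo complex monalg zify ring lra.
From mathcomp Require mpoly.
Require Import Defs.

Set Implicit Arguments.
Unset Strict Implicit.
Unset Printing Implicit Defensive.

Import Order.TTheory GRing.Theory Num.Theory.
Local Open Scope ring_scope.

(** * Alternating words and monoid algebras *)

(** The relation of c_k has m_k + 1 terms, so the deformed reflections do not in general permute the
    basis W up to units. What survives is triangularity: if s_i w is longer than w, then S_i w is a
    unit times s_i w plus elements shorter than s_i w, and every value is found by solving such a
    triangular equation. At a corner {k, k+1} with bottom u the relation is multiplied by an
    alternating product of S_k and S_(k+1). It then reads sum_q p_q Y_(2q-m) = 0, where the points
    Y_n arise from u by alternating reflections. The extreme points Y_m and Y_(-m) both lead with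
    the top of the corner, and their coefficients 1 and p_k(0) are units: this is a deformed braid
    relation. One of the two edges into the top can stay undeformed, and the other is then forced.
    Parity decides which one, because the rotation extending c_k is S_k S_(k+1) on even elements and
    S_(k+1) S_k on odd ones. The Hecke algebra itself contains no S_i; they act on two copies of it,
    the second one standing for s_0 times the first. *)

Section Alternation.

Variables (I A : Type) (g : I -> A -> A).

Fixpoint alt (n : nat) (a b : I) (x : A) : A :=
  if n is n'.+1 then g (if odd n' then b else a) (alt n' a b x) else x.

Lemma altSr n a b x : alt n.+1 a b x = alt n b a (g a x).
Proof. by elim: n => //= n <-; case: (odd n). Qed.

Lemma altK n a b x : (forall i, involutive (g i)) ->
  alt n (if odd n then a else b) (if odd n then b else a) (alt n a b x) = x.
Proof.
move=> gK; elim: n => // n IHn.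
rewrite altSr [alt n.+1 _ _ x]/=.
by move: IHn; rewrite [odd n.+1]/=; case: (odd n) => /=; rewrite gK.
Qed.

End Alternation.

(** Recursion on a measure in which [F] takes an ordinary function, without proof arguments. Reading
    it at a point of no smaller measure returns [v0], so each use has to show that this default is
    not reached. *)
Lemma rec_fixpoint (P V : Type) (mu : P -> nat) (v0 : V) (F : P -> (P -> V) -> V) :
  exists f : P -> V,
    forall p, f p = F p (fun q => if (mu q < mu p)%N then f q else v0).
Proof.
pose fix app (n : nat) (p : P) {struct n} : V :=
  if n is n'.+1 then F p (fun q => if (mu q < mu p)%N then app n' q else v0)
  else v0.
have appE n : forall k p, (mu p < n)%N -> (mu p < k)%N -> app n p = app k p.
  elim: n => // n IHn [|k] // p pn pk /=; congr F; apply: funext => q.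
  by case: ifP => // qp; apply: IHn; apply: (leq_trans qp).
exists (fun p => app (mu p).+1 p) => p /=; congr F; apply: funext => q.
by case: ifP => // qp; exact: (appE _ (mu q).+1).
Qed.

Section Invertible.

Variable R : comNzRingType.

Definition invertible (a : R) : Prop := exists b, a * b = 1.

(** [qring] is only a commutative ring, so inverses are chosen; 0 is the default at non-units. *)
Definition inverse (a : R) : R :=
  if pselect (invertible a) is left e then projT1 (cid e) else 0.

Lemma mul_inverse a : invertible a -> a * inverse a = 1.
Proof. by rewrite /inverse; case: pselect => // e _; case: (cid e). Qed.

Lemma mulVr_inverse a : invertible a -> inverse a * a = 1.
Proof. by rewrite mulrC; exact: mul_inverse. Qed.

Lemma invertible1 : invertible 1.
Proof. by exists 1; rewrite mul1r. Qed.

Lemma invertibleM a b : invertible a -> invertible b -> invertible (a * b).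
Proof. by move=> [c ac] [d bd]; exists (c * d); rewrite mulrACA ac bd mul1r. Qed.

Lemma invertibleN a : invertible a -> invertible (- a).
Proof. by move=> [c ac]; exists (- c); rewrite mulrNN. Qed.

Lemma invertible_inverse a : invertible a -> invertible (inverse a).
Proof. by move=> ua; exists a; exact: mulVr_inverse. Qed.

Lemma scaler_inj_invertible (V : lmodType R) a (x y : V) :
  invertible a -> a *: x = a *: y -> x = y.
Proof.
by move=> ua /(congr1 ( *:%R (inverse a))); rewrite !scalerA mulVr_inverse // !scale1r.
Qed.

End Invertible.

Section LinearExtension.

Variables (R : comNzRingType) (W : choiceType).
Implicit Types (v : {malg R[W]}) (w : W).

Definition lin (V : lmodType R) (f : W -> V) v : V :=
  \sum_(w <- msupp v) v@_w *: f w.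

Lemma linEw (V : lmodType R) (f : W -> V) (d : {fset W}) v :
  (msupp v `<=` d)%fset -> lin f v = \sum_(w <- d) v@_w *: f w.
Proof.
move=> vd; apply: big_fset_incl => // w _; rewrite -mcoeff_eq0 => /eqP ->.
by rewrite scale0r.
Qed.

Lemma lin_is_linear (V : lmodType R) (f : W -> V) : linear (lin f).
Proof.
move=> a v1 v2; pose d := (msupp v1 `|` msupp v2)%fset.
rewrite (@linEw _ _ d) ?(@linEw _ _ d v1) ?(@linEw _ _ d v2) /d ?fsubsetUl ?fsubsetUr //.
  rewrite scaler_sumr -big_split; apply: eq_bigr => w _ /=.
  by rewrite mcoeffD mcoeffZ scalerDl scalerA.
apply: (fsubset_trans (msuppD_le _ _)); apply: fsetSU; exact: msuppZ_le.
Qed.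

HB.instance Definition _ (V : lmodType R) (f : W -> V) :=
  GRing.isLinear.Build R {malg R[W]} V *:%R (lin f) (lin_is_linear f).

Lemma linU (V : lmodType R) (f : W -> V) w : lin f << w >> = f w.
Proof. by rewrite /lin msuppU oner_eq0 big_seq_fset1 mcoeffUU scale1r. Qed.

Lemma mcoeff_gen w w' : (<< w >> : {malg R[W]})@_w' = (w == w')%:R.
Proof. by rewrite mcoeffU. Qed.

Lemma malg_sumU v : v = \sum_(w <- msupp v) v@_w *: << w >>.
Proof.
rewrite {1}[v]monalgE; apply: eq_bigr => w _; apply/malgP => w'.
by rewrite mcoeffZ !mcoeffU; case: eqP => _; rewrite ?mulr1 ?mulr0.
Qed.

(** Only generators in the support of v have to be treated, so that a bound on the lengths occurring
    in v can be used. *)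
Lemma malg_linear_ind (K : {malg R[W]} -> Prop) v : K 0 ->
  (forall a v1 v2, K v1 -> K v2 -> K (a *: v1 + v2)) ->
  (forall w, v@_w != 0 -> K << w >>) -> K v.
Proof.
move=> K0 KP Kv; rewrite [v]malg_sumU big_seq.
apply: (big_rec K K0) => w x; rewrite -mcoeff_neq0 => vw; exact: KP (Kv w vw).
Qed.

Lemma eq_lin_supp (V : lmodType R) (f h : W -> V) v :
  (forall w, v@_w != 0 -> f w = h w) -> lin f v = lin h v.
Proof.
move=> fh; apply: eq_big_seq => w; rewrite -mcoeff_neq0 => vw.
by rewrite fh.
Qed.

Lemma linear_ext_supp (V : lmodType R) (f h : {linear {malg R[W]} -> V}) v :
  (forall w, v@_w != 0 -> f << w >> = h << w >>) -> f v = h v.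
Proof.
move=> fh; rewrite [v]malg_sumU !linear_sum; apply: eq_big_seq => w.
by rewrite -mcoeff_neq0 => vw; rewrite !linearZ /= fh.
Qed.

End LinearExtension.

(** * Chamber systems and the deformed regular representation *)

(** The combinatorics of W that the deformation uses: chambers are the elements, [refl i w] is s_i w
    and [len] is the word length, so descents are left descents. Three consecutive descents are
    excluded separately because they are pairwise adjacent when r = 3. *)
Record chamber_system (r : nat) (m : 'I_r -> nat) := ChamberSystem {
  chamber :> choiceType;
  refl : 'I_r -> chamber -> chamber;
  base : chamber;
  len : chamber -> nat;
  reflK : forall i, involutive (refl i);
  len_refl : forall i w, len (refl i w) = (len w).+1 \/ len w = (len (refl i w)).+1;
  len_base : len base = 0%N;
  len_eq0 : forall w, (forall i, (len w < len (refl i w))%N) -> w = base;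
  desc_adjacent : forall w i j, i != j ->
    (len (refl i w) < len w)%N -> (len (refl j w) < len w)%N ->
    j = ordS i \/ i = ordS j;
  no_three_desc : forall w i, (len (refl i w) < len w)%N ->
    (len (refl (ordS i) w) < len w)%N ->
    (len (refl (ordS (ordS i)) w) < len w)%N -> False;
  braid : forall i w, alt refl (m i) i (ordS i) w = alt refl (m i) (ordS i) i w;
  len_alt : forall i w n, (n <= m i)%N -> (len w < len (refl i w))%N ->
    (len w < len (refl (ordS i) w))%N ->
    len (alt refl n i (ordS i) w) = (len w + n)%N /\
    len (alt refl n (ordS i) i w) = (len w + n)%N;
  alt_bottom : forall i w, (len (refl i w) < len w)%N ->
    (len (refl (ordS i) w) < len w)%N ->
    let u := alt refl (m i) i (ordS i) w in
    (len u < len (refl i u))%N /\ (len u < len (refl (ordS i) u))%N }.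

(** * Corners of W: tops, bottoms and the two paths between them *)

Section Descents.

Variables (r : nat) (m : 'I_r -> nat) (W : chamber_system m).
Hypothesis m_gt1 : forall k, (1 < m k)%N.
Implicit Types (w t u : W) (i j k : 'I_r).

Local Notation s := (@refl r m W).
Local Notation len := (@len r m W).

Definition desc w i := (len (s i w) < len w)%N.

Lemma len_asc w i : ~~ desc w i -> len (s i w) = (len w).+1.
Proof. by rewrite /desc; case: (len_refl i w); lia. Qed.

Lemma len_desc w i : desc w i -> len w = (len (s i w)).+1.
Proof. by rewrite /desc; case: (len_refl i w); lia. Qed.

Lemma desc_refl w i : desc (s i w) i = ~~ desc w i.
Proof. by rewrite /desc reflK; case: (len_refl i w); lia. Qed.

Lemma odd_len_refl w i : odd (len (s i w)) = ~~ odd (len w).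
Proof. by case: (len_refl i w) => [->|->] //=; rewrite negbK. Qed.

Lemma exists_desc w : w <> base W -> exists i, desc w i.
Proof.
move=> wb; apply: contrapT => /forallNP nd; apply: wb; apply: len_eq0 => i.
by move/negP: (nd i) => /len_asc ->.
Qed.

Lemma odd_len_alt n i j w : odd (len (alt s n i j w)) = odd n (+) odd (len w).
Proof. by elim: n => //= n IHn; rewrite odd_len_refl IHn addNb. Qed.

(* Among two adjacent descents of t, the parity of t decides which one is     *)
(* used to reach t; the other one is called secondary, and is determined by   *)
(* the relation of the polygon {k, k+1}.                                      *)
Definition next_desc t i := if odd (len t) then ord_pred i else ordS i.
Definition secondary t i := desc t i && desc t (next_desc t i).
Definition polygon t i := if odd (len t) then ord_pred i else i.
Definition bottom t i := let k := polygon t i in alt s (m k) k (ordS k) t.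

(** Of the two reflections whose product is the rotation at k on elements of the parity of u, this
    is the one applied first. *)
Definition first_letter k u := if odd (len u) then k else ordS k.
Definition other_letter k u := if odd (len u) then ordS k else k.

Definition minimal k u := ~~ desc u k && ~~ desc u (ordS k).

Lemma len_alt_minimal k u n : minimal k u -> (n <= m k)%N ->
  len (alt s n (first_letter k u) (other_letter k u) u) = (len u + n)%N /\
  len (alt s n (other_letter k u) (first_letter k u) u) = (len u + n)%N.
Proof.
move=> /andP[uk uSk] nm.
have := @len_alt _ _ W k u n nm; rewrite !(len_asc uk, len_asc uSk).
move=> /(_ (leqnn _) (leqnn _)) [l1 l2].
by rewrite /first_letter /other_letter; case: odd.
Qed.

Lemma alt_top k t : desc t k -> desc t (ordS k) ->
  let u := alt s (m k) k (ordS k) t in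
  [/\ minimal k u, t = alt s (m k) (first_letter k u) (other_letter k u) u,
      t = alt s (m k) (other_letter k u) (first_letter k u) u &
      len t = (len u + m k)%N].
Proof.
move=> tk tSk u.
have mu : minimal k u.
  by rewrite /minimal /desc -!leqNgt; case: (alt_bottom tk tSk) => /ltnW -> /ltnW ->.
have t1 : t = alt s (m k) k (ordS k) u.
  rewrite -{1}[t](@altK _ _ s (m k) k (ordS k)); last exact: reflK.
  by case: odd => //; rewrite -braid.
have t2 : t = alt s (m k) (ordS k) k u by rewrite -braid.
have tt : [/\ t = alt s (m k) (first_letter k u) (other_letter k u) u &
      t = alt s (m k) (other_letter k u) (first_letter k u) u].
  by rewrite /first_letter /other_letter; case: odd.
case: tt => tt1 tt2; split=> //.
by have [<- _] := len_alt_minimal mu (leqnn _); rewrite -tt1.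
Qed.

(** Both alternating paths from the bottom u reach the top t after m k steps. The one starting with
    [first_letter] arrives through the secondary descent, the other one through its partner. *)
Lemma secondaryP t i : secondary t i ->
  let k := polygon t i in let u := bottom t i in
  let a := first_letter k u in let b := other_letter k u in
  [/\ minimal k u, t = alt s (m k) a b u, t = alt s (m k) b a u,
      len t = (len u + m k)%N &
      i = (if odd (m k).-1 then b else a) /\
      next_desc t i = (if odd (m k).-1 then a else b)].
Proof.
move=> /andP[ti tn] k u a b.
have [tk tSk] : desc t k /\ desc t (ordS k).
  by rewrite /k /polygon; move: tn; rewrite /next_desc; case: odd => //; rewrite ord_predK.
have [mu t1 t2 lt] := alt_top tk tSk; split=> //.
have := odd_len_alt (m k) k (ordS k) t; rewrite -/u => ou.
rewrite /a /b /first_letter /other_letter.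
have m0 : odd (m k).-1 = ~~ odd (m k) by have := m_gt1 k; case: (m k) => //= n _; rewrite negbK.
rewrite m0 /next_desc; have : k = polygon t i by [].
rewrite /polygon; move: ou; rewrite -/(bottom t i) -/u => ->.
by case: (odd (len t)) => ->; case: odd => /=; rewrite ?ord_predK.
Qed.

(** Otherwise t would have three consecutive descents. Hence the partner of a secondary descent is
    primary. *)
Lemma secondary_next t i : secondary t i -> secondary t (next_desc t i) = false.
Proof.
move=> /andP[ti]; rewrite /secondary /next_desc => t2.
apply/negP => /andP[_]; move: t2; case: odd => t2 t3.
  by have := @no_three_desc _ _ _ t (ord_pred (ord_pred i)); rewrite !ord_predK => H; apply: (H t3 t2 ti).
exact: (@no_three_desc _ _ _ t i).
Qed.

Lemma exists_primary t : t <> base W -> exists2 i, desc t i & ~~ secondary t i.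
Proof.
move=> /exists_desc[i ti]; case ti' : (secondary t i); last by exists i => //; rewrite ti'.
exists (next_desc t i); last by rewrite secondary_next.
by case/andP: ti'.
Qed.

(** Two distinct descents are adjacent, and in the direction selected by the parity of t one of them
    has the other as [next_desc]; that one is secondary. *)
Lemma primary_unique t i j : desc t i -> desc t j ->
  ~~ secondary t i -> ~~ secondary t j -> i = j.
Proof.
move=> ti tj; rewrite /secondary ti tj /next_desc /=.
have [//|ij] := eqVneq i j.
by case: (desc_adjacent ij ti tj) => E; rewrite E in ti tj *;
  case: odd; rewrite ?ordSK ?ti ?tj //.
Qed.

(** Converse to [secondaryP]: here the corner is given by its bottom, and c is the last letter of
    the path starting with [first_letter]. *)
Lemma bottom_eq k u : minimal k u ->
  let t := alt s (m k) (first_letter k u) (other_letter k u) u in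
  let c := if odd (m k).-1 then other_letter k u else first_letter k u in
  [/\ secondary t c, polygon t c = k, bottom t c = u &
    refl c t = alt s (m k).-1 (first_letter k u) (other_letter k u) u].
Proof.
move=> mu t c.
have [lt _] := len_alt_minimal mu (leqnn _); rewrite -/t in lt.
have mk : m k = (m k).-1.+1 by have := m_gt1 k; lia.
have [l1 l2] := @len_alt_minimal k u (m k).-1 mu (leq_pred _).
have tE : t = s c (alt s (m k).-1 (first_letter k u) (other_letter k u) u).
  by rewrite /t mk.
pose c' := if odd (m k).-1 then first_letter k u else other_letter k u.
have tE2 : t = alt s (m k) (other_letter k u) (first_letter k u) u.
  by rewrite /t /first_letter /other_letter; case: odd; rewrite braid.
have tE' : t = s c' (alt s (m k).-1 (other_letter k u) (first_letter k u) u).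
  by rewrite tE2 mk.
have tc : desc t c by rewrite tE desc_refl /desc -tE l1 lt; lia.
have tc' : desc t c' by rewrite tE' desc_refl /desc -tE' l2 lt; lia.
have ot : odd (len t) = odd (m k) (+) odd (len u) by rewrite odd_len_alt.
have om : odd (m k) = ~~ odd (m k).-1 by rewrite {1}mk.
have nc : next_desc t c = c'.
  rewrite /next_desc /c /c' ot om /first_letter /other_letter.
  by case: (odd (m k).-1) (odd (len u)) => -[] /=; rewrite ?ordSK.
have pc : polygon t c = k.
  rewrite /polygon /c ot om /first_letter /other_letter.
  by case: (odd (m k).-1) (odd (len u)) => -[] /=; rewrite ?ordSK.
split=> //; first by rewrite /secondary tc nc.
  rewrite /bottom pc.
  have := @altK _ _ s (m k) (first_letter k u) (other_letter k u) u (@reflK _ _ W).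
  rewrite -/t; case: odd; rewrite /first_letter /other_letter; case: odd => //.
  - by rewrite -braid.
  - by rewrite -braid.
by rewrite tE reflK.
Qed.

End Descents.

(* A point of the line ..., Y_(-1), Y_0 = v, Y_1, ... on which g_a and g_b act  *)
(* as the two reflections swapping Y_0 with Y_1 and with Y_(-1): this is        *)
(* Y_(2q - n).                                                                  *)
Definition line (I A : Type) (g : I -> A -> A) (n : nat) (a b : I) (q : nat) (v : A) :=
  if (n <= q.*2)%N then alt g (q.*2 - n) a b v else alt g (n - q.*2) b a v.

Lemma line0 (I A : Type) (g : I -> A -> A) n a b v : line g n a b 0 v = alt g n b a v.
Proof. by rewrite /line leqn0 double0 subn0; case: n. Qed.

(** * Filtration by length and leading terms *)

Section Filtration.

Variables (r : nat) (m : 'I_r -> nat) (W : chamber_system m) (R : comNzRingType).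
Local Notation M := {malg R[W]}.
Local Notation len := (@len r m W).
Implicit Types (v y : M) (w x : W).

Definition low n v := forall w, v@_w != 0 -> (len w < n)%N.

Lemma low0 n : low n 0.
Proof. by move=> w; rewrite mcoeff0 eqxx. Qed.

Lemma lowD n v y : low n v -> low n y -> low n (v + y).
Proof.
move=> lv ly w; have [v0|/lv//] := eqVneq (v@_w) 0.
by rewrite mcoeffD v0 add0r => /ly.
Qed.

Lemma lowZ n a v : low n v -> low n (a *: v).
Proof.
move=> lv w; have [v0|/lv//] := eqVneq (v@_w) 0.
by rewrite mcoeffZ v0 mulr0 eqxx.
Qed.

Lemma lowN n v : low n v -> low n (- v).
Proof. by move=> lv; rewrite -scaleN1r; exact: lowZ. Qed.

Lemma lowB n v y : low n v -> low n y -> low n (v - y).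
Proof. by move=> lv ly; apply: lowD => //; exact: lowN. Qed.

Lemma low_sum n (I : Type) (rr : seq I) (P : pred I) (f : I -> M) :
  (forall i, P i -> low n (f i)) -> low n (\sum_(i <- rr | P i) f i).
Proof. by move=> lf; apply: (big_ind (low n)) => //; [exact: low0 | exact: lowD]. Qed.

Lemma low_leq n k v : (n <= k)%N -> low n v -> low k v.
Proof. by move=> nk lv w /lv wn; exact: leq_trans wn nk. Qed.

Lemma lowU w n : (len w < n)%N -> low n << w >>.
Proof. by move=> wn x; rewrite mcoeff_gen; case: (w =P x) => [<-|]; rewrite ?eqxx. Qed.

Lemma low_lin n k (f : W -> M) v : low n v ->
  (forall w, (len w < n)%N -> low k (f w)) -> low k (lin f v).
Proof.
move=> lv lf; rewrite /lin big_seq; apply: low_sum => w.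
by rewrite -mcoeff_neq0 => /lv wn; apply/lowZ/lf.
Qed.

Lemma eq_lin_low n (V : lmodType R) (f h : W -> V) v : low n v ->
  (forall w, (len w < n)%N -> f w = h w) -> lin f v = lin h v.
Proof. by move=> lv fh; apply: eq_lin_supp => w /lv /fh. Qed.

(** Up to a unit, v may replace [<< x >>] in an induction on length, since all its other terms are
    strictly shorter. *)
Definition lead x v := invertible v@_x /\ low (len x) (v - v@_x *: << x >>).

Lemma leadI x a v : invertible a -> low (len x) (v - a *: << x >>) -> lead x v.
Proof.
move=> ua lv; have aE : v@_x = a.
  apply/eqP; rewrite -subr_eq0; apply: contraT => va.
  have := lv x; rewrite mcoeffB mcoeffZ mcoeff_gen eqxx mulr1 => /(_ va).
  by rewrite ltnn.
by rewrite /lead aE.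
Qed.

Lemma leadU x : lead x << x >>.
Proof. by apply: (@leadI x 1); [exact: invertible1 | rewrite scale1r subrr; exact: low0]. Qed.

Lemma lead_low x v : lead x v -> low (len x).+1 v.
Proof.
move=> [_ lv]; rewrite -[v](subrK (v@_x *: << x >>)); apply: lowD.
  exact: low_leq lv.
by apply/lowZ/lowU.
Qed.

Lemma lead_add_low x v y : lead x v -> low (len x) y -> lead x (v + y).
Proof.
by move=> [uv lv] ly; apply: (leadI uv); rewrite addrAC; exact: lowD.
Qed.

Lemma leadZ x a v : invertible a -> lead x v -> lead x (a *: v).
Proof.
move=> ua [uv lv]; apply: (leadI (invertibleM ua uv)).
by rewrite -scalerA -scalerBr; exact: lowZ.
Qed.

Lemma leadN x v : lead x v -> lead x (- v).
Proof.
by rewrite -scaleN1r; apply: leadZ; apply: invertibleN; exact: invertible1.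
Qed.

End Filtration.

(** * The deformed reflections and their triangularity *)

Section Representation.

Variables (r : nat) (m : 'I_r -> nat) (W : chamber_system m).
Hypothesis m_gt1 : forall k, (1 < m k)%N.
Variables (R : comNzRingType) (p : 'I_r -> nat -> R).
Hypothesis p_monic : forall k, p k (m k) = 1.
Hypothesis p0_inv : forall k, invertible (p k 0).

Local Notation M := {malg R[W]}.
Local Notation s := (@refl r m W).
Local Notation len := (@len r m W).
Implicit Types (v y : M) (w x t u : W) (i j k : 'I_r).

(** The missing term q = m k has coefficient 1, so the relation at u says that this term is minus
    [line_sum]. *)
Definition line_sum (g : 'I_r -> M -> M) k u : M :=
  \sum_(q < m k) p k q *: line g (m k) (first_letter k u) (other_letter k u) q << u >>.

(** The first two cases solve an equation for S_i w. At a descent it is S_i (S_i t) = t, where y =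
    S_i t leads with w. At a secondary ascent, y is the point Y_(m-1) of the line, it leads with w,
    and the relation at the bottom prescribes S_i y = Y_m. Primary ascents stay undeformed. *)
Definition step (z : W * 'I_r) (f : W * 'I_r -> M) : M :=
  let: (w, i) := z in
  let g j := lin (fun x => f (x, j)) in
  let t := s i w in
  if desc w i then
    let y := g i << t >> in
    inverse y@_w *: (<< t >> - g i (y - y@_w *: << w >>))
  else if secondary t i then
    let k := polygon t i in
    let u := bottom t i in
    let y := alt g (m k).-1 (first_letter k u) (other_letter k u) << u >> in
    inverse y@_w *: (- line_sum g k u - g i (y - y@_w *: << w >>))
  else << t >>.

(** The extra unit puts a secondary edge after the primary edge into the same top: that edge occurs
    in the relation and starts at an element of the same length. *)
Definition rank (z : W * 'I_r) : nat :=
  (len z.1).*2 + (~~ desc z.1 z.2 && secondary (s z.2 z.1) z.2).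

Definition act_fun : W * 'I_r -> M :=
  projT1 (cid (rec_fixpoint rank 0 step)).

Lemma act_funE z :
  act_fun z = step z (fun z' => if (rank z' < rank z)%N then act_fun z' else 0).
Proof. by rewrite /act_fun; case: cid. Qed.

Definition act i : {linear M -> M} := lin (fun w => act_fun (w, i)).
#[global] Arguments act : simpl never.

Lemma actU i w : act i << w >> = act_fun (w, i).
Proof. exact: linU. Qed.

(** The induction hypothesis under which the coefficients inverted in [step] are units. *)
Definition tame n := forall w i, (len w < n)%N ->
  low (len w).+2 (act_fun (w, i)) /\
  (~~ desc w i -> lead (s i w) (act_fun (w, i))).

Lemma tame_leq n d : (d <= n)%N -> tame n -> tame d.
Proof. by move=> kn tn w i wk; apply: tn; exact: leq_trans wk kn. Qed.

Lemma low_act n d v i : tame n -> (d <= n)%N -> low d v -> low d.+1 (act i v).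
Proof.
move=> tn kn lv; apply: (low_lin lv) => w wk.
by have [lw _] := tn w i (leq_trans wk kn); apply: low_leq lw.
Qed.

Lemma lead_act n x v i : tame n -> (len x < n)%N -> ~~ desc x i ->
  lead x v -> lead (s i x) (act i v).
Proof.
move=> tn xn xi [uv lv]; rewrite -[v](subrK (v@_x *: << x >>)) addrC linearD linearZ /=.
apply: lead_add_low.
  rewrite actU; exact: leadZ uv ((tn x i xn).2 xi).
rewrite len_asc //; apply: (low_act tn _ lv); exact: ltnW.
Qed.

Lemma lead_alt_act n k u d : tame n -> minimal k u -> (d <= m k)%N -> (len u + d <= n)%N ->
  let a := first_letter k u in let b := other_letter k u in
  lead (alt s d a b u) (alt act d a b << u >>) /\
  lead (alt s d b a u) (alt act d b a << u >>).
Proof.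
move=> tn mu dm dn a b; elim: d dm dn => [|d IHd] dm dn.
  by split; exact: leadU.
have [l1 l2] := IHd (ltnW dm) (leq_trans (leq_add (leqnn _) (leqnSn d)) dn).
have [e1 e2] := len_alt_minimal mu (ltnW dm).
have [f1 f2] := len_alt_minimal mu dm.
rewrite -/a -/b in e1 e2 f1 f2.
have a1 : ~~ desc (alt s d a b u) (if odd d then b else a).
  by rewrite /desc -[s _ _]/(alt s d.+1 a b u) f1 e1; lia.
have a2 : ~~ desc (alt s d b a u) (if odd d then a else b).
  by rewrite /desc -[s _ _]/(alt s d.+1 b a u) f2 e2; lia.
have xn1 : (len (alt s d a b u) < n)%N by rewrite e1; lia.
have xn2 : (len (alt s d b a u) < n)%N by rewrite e2; lia.
by split; [exact: (lead_act tn xn1 a1 l1) | exact: (lead_act tn xn2 a2 l2)].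
Qed.

(* Values of the recursion that are large enough to be cut off do not occur. *)
Lemma act_truncE (n : nat) (z : W * 'I_r) (v : M) i : ((n.*2 <= rank z)%N) -> low n v ->
  lin (fun x => if (rank (x, i) < rank z)%N then act_fun (x, i) else 0) v = act i v.
Proof.
move=> nz lv; apply: (eq_lin_low lv) => w wn; rewrite ifT //.
by apply: leq_trans nz; rewrite /rank /=; case: (_ && _); lia.
Qed.

Lemma rank_ge w i : ((len w).*2 <= rank (w, i))%N.
Proof. by rewrite /rank /= leq_addr. Qed.

Lemma act_primary w i : ~~ desc w i -> ~~ secondary (s i w) i ->
  act i << w >> = << s i w >>.
Proof. by move=> wi ti; rewrite actU act_funE /= (negbTE wi) (negbTE ti). Qed.

Lemma act_desc w i : tame (len w) -> desc w i ->
  let y := act i << s i w >> in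
  lead w y /\
  act i << w >> = inverse y@_w *: (<< s i w >> - act i (y - y@_w *: << w >>)).
Proof.
move=> tw wi y; have ltw : (len (s i w) < len w)%N by rewrite (len_desc wi).
have ly : lead w y.
  by rewrite -[w in lead w](reflK i w); apply: (lead_act tw) => //;
     [rewrite desc_refl wi | exact: leadU].
split=> //; rewrite actU act_funE /= wi.
rewrite !(act_truncE _ (rank_ge w i)) //; last exact: lowU.
by case: ly.
Qed.

Lemma alt_trunc n k u d (z : W * 'I_r) : tame n -> minimal k u -> (d <= m k)%N ->
  (len u + d <= n)%N -> (n.*2 <= rank z)%N ->
  let g j := lin (fun x => if (rank (x, j) < rank z)%N then act_fun (x, j) else 0) in
  let a := first_letter k u in let b := other_letter k u in
  alt g d a b << u >> = alt act d a b << u >> /\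
  alt g d b a << u >> = alt act d b a << u >>.
Proof.
move=> tn mu dm dn nz g a b; elim: d dm dn => // d IHd dm dn.
have dn' : (len u + d <= n)%N by lia.
have [e1 e2] := IHd (ltnW dm) dn'.
have [l1 l2] := lead_alt_act tn mu (ltnW dm) dn'.
have [f1 f2] := len_alt_minimal mu (ltnW dm).
move: l1 l2 => /lead_low; rewrite f1 => l1 /lead_low; rewrite f2 => l2.
by rewrite /= e1 e2; split; rewrite /g (act_truncE _ nz) //;
  [apply: low_leq l1 | apply: low_leq l2]; lia.
Qed.

Lemma act_secondary w i : tame (len w) -> ~~ desc w i -> secondary (s i w) i ->
  let t := s i w in let k := polygon t i in let u := bottom t i in
  let y := alt act (m k).-1 (first_letter k u) (other_letter k u) << u >> in
  lead w y /\
  act i << w >> = inverse y@_w *: (- line_sum act k u - act i (y - y@_w *: << w >>)).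
Proof.
move=> tw wi ti t k u y.
have [mu t1 t2 lt [iE nE]] := secondaryP m_gt1 ti.
rewrite -/t -/k -/u in mu t1 t2 lt iE nE.
have lwt : len t = (len w).+1 by rewrite len_asc.
have mk := m_gt1 k.
have mkE : m k = (m k).-1.+1 by lia.
have luw : (len u + (m k).-1 <= len w)%N by lia.
have [l1 l2] := lead_alt_act tw mu (leq_pred _) luw.
have wE : w = alt s (m k).-1 (first_letter k u) (other_letter k u) u.
  by move: t1; rewrite mkE /= -iE -{1}[t]/(s i w) => /(can_inj (reflK i)).
have ly : lead w y by rewrite [w in lead w]wE; exact: l1.
have rz := rank_ge w i.
split=> //; rewrite actU act_funE /= (negbTE wi) ti -/t -/k -/u.
have [-> _] := alt_trunc tw mu (leq_pred _) luw rz.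
rewrite -/y (act_truncE _ rz); last by case: ly.
pose g j := lin (fun x => if (rank (x, j) < rank (w, i))%N then act_fun (x, j) else 0).
suff E : line_sum g k u = line_sum act k u by rewrite E.
apply: eq_bigr => q _; apply: (congr1 ( *:%R _)).
have qm : (q < m k)%N by [].
rewrite /line; case: leqP => mq.
  have d1 : (q.*2 - m k <= m k)%N by lia.
  have d2 : (len u + (q.*2 - m k) <= len w)%N by lia.
  by have [-> _] := alt_trunc tw mu d1 d2 rz.
have [q0|q0] := posnP q; last first.
  have d1 : (m k - q.*2 <= m k)%N by lia.
  have d2 : (len u + (m k - q.*2) <= len w)%N by lia.
  by have [_ ->] := alt_trunc tw mu d1 d2 rz.
(* The term q = 0 ends with the primary edge into t. It starts at s_j t, which is as long as w, so
   only the extra unit in [rank] keeps it below the cut-off. *)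
rewrite q0 subn0 mkE /= -nE.
have [_ ->] := alt_trunc tw mu (leq_pred _) luw rz.
set j := next_desc t i; set v := alt _ _ _ _ _.
have jx : s j t = alt s (m k).-1 (other_letter k u) (first_letter k u) u.
  by rewrite t2 {1}mkE /= -nE reflK.
have lv : lead (s j t) v by rewrite jx; exact: l2.
have tj : desc t j by case/andP: ti.
apply: eq_lin_supp => x vx; rewrite ifT //.
have [xE|xj] := eqVneq x (s j t).
  rewrite /rank /= wi -/t ti xE reflK /j (secondary_next ti) andbF addn0 addn1.
  by have := len_desc tj; rewrite -/j; lia.
have : (len x < len (s j t))%N.
  case: lv => _ /(_ x); rewrite mcoeffB mcoeffZ mcoeff_gen [s j t == x]eq_sym (negbTE xj) mulr0 subr0.
  by apply.
by have := len_desc tj; rewrite /rank /=; case: (_ && _); lia.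
Qed.

(** In the secondary case the term q = 0 of [line_sum] enters t through a primary edge, hence leads
    with t and a unit multiple of p_k(0). For 0 < q < m k the point Y_(2q-m) stays at least two
    steps below t. *)
Lemma tame_all n : tame n.
Proof.
elim: n => // n IHn w i; rewrite ltnS => wn.
have tw := tame_leq wn IHn; rewrite -!actU.
have [wi|wi] := boolP (desc w i).
  have [[uy ly] ->] := act_desc tw wi; split=> //.
  apply/lowZ/lowB; first by apply: lowU; rewrite (len_desc wi); lia.
  by apply: (@low_leq _ _ _ _ (len w).+1) => //; exact: (low_act tw (leqnn _) ly).
suff l : lead (s i w) (act i << w >>).
  by split=> //; have := lead_low l; rewrite len_asc.
have [ti|ti] := boolP (secondary (s i w) i); last first.
  by rewrite act_primary //; exact: leadU.
have [[uy ly] ->] := act_secondary tw wi ti.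
set t := s i w in ti *; set k := polygon t i in uy ly *; set u := bottom t i in uy ly *.
have [mu t1 t2 lt [iE nE]] := secondaryP m_gt1 ti.
rewrite -/t -/k -/u in mu t1 t2 lt iE nE.
have lwt : len t = (len w).+1 by rewrite len_asc.
apply: leadZ; first exact: invertible_inverse.
apply: lead_add_low; last first.
  by apply: lowN; rewrite lwt; exact: (low_act tw (leqnn _) ly).
apply: leadN; rewrite /line_sum.
have mk := m_gt1 k.
have -> : m k = (m k).-1.+1 by lia.
have mkE : m k = (m k).-1.+1 by lia.
have luw : (len u + (m k).-1 <= len w)%N by lia.
have [l1 l2] := lead_alt_act tw mu (leq_pred _) luw.
rewrite big_ord_recl; apply: lead_add_low.
  apply: leadZ; first exact: p0_inv.
  rewrite (line0 act (m k).-1.+1) /=.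
  set x := alt s _ _ _ _ in l2.
  have tE : t = s (next_desc t i) x by rewrite {1}t2 mkE /= -nE.
  have lx : len t = (len x).+1.
    by have [_] := len_alt_minimal mu (leq_pred _); rewrite -/x lt => ->; lia.
  have tn : desc t (next_desc t i) by case/andP: ti.
  have xn : ~~ desc x (next_desc t i) by move: tn; rewrite {1}tE desc_refl.
  have xt : ~~ secondary (s (next_desc t i) x) (next_desc t i).
    by rewrite -tE (secondary_next ti).
  rewrite -nE; case: l2; move: (alt act _ _ _ _) => v uv lv.
  have -> : v = v@_x *: << x >> + (v - v@_x *: << x >>) by rewrite addrC subrK.
  rewrite linearD linearZ (act_primary xn xt) -tE.
  have lt' := leadZ uv (@leadU _ _ W R t).
  apply: (lead_add_low lt').
  have lv' : low (len x).+1 (act (next_desc t i) (v - v@_x *: << x >>)).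
    by apply: (low_act tw _ lv); lia.
  by rewrite lx.
apply: low_sum => q _; apply: lowZ; rewrite lwt /line lift0.
have qm : (q.+1 < m k)%N by have := ltn_ord q; lia.
rewrite -mkE; case: leqP => mq.
  have d1 : (q.+1.*2 - m k <= m k)%N by lia.
  have d2 : (len u + (q.+1.*2 - m k) <= len w)%N by lia.
  have [l3 _] := lead_alt_act tw mu d1 d2.
  have [f1 _] := len_alt_minimal mu d1.
  by apply: low_leq (lead_low l3); rewrite f1; lia.
have d1 : (m k - q.+1.*2 <= m k)%N by lia.
have d2 : (len u + (m k - q.+1.*2) <= len w)%N by lia.
have [_ l3] := lead_alt_act tw mu d1 d2.
have [_ f1] := len_alt_minimal mu d1.
by apply: low_leq (lead_low l3); rewrite f1; lia.
Qed.

End Representation.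

#[global] Arguments act : simpl never.

(** * Polynomial relations along a line of alternating reflections *)

Section Line.

Variables (R : comNzRingType) (V : lmodType R) (I : Type) (g : I -> {linear V -> V}).
Variables (C : {linear V -> V}) (a b : I) (v : V).
Hypothesis gK : forall i, involutive (g i).
Hypothesis Ca : forall x, C (g a x) = g a (C x).
Hypothesis Cb : forall x, C (g b x) = g b (C x).
Hypothesis Cv : C v = g b (g a v).

Lemma comm_alt (F : V -> V) n x : (forall x, F (g a x) = g a (F x)) ->
  (forall x, F (g b x) = g b (F x)) ->
  F (alt g n a b x) = alt g n a b (F x) /\ F (alt g n b a x) = alt g n b a (F x).
Proof.
move=> Fa Fb; elim: n => //= n [<- <-].
by case: (odd n); rewrite ?Fa ?Fb.
Qed.

(** C shifts the line by two, from Y_i to Y_(i+2), and the starting point is Y_(-n). The two middle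
    cases are the crossings from Y_(-1) to Y_1 and from Y_(-2) to Y_0. *)
Lemma line_iter n q : iter q C (alt g n b a v) = line g n a b q v.
Proof.
elim: q => [|q /= ->]; first by rewrite line0.
have Calt d := comm_alt d v Ca Cb.
rewrite /line; case: (leqP n q.*2) => nq.
  rewrite ifT; last by rewrite doubleS; lia.
  have -> : (q.+1.*2 - n = (q.*2 - n).+2)%N by rewrite doubleS; lia.
  by rewrite (Calt _).1 Cv !altSr.
case: (leqP n q.+1.*2) => nq'.
  have [nE|nE] : (n = q.*2.+1 \/ n = q.*2.+2)%N by rewrite doubleS in nq'; lia.
    have -> : (n - q.*2 = 1)%N by lia.
    have -> : (q.+1.*2 - n = 1)%N by rewrite doubleS; lia.
    by rewrite /= Cb Cv gK.
  have -> : (n - q.*2 = 2)%N by lia.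
  have -> : (q.+1.*2 - n = 0)%N by rewrite doubleS; lia.
  by rewrite /= Ca Cb Cv !gK.
have -> : (n - q.*2 = (n - q.+1.*2).+2)%N by rewrite doubleS; lia.
by rewrite (Calt _).2 Cv !altSr !gK.
Qed.

Definition poly_act (p : nat -> R) n (F : V -> V) x := \sum_(q < n.+1) p q *: iter q F x.

Lemma poly_act_comm p n (F : V -> V) (h : {linear V -> V}) x :
  (forall x, F (h x) = h (F x)) -> poly_act p n F (h x) = h (poly_act p n F x).
Proof.
move=> Fh; rewrite /poly_act linear_sum; apply: eq_bigr => q _.
rewrite linearZZ; congr (_ *: _); elim: {q}(nat_of_ord q) => //= q IHq.
by rewrite IHq Fh.
Qed.

(** Alternating products of the g's are bijective and commute with C. Applying the one of length n
    moves the points Y_0, Y_2, ..., Y_(2n) to the symmetric range from Y_(-n) to Y_n. *)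
Lemma poly_act_line p n :
  poly_act p n C v = 0 <-> \sum_(q < n.+1) p q *: line g n a b q v = 0.
Proof.
have -> : \sum_(q < n.+1) p q *: line g n a b q v = alt g n b a (poly_act p n C v).
  have Fc : forall x, poly_act p n C (g a x) = g a (poly_act p n C x).
    by move=> x; exact: poly_act_comm.
  have Fc' : forall x, poly_act p n C (g b x) = g b (poly_act p n C x).
    by move=> x; exact: poly_act_comm.
  rewrite -(comm_alt n v Fc Fc').2.
  by apply: eq_bigr => q _; rewrite line_iter.
elim: n {-2}(n) => // n IHn k; rewrite IHn /=; split=> [->|]; first by rewrite linear0.
by move=> /(congr1 (g (if odd n then a else b))); rewrite gK linear0.
Qed.

End Line.

Section Action.

Variables (r : nat) (m : 'I_r -> nat) (R : comNzRingType) (p : 'I_r -> nat -> R).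

(** The rotation is a separate linear map because neither product of two reflections is right on
    both parities; the map so defined commutes with both reflections of its corner. *)
Record polygonal_action (V : lmodType R) := PolygonalAction {
  pa_refl : 'I_r -> {linear V -> V};
  pa_rot : 'I_r -> {linear V -> V};
  pa_parity : bool -> V -> Prop;
  pa_reflK : forall i, involutive (pa_refl i);
  pa_rot_refl : forall k x, pa_rot k (pa_refl k x) = pa_refl k (pa_rot k x);
  pa_rot_reflS : forall k x,
    pa_rot k (pa_refl (ordS k) x) = pa_refl (ordS k) (pa_rot k x);
  pa_parity_refl : forall b i x, pa_parity b x -> pa_parity (~~ b) (pa_refl i x);
  pa_rotE : forall b k x, pa_parity b x -> pa_rot k x =
    if b then pa_refl (ordS k) (pa_refl k x) else pa_refl k (pa_refl (ordS k) x);
  pa_rel : forall k x, poly_act (p k) (m k) (pa_rot k) x = 0 }.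

Lemma pa_line (V : lmodType R) (A : polygonal_action V) k (e : bool) x :
  pa_parity A e x ->
  \sum_(q < (m k).+1) p k q *:
    line (pa_refl A) (m k) (if e then k else ordS k) (if e then ordS k else k) q x = 0.
Proof.
move=> ex; apply/(poly_act_line (C := pa_rot A k)).
- exact: pa_reflK.
- by case: (e) => y; [exact: pa_rot_refl | exact: pa_rot_reflS].
- by case: (e) => y; [exact: pa_rot_reflS | exact: pa_rot_refl].
- by rewrite (pa_rotE k ex); case: (e).
- exact: pa_rel.
Qed.

End Action.

(** * Relations of the deformed module and its universal property *)

Section Universal.

Variables (r : nat) (m : 'I_r -> nat) (W : chamber_system m).
Hypothesis m_gt1 : forall k, (1 < m k)%N.
Variables (R : comNzRingType) (p : 'I_r -> nat -> R).
Hypothesis p_monic : forall k, p k (m k) = 1.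
Hypothesis p0_inv : forall k, invertible (p k 0).

Local Notation M := {malg R[W]}.
Local Notation s := (@refl r m W).
Local Notation len := (@len r m W).
Local Notation act := (@act r m W R p).
Implicit Types (v y : M) (w x t u : W) (i j k : 'I_r).

Lemma tame_act n : tame W p n.
Proof. exact: (@tame_all r m W m_gt1 R p p0_inv n). Qed.
Arguments tame_act : clear implicits.

Lemma act_descE w i : desc w i ->
  let y := act i << s i w >> in let a := y@_w in
  [/\ invertible a, low (len w) (y - a *: << w >>) &
    act i << w >> = inverse a *: (<< s i w >> - act i (y - a *: << w >>))].
Proof. by move=> wi y a; have [[]] := act_desc (tame_act _) wi. Qed.

(** The descent case of [step] is the equation S_i (S_i t) = t solved for S_i w. Induction on length
    disposes of the shorter terms, and an ascent is treated through the descent at s_i w. *)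
Lemma actK i : involutive (act i).
Proof.
suff H n w : (len w < n)%N -> act i (act i << w >>) = << w >>.
  move=> v; apply: (@linear_ext_supp _ _ _ (act i \o act i) idfun) => w _.
  exact: (H (len w).+1).
elim: n w => // n IHn w wn.
have IH v : low (len w) v -> act i (act i v) = v.
  move=> lv; apply: (@linear_ext_supp _ _ _ (act i \o act i) idfun) => x /lv xw.
  by apply: IHn; lia.
have [wi|wi] := boolP (desc w i).
  have := act_descE wi; set y := act i << s i w >>; set a := y@_w; move=> [ua ly ->].
  rewrite linearZZ linearB -/y (IH _ ly).
  by rewrite opprB addrC subrK scalerA mulVr_inverse // scale1r.
have ti : desc (s i w) i by rewrite desc_refl.
have := act_descE ti; rewrite reflK; set y := act i << w >>; set a := y@_(s i w).
move=> [ua ly tE]; have yE : y = (y - a *: << s i w >>) + a *: << s i w >> by rewrite subrK.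
by rewrite {1}yE linearD [act i (a *: _)]linearZZ tE scalerA mul_inverse // scale1r addrC subrK.
Qed.

(** A linear property known for shorter elements and for primary edges holds along both paths of a
    corner, up to the secondary edge: the path starting with b may use its last step, which is
    primary up to shorter terms, while the path starting with a may not. *)
Lemma act_line_ind (K : 'I_r -> M -> Prop) w i :
  (forall j a v y, K j v -> K j y -> K j (a *: v + y)) ->
  (forall x j, (len x < len w)%N -> K j << x >>) ->
  (forall x j, ~~ desc x j -> ~~ secondary (s j x) j -> K j << x >>) ->
  ~~ desc w i -> secondary (s i w) i ->
  let t := s i w in let k := polygon t i in let u := bottom t i in
  let a := first_letter k u in let b := other_letter k u in
  forall d, ((d < (m k).-1)%N -> K (if odd d then b else a) (alt act d a b << u >>)) /\
    ((d < m k)%N -> K (if odd d then a else b) (alt act d b a << u >>)).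
Proof.
move=> KP Klow Kprim wi ti t k u a b d.
have [mu t1 t2 lt [iE nE]] := secondaryP m_gt1 ti.
rewrite -/t -/k -/u -/a -/b in mu t1 t2 lt iE nE.
have lwt : len t = (len w).+1 by rewrite len_asc.
have mk := m_gt1 k.
have Kw j n v : (n <= len w)%N -> low n v -> K j v.
  move=> nw lv; apply: malg_linear_ind.
  - have x0 : K j << u >> by apply: Klow; lia.
    by have := KP j (-1) _ _ x0 x0; rewrite scaleN1r addNr.
  - exact: KP.
  - move=> x /lv xn; apply: Klow; exact: leq_trans xn nw.
split=> dm.
  have d1 : (d <= m k)%N by lia.
  have [l1 _] := lead_alt_act (tame_act _) mu d1 (leqnn (len u + d)).
  have [f1 _] := len_alt_minimal mu d1.
  by apply: (Kw _ (len u + d).+1); [lia | rewrite -f1; exact: lead_low].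
have [_ f1] := len_alt_minimal mu (ltnW dm).
have [_ l1] := lead_alt_act (tame_act _) mu (ltnW dm) (leqnn (len u + d)).
rewrite -/a -/b in f1 l1.
have [dE|dE] := eqVneq d (m k).-1; last first.
  by apply: (Kw _ (len u + d).+1); [lia | rewrite -f1; exact: lead_low].
set v := alt act _ _ _ _ in l1 *; set x := alt s _ _ _ _ in f1 l1.
have mkE : m k = d.+1 by lia.
have -> : (if odd d then a else b) = next_desc t i by rewrite nE dE.
have tE : t = s (next_desc t i) x by rewrite {1}t2 mkE /= nE -dE.
have tn : desc t (next_desc t i) by case/andP: ti.
case: l1 => ux lx; rewrite -[v](subrK (v@_x *: << x >>)) addrC; apply: KP.
  apply: Kprim.
    by move: tn; rewrite {1}tE desc_refl.
  by rewrite -tE (secondary_next ti).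
apply: (Kw _ _ _ _ lx); lia.
Qed.

Definition even_part : {linear M -> M} :=
  lin (fun w => if odd (len w) then 0 else << w >>).

Lemma even_partU w : even_part << w >> = if odd (len w) then 0 else << w >>.
Proof. exact: linU. Qed.

Definition parity (b : bool) v := even_part v = if b then 0 else v.

Lemma parityU w : parity (odd (len w)) << w >>.
Proof. by rewrite /parity even_partU. Qed.

Lemma parityZD b a v y : parity b v -> parity b y -> parity b (a *: v + y).
Proof.
by rewrite /parity linearPZ => -> ->; case: b; rewrite ?scaler0 ?addr0.
Qed.

Lemma parity0 b : parity b 0.
Proof. by rewrite /parity linear0; case: b. Qed.

Lemma parityZ b a v : parity b v -> parity b (a *: v).
Proof. by move=> bv; have := parityZD a bv (parity0 b); rewrite addr0. Qed.

Lemma parityD b v y : parity b v -> parity b y -> parity b (v + y).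
Proof. by move=> bv; have := parityZD 1 bv; rewrite scale1r; apply. Qed.

Lemma parityN b v : parity b v -> parity b (- v).
Proof. by rewrite -scaleN1r; exact: parityZ. Qed.

(** Expressed through a projection, the exchange of parities is one linear identity and can be
    checked on generators, by induction on length through the cases of [step]. *)
Lemma even_part_act i v : even_part (act i v) = act i (v - even_part v).
Proof.
suff H n w j : (len w < n)%N -> parity (~~ odd (len w)) (act j << w >>).
  pose f : {linear M -> M} := even_part \o act i.
  pose h : {linear M -> M} := act i \o (idfun \- even_part).
  apply: (@linear_ext_supp _ _ _ f h) => w _.
  change (even_part (act i << w >>) = act i (<< w >> - even_part << w >>)).
  rewrite (H (len w).+1) // parityU; case: odd => /=; first by rewrite subr0.
  by rewrite subrr linear0.
elim: n w j {i v} => // n IHn w j wn.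
pose K j v := even_part (act j v) = act j (v - even_part v).
have KP i' a v1 v2 : K i' v1 -> K i' v2 -> K i' (a *: v1 + v2).
  move=> h1 h2; rewrite /K [in LHS]linearPZ [in LHS]linearPZ h1 h2 -linearPZ.
  by apply: congr1; rewrite linearPZ opprD addrACA -scalerBr.
have Kgen i' x : parity (~~ odd (len x)) (act i' << x >>) -> K i' << x >>.
  rewrite /K => ->; rewrite parityU; case: odd => /=; first by rewrite subr0.
  by rewrite subrr linear0.
have Kpar i' b v : K i' v -> parity b v -> parity (~~ b) (act i' v).
  rewrite /parity => -> ->; case: b => /=; first by rewrite subr0.
  by rewrite subrr linear0.
have Klow x j' : (len x < len w)%N -> K j' << x >>.
  by move=> xw; apply: Kgen; apply: IHn; lia.
have Klin v b j' : low (len w) v -> parity b v -> parity (~~ b) (act j' v).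
  move=> lv; apply: Kpar; apply: malg_linear_ind; [| exact: KP | move=> x /lv; exact: Klow].
  by rewrite /K !(linear0, subrr).
have Kprim x j' : ~~ desc x j' -> ~~ secondary (s j' x) j' -> K j' << x >>.
  move=> xj tj; apply: Kgen; rewrite act_primary // -(odd_len_refl x j'); exact: parityU.
have [wj|wj] := boolP (desc w j).
  have := act_descE wj; set y := act j << s j w >>; set a := y@_w; move=> [ua ly ->].
  have py : parity (odd (len w)) y.
    by have := IHn (s j w) j; rewrite odd_len_refl negbK; apply; move: (len_desc wj); lia.
  apply/parityZ/parityD; first by rewrite -(odd_len_refl w j); exact: parityU.
  apply/parityN/Klin => //; apply: parityD => //; apply/parityN/parityZ; exact: parityU.
have [tj|tj] := boolP (secondary (s j w) j); last first.
  by apply: (Kpar _ _ _ (Kprim _ _ wj tj)); exact: parityU.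
have [[uy ly] ->] := act_secondary m_gt1 (tame_act _) wj tj.
have Kline := act_line_ind KP Klow Kprim wj tj.
have [mu t1 t2 lt _] := secondaryP m_gt1 tj.
set t := s j w in tj Kline uy ly mu t1 t2 lt *; set k := polygon t j in Kline uy ly mu t1 t2 lt *.
set u := bottom t j in Kline uy ly mu t1 t2 lt *.
set a := first_letter k u in Kline uy ly mu t1 t2 lt *.
set b := other_letter k u in Kline uy ly mu t1 t2 lt *.
have mk := m_gt1 k.
have lwt : len t = (len w).+1 by rewrite len_asc.
have p1 d : (d <= (m k).-1)%N -> parity (odd d (+) odd (len u)) (alt act d a b << u >>).
  elim: d => [_|d IHd dm] /=; first exact: parityU.
  by rewrite addNb; apply: Kpar (IHd (ltnW dm)); case: (Kline d) => + _; apply.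
have p2 d : (d <= m k)%N -> parity (odd d (+) odd (len u)) (alt act d b a << u >>).
  elim: d => [_|d IHd dm] /=; first exact: parityU.
  by rewrite addNb; apply: Kpar (IHd (ltnW dm)); case: (Kline d) => _; apply.
have ow : ~~ odd (len w) = odd (m k) (+) odd (len u).
  have -> : ~~ odd (len w) = odd (len t) by rewrite lwt.
  by rewrite lt oddD addbC.
have ow' : odd (len w) = odd (m k).-1 (+) odd (len u).
  have -> : odd (m k).-1 = ~~ odd (m k) by case: (m k) mk => //= d _; rewrite negbK.
  by rewrite addNb -ow negbK.
apply/parityZ/parityD; last first.
  apply/parityN/Klin => //; apply: parityD; first by rewrite ow'; exact: p1.
  by apply/parityN/parityZ; exact: parityU.
apply/parityN; apply: (big_ind (parity _)); [exact: parity0 | by move=> *; exact: parityD |].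
move=> q _; apply: parityZ; rewrite ow /line -/a -/b.
have qm := ltn_ord q; case: leqP => mq.
  have -> : odd (m k) = odd (q.*2 - m k) by rewrite oddB // odd_double.
  by apply: p1; lia.
have -> : odd (m k) = odd (m k - q.*2) by rewrite oddB ?odd_double ?addbF // ltnW.
by apply: p2; lia.
Qed.

Lemma parity_act b i v : parity b v -> parity (~~ b) (act i v).
Proof.
rewrite /parity even_part_act => ->; case: b => /=; first by rewrite subr0.
by rewrite subrr linear0.
Qed.

Lemma parity_supp b v w : parity b v -> v@_w != 0 -> odd (len w) = b.
Proof.
move=> bv vw; apply: contraNeq vw => wb; apply/eqP.
suff H : (even_part v)@_w = if odd (len w) then 0 else v@_w.
  by move: H wb; rewrite bv; case: (b); case: odd => //; rewrite mcoeff0.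
rewrite {1}[v]malg_sumU linear_sum raddf_sum /=.
rewrite (eq_bigr (fun x => if x == w then if odd (len w) then 0 else v@_w else 0)).
  rewrite -big_mkcond /=; case: (msuppP v w) => [wv|wv]; last first.
    by rewrite big_seq_cond big_pred0 ?if_same // => x; case: eqP => [->|]; rewrite ?andbF // (negbTE wv).
  by rewrite -big_filter filter_pred1_uniq ?big_seq1.
move=> x _; rewrite linearZZ mcoeffZ even_partU.
have [->|xw] := eqVneq x w; case: odd; rewrite ?mcoeff0 ?mulr0 // mcoeff_gen ?eqxx ?mulr1 //.
by rewrite (negbTE xw) mulr0.
Qed.

Definition rot k : {linear M -> M} :=
  lin (fun w => if odd (len w) then act (ordS k) (act k << w >>)
                else act k (act (ordS k) << w >>)).

Lemma rotU k w : rot k << w >> =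
  if odd (len w) then act (ordS k) (act k << w >>) else act k (act (ordS k) << w >>).
Proof. exact: linU. Qed.

Lemma rotE b k v : parity b v ->
  rot k v = if b then act (ordS k) (act k v) else act k (act (ordS k) v).
Proof.
move=> bv; have vw w := @parity_supp b v w bv.
pose f : {linear M -> M} := act (ordS k) \o act k.
pose h : {linear M -> M} := act k \o act (ordS k).
case: b vw {bv} => vw.
  by apply: (@linear_ext_supp _ _ _ (rot k) f) => w /vw wb; rewrite rotU wb.
by apply: (@linear_ext_supp _ _ _ (rot k) h) => w /vw wb; rewrite rotU wb.
Qed.

Lemma rot_act k v : rot k (act k v) = act k (rot k v).
Proof.
apply: (@linear_ext_supp _ _ _ (rot k \o act k) (act k \o rot k)) => w _.
change (rot k (act k << w >>) = act k (rot k << w >>)).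
rewrite (rotE _ (parityU w)) (rotE _ (parity_act k (parityU w))).
by case: odd => /=; rewrite ?actK.
Qed.

Lemma rot_actS k v : rot k (act (ordS k) v) = act (ordS k) (rot k v).
Proof.
apply: (@linear_ext_supp _ _ _ (rot k \o act (ordS k)) (act (ordS k) \o rot k)) => w _.
change (rot k (act (ordS k) << w >>) = act (ordS k) (rot k << w >>)).
rewrite (rotE _ (parityU w)) (rotE _ (parity_act (ordS k) (parityU w))).
by case: odd => /=; rewrite ?actK.
Qed.

(** At the bottom of a corner the relation, written along the line, is the very equation that
    defined the value at the secondary edge. *)
Lemma rot_rel_minimal k u : minimal k u -> poly_act (p k) (m k) (rot k) << u >> = 0.
Proof.
move=> mu; have [] := bottom_eq m_gt1 mu.
set a := first_letter k u; set b := other_letter k u.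
set c := if _ then _ else _; set t := alt _ _ _ _ _ => tc pt bt wE.
have Ca (x : M) : rot k (act a x) = act a (rot k x).
  by rewrite /a /first_letter; case: odd; [exact: rot_act | exact: rot_actS].
have Cb (x : M) : rot k (act b x) = act b (rot k x).
  by rewrite /b /other_letter; case: odd; [exact: rot_actS | exact: rot_act].
apply/(poly_act_line (g := act) actK Ca Cb).
  by rewrite (rotE _ (parityU u)) /a /b /first_letter /other_letter; case: odd.
rewrite big_ord_recr /= p_monic scale1r.
have wc : ~~ desc (s c t) c by rewrite desc_refl negbK; case/andP: tc.
have tc' : secondary (s c (s c t)) c by rewrite reflK.
have := act_secondary m_gt1 (tame_act _) wc tc'; cbv zeta; rewrite reflK pt bt -/a -/b.
set y := alt _ _ _ _ _; move=> [[uy ly] yE].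
have -> : line act (m k) a b (m k) << u >> = act c y.
  rewrite /line -addnn leq_addr addnK; have -> : m k = (m k).-1.+1 by have := m_gt1 k; lia.
  by [].
rewrite -[y in act c y](subrK (y@_(s c t) *: << s c t >>)) linearD [act c (_ *: _)]linearZZ yE.
by rewrite scalerA mul_inverse // scale1r [act c _ + _]addrC subrK addrN.
Qed.

Lemma poly_actD k v y a : poly_act (p k) (m k) (rot k) (a *: v + y) =
  a *: poly_act (p k) (m k) (rot k) v + poly_act (p k) (m k) (rot k) y.
Proof.
rewrite /poly_act scaler_sumr -big_split; apply: eq_bigr => q _ /=.
have -> : iter q (rot k) (a *: v + y) = a *: iter q (rot k) v + iter q (rot k) y.
  by elim: {q}(nat_of_ord q) => //= q ->; rewrite linearPZ.
by rewrite scalerDr !scalerA mulrC.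
Qed.

(** If w is not a bottom, some S_c with c in {k, k+1} lowers it. The rotation commutes with S_c, so
    the relation passes from s_c w to S_c (s_c w), which is w up to a unit and shorter terms. *)
Lemma rot_rel k v : poly_act (p k) (m k) (rot k) v = 0.
Proof.
pose K v := poly_act (p k) (m k) (rot k) v = 0.
have KP a v1 v2 : K v1 -> K v2 -> K (a *: v1 + v2).
  by rewrite /K poly_actD => -> ->; rewrite scaler0 addr0.
have I0 q : iter q (rot k) 0 = 0 by elim: q => // q IHq; rewrite iterS IHq linear0.
have K0 : K 0 by rewrite /K /poly_act big1 // => q _; rewrite I0 scaler0.
suff H n w : (len w < n)%N -> K << w >>.
  apply: (malg_linear_ind K0 KP) => w _; exact: (H (len w).+1).
elim: n w => // n IHn w wn.
have [mw|] := boolP (minimal k w); first exact: rot_rel_minimal.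
rewrite /minimal negb_and !negbK => wd.
have [c wc Cc] : exists2 c, desc w c & forall x : M, rot k (act c x) = act c (rot k x).
  by case/orP: wd => wd; [exists k => //; exact: rot_act | exists (ordS k) => //; exact: rot_actS].
have := act_descE wc; set y := act c << s c w >>; set a := y@_w; move=> [ua ly _].
have yE : y = a *: << w >> + (y - a *: << w >>) by rewrite addrC subrK.
have Ky : K y.
  rewrite /K /y poly_act_comm // IHn ?linear0 //; have := len_desc wc; lia.
have Kl : K (y - a *: << w >>).
  by apply: (malg_linear_ind K0 KP) => x /ly xw; apply: IHn; lia.
have -> : << w >> = inverse a *: y + (- inverse a) *: (y - a *: << w >>).
  by rewrite scaleNr -scalerBr opprB addrC subrK scalerA mulVr_inverse // scale1r.
have Kz := KP (- inverse a) _ _ Kl K0; rewrite addr0 in Kz.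
exact: (KP _ _ _ Ky Kz).
Qed.

(** [phi] is defined by recursion through primary descents only. At a secondary edge equivariance
    comes for free, since [A] satisfies the same relation and the top term of that relation is
    determined by the others. *)
Lemma chamber_universal (V : lmodType R) (A : polygonal_action m p V) (v0 : V) :
  pa_parity A false v0 ->
  exists phi : {linear M -> V},
    [/\ phi << base W >> = v0, forall i v, phi (act i v) = pa_refl A i (phi v) &
      forall w, pa_parity A (odd (len w)) (phi << w >>)].
Proof.
move=> par0; set g := pa_refl A.
pose prim w := if pselect (w <> base W) is left e
  then Some (s2val (cid2 (exists_primary e))) else None.
pose F w (f : W -> V) := if prim w is Some i then g i (f (s i w)) else v0.
have [f fE] := rec_fixpoint len 0 F.
have fb : f (base W) = v0.
  by rewrite fE /F /prim; case: pselect.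
have fS w i : desc w i -> ~~ secondary w i -> f w = g i (f (s i w)).
  move=> wi ti; rewrite fE /F /prim; case: pselect => [wb|/contrapT wb]; last first.
    by have := len_desc wi; rewrite wb len_base.
  case: cid2 => j wj tj /=; have -> : j = i by exact: (primary_unique wj wi).
  by rewrite ifT.
pose phi : {linear M -> V} := lin f.
have phiU w : phi << w >> = f w by exact: linU.
have phipar n w : (len w < n)%N -> pa_parity A (odd (len w)) (phi << w >>).
  elim: n w => // n IHn w wn; have [->|wb] := eqVneq w (base W).
    by rewrite phiU fb len_base.
  have [i wi ti] := exists_primary (elimN eqP wb).
  rewrite phiU (fS _ _ wi ti) -[odd _]negbK -(odd_len_refl w i).
  apply: pa_parity_refl; rewrite -phiU; apply: IHn; have := len_desc wi; lia.
exists phi; split=> [|i v|w]; [by rewrite phiU | | exact: (phipar (len w).+1)].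
pose K i v := phi (act i v) = g i (phi v).
have KP j a v1 v2 : K j v1 -> K j v2 -> K j (a *: v1 + v2).
  by rewrite /K !linearPZ => -> ->.
have K0 j : K j 0 by rewrite /K !linear0.
have Ksum n j v' : low n v' -> (forall x, (len x < n)%N -> K j << x >>) -> K j v'.
  move=> lv Kx; apply: (malg_linear_ind (K0 j) (KP j)) => x /lv; exact: Kx.
suff H n w j : (len w < n)%N -> K j << w >>.
  apply: (malg_linear_ind (K0 i) (KP i)) => w _; exact: (H (len w).+1).
elim: n w j => // n IHn w j wn.
have Klow x j' : (len x < len w)%N -> K j' << x >> by move=> xw; apply: IHn; lia.
have Kprim x j' : ~~ desc x j' -> ~~ secondary (s j' x) j' -> K j' << x >>.
  move=> xj tj; rewrite /K act_primary // !phiU (fS (s j' x) j') ?reflK //.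
  by rewrite desc_refl.
have [wj|wj] := boolP (desc w j).
  have := act_descE wj; set y := act j << s j w >>; set a := y@_w; move=> [ua ly E].
  have Kt : K j << s j w >> by apply: Klow; have := len_desc wj; lia.
  apply: (scaler_inj_invertible ua); rewrite E -linearZZ scalerA mul_inverse // scale1r.
  rewrite linearB /= (Ksum _ _ _ ly); last by move=> x xw; exact: Klow.
  rewrite linearB linearZZ -/y; move: Kt; rewrite /K -/y => ->.
  rewrite linearB linearZZ pa_reflK opprB addrC subrK.
  by [].
have [tj|tj] := boolP (secondary (s j w) j); last exact: Kprim.
have [[uy ly] E] := act_secondary m_gt1 (tame_act _) wj tj.
have Kline := act_line_ind KP Klow Kprim wj tj.
have [mu t1 t2 lt [jE _]] := secondaryP m_gt1 tj.
set t := s j w in tj Kline uy ly mu t1 t2 lt jE E *.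
set k := polygon t j in Kline uy ly mu t1 t2 lt jE E *.
set u := bottom t j in Kline uy ly mu t1 t2 lt jE E *.
set a := first_letter k u in Kline uy ly mu t1 t2 lt jE E *.
set b := other_letter k u in Kline uy ly mu t1 t2 lt jE E *.
have mk := m_gt1 k.
have p1 d : (d <= (m k).-1)%N -> phi (alt act d a b << u >>) = alt g d a b (phi << u >>).
  elim: d => // d IHd dm /=; rewrite -(IHd (ltnW dm)).
  by case: (Kline d) => + _; apply.
have p2 d : (d <= m k)%N -> phi (alt act d b a << u >>) = alt g d b a (phi << u >>).
  elim: d => // d IHd dm /=; rewrite -(IHd (ltnW dm)).
  by case: (Kline d) => _; apply.
apply: (scaler_inj_invertible uy); rewrite E -linearZZ scalerA mul_inverse // scale1r.
set y := alt act _ _ _ _ in uy ly E *; set c := y@_w in uy ly E *.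
rewrite linearB linearN /= (Ksum _ _ _ ly); last by move=> x xw; exact: Klow.
(* [phi] carries the sum at u to the corresponding sum in [A], whose relation gives the top term as
   g j (phi y). *)
have -> : phi (line_sum p act k u) = - g j (phi y).
  rewrite p1 //; have := pa_line k (phipar _ u (leqnn _)) (A := A).
  rewrite big_ord_recr /= p_monic scale1r -/g -/(first_letter k u) -/(other_letter k u) -/a -/b.
  have -> : line g (m k) a b (m k) (phi << u >>) = g j (alt g (m k).-1 a b (phi << u >>)).
    rewrite /line -addnn leq_addr addnK {1}(_ : m k = (m k).-1.+1) /= -?jE //; lia.
  move=> /eqP; rewrite addr_eq0 => /eqP <-.
  rewrite /line_sum linear_sum; apply: eq_bigr => q _; rewrite linearZZ; congr (_ *: _).
  have qm := ltn_ord q; rewrite /line; case: leqP => mq; first by apply: p1; lia.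
  by apply: p2; lia.
have -> : phi (y - c *: << w >>) = phi y - c *: phi << w >> by rewrite linearB linearZZ.
by rewrite opprK [g j (_ - _)]linearB [g j (_ *: _)]linearZZ opprB addrC subrK.
Qed.

End Universal.

(** * The Coxeter group of a polygon *)

Section Chebyshev.

Variable K : realType.

(* (U_(n-1), U_(n-2)) for the Chebyshev polynomials U of the second kind, as   *)
(* functions of c = 2 cos(theta).                                               *)
Fixpoint cheb (c : K) (n : nat) : K * K :=
  if n is n'.+1 then (c * (cheb c n').1 - (cheb c n').2, (cheb c n').1) else (0, -1).

Lemma cheb_sin (t : K) n : sin t != 0 ->
  cheb (2 * cos t) n = (sin (n%:R * t) / sin t, sin (n%:R * t - t) / sin t).
Proof.
move=> st; elim: n => [|n IHn] /=.
  by rewrite mul0r sin0 mul0r sub0r sinN mulNr divff.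
have nS : n.+1%:R * t = n%:R * t + t by rewrite -natr1 mulrDl mul1r.
by rewrite IHn /= nS addrK sinB sinD; congr (_, _); field.
Qed.

Lemma cheb_2 n : cheb 2 n = (n%:R, n%:R - 1).
Proof.
elim: n => [|n IHn] /=; first by rewrite sub0r.
by rewrite IHn /= -(natr1 n); congr (_, _); ring.
Qed.

Variable M : nat.
Let theta : K := pi / M%:R.

(* M = 0 stands for an infinite order. *)
Definition cheb_arg : K := if M == 0 then 2 else 2 * cos theta.

Hypothesis M_neq1 : (M != 1)%N.

Lemma angle_bounds : (0 < M)%N -> 0 < theta < pi.
Proof.
move=> M0; have M2 : (1 < M)%N by lia.
have M0' : 0 < M%:R :> K by rewrite ltr0n.
rewrite /theta divr_gt0 ?pi_gt0 //= ltr_pdivrMr //.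
by rewrite ltr_pMr ?pi_gt0 // ltr1n.
Qed.

Lemma sin_angle_gt0 : (0 < M)%N -> 0 < sin theta.
Proof. by move=> M0; apply: sin_gt0_pi; exact: angle_bounds. Qed.

Lemma cheb_ge0 n : (M = 0 \/ n <= M)%N -> 0 <= (cheb cheb_arg n).1.
Proof.
rewrite /cheb_arg; case: eqP => [_ _|M0]; first by rewrite cheb_2 /= ler0n.
move=> [//|nM]; have M0' : (0 < M)%N by lia.
have s0 := sin_angle_gt0 M0'.
rewrite cheb_sin ?gt_eqF //= divr_ge0 ?(ltW s0) //; apply: sin_ge0_pi.
have /andP[t0 _] := angle_bounds M0'.
rewrite mulr_ge0 ?ler0n ?(ltW t0) //= /theta mulrCA ler_piMr ?pi_ge0 //.
by rewrite ler_pdivrMr ?ltr0n // mul1r ler_nat.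
Qed.

Lemma cheb_order : (0 < M)%N ->
  (cheb cheb_arg M.+1).1 = -1 /\ cheb cheb_arg M = (0, 1).
Proof.
move=> M0; have s0 := sin_angle_gt0 M0.
have -> : cheb cheb_arg M = (0, 1) => /=; last first.
  suff -> : cheb cheb_arg M = (0, 1) by rewrite /= mulr0 sub0r.
  rewrite /cheb_arg gtn_eqF // cheb_sin ?gt_eqF //.
  have MT : M%:R * theta = pi by rewrite /theta mulrCA divff ?mulr1 // pnatr_eq0 -lt0n.
  by rewrite MT sinpi mul0r sinB sinpi mul0r cospi mulN1r sub0r opprK divff // gt_eqF.
rewrite /cheb_arg gtn_eqF // cheb_sin ?gt_eqF //.
have MT : M%:R * theta = pi by rewrite /theta mulrCA divff ?mulr1 // pnatr_eq0 -lt0n.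
by rewrite MT sinpi mul0r sinB sinpi mul0r cospi mulN1r sub0r opprK divff // gt_eqF.
Qed.

(** This is the Gram determinant of the two roots; for infinite order it would vanish. *)
Lemma cheb_arg_nondeg : (0 < M)%N -> 4 - cheb_arg ^+ 2 != 0.
Proof.
move=> M0; have s0 := sin_angle_gt0 M0; rewrite /cheb_arg gtn_eqF //.
have -> : 4 - (2 * cos theta) ^+ 2 = 4 * sin theta ^+ 2 by rewrite sin2cos2; ring.
by rewrite mulf_neq0 // ?expf_neq0 // gt_eqF.
Qed.

End Chebyshev.

(** * The geometric representation *)

Section ReflectionAction.

Variables (K : realType) (r : nat) (bil : 'I_r -> 'I_r -> K).
Hypothesis bil_diag : forall i, bil i i = 2.

Implicit Types (X : 'M[K]_r * bool) (i j : 'I_r) (a b : 'I_r).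

(* If row j of X.1 is the root w^-1(alpha_j), then row j of refl0 i X is       *)
(* (s_i w)^-1(alpha_j); the bit is the parity of the word that led to X.       *)
Definition refl0 i X : 'M[K]_r * bool :=
  (X.1 - (\col_j bil i j) *m row i X.1, ~~ X.2).

Lemma refl0_entry i X j l : (refl0 i X).1 j l = X.1 j l - bil i j * X.1 i l.
Proof. by rewrite !mxE big_ord1 !mxE. Qed.

Lemma refl0K i : involutive (refl0 i).
Proof.
move=> X; apply: injective_projections; last exact: negbK.
by apply/matrixP => j l; rewrite !refl0_entry bil_diag; ring.
Qed.

Lemma refl0_unit i X : X.1 \in unitmx -> (refl0 i X).1 \in unitmx.
Proof.
have E Y : (refl0 i Y).1 = (1%:M - (\col_j bil i j) *m row i 1%:M) *m Y.1.
  by rewrite mulmxBl mul1mx -mulmxA -row_mul mul1mx.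
have u : 1%:M - (\col_j bil i j) *m row i 1%:M \in @unitmx K r.
  set A := _ - _; suff : A *m A = 1%:M by move=> /mulmx1_unit [].
  by have := congr1 fst (refl0K i (1%:M, false)); rewrite E.
by rewrite E unitmx_mul u.
Qed.

(** On the plane of the two roots each reflection performs one step of the three-term recursion of
    [cheb]. *)
Lemma alt_rows c a b n X l : bil a b = - c -> bil b a = - c ->
  ((alt refl0 n a b X).1 (if odd n then b else a) l
     = (cheb c n.+1).1 * X.1 a l + (cheb c n).1 * X.1 b l) /\
  ((alt refl0 n a b X).1 (if odd n then a else b) l
     = - ((cheb c n).1 * X.1 a l + (cheb c n).2 * X.1 b l)).
Proof.
move=> bil_ab bil_ba; elim: n => [|n [IH1 IH2]].
  by rewrite /=; split; ring.
rewrite /= !refl0_entry; case: (odd n) IH1 IH2 => /= -> ->;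
  rewrite ?bil_ab ?bil_ba bil_diag /=; split; ring.
Qed.

(** Rows a and b agree after M reflections since M theta is a half-turn. For any other row, a
    suitable combination with rows a and b is fixed by both reflections. *)
Lemma alt_braid a b M X : (1 < M)%N ->
  bil a b = - cheb_arg K M -> bil b a = - cheb_arg K M ->
  alt refl0 M a b X = alt refl0 M b a X.
Proof.
move=> M1 bil_ab bil_ba; have M0 : (0 < M)%N by lia.
have M_neq1 : (M != 1)%N by lia.
have [pM1 cM] := cheb_order K M_neq1 M0.
have ab Y l : (alt refl0 M a b Y).1 a l = (alt refl0 M b a Y).1 a l /\
              (alt refl0 M a b Y).1 b l = (alt refl0 M b a Y).1 b l.
  have [] := alt_rows M Y l bil_ab bil_ba; have [] := alt_rows M Y l bil_ba bil_ab.
  by rewrite pM1 cM /= !mul0r !add0r !mul1r !mulN1r !addr0; case: odd => -> -> -> ->.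
have par n c d Y : (alt refl0 n c d Y).2 = odd n (+) Y.2.
  by elim: n => //= n ->; rewrite addNb.
rewrite [LHS]surjective_pairing [RHS]surjective_pairing !par; congr (_, _).
apply/matrixP => j l.
pose c := cheb_arg K M; have D := cheb_arg_nondeg K M_neq1 M0; rewrite -/c in D.
(* alpha_j + x alpha_a + y alpha_b is the component of alpha_j orthogonal to alpha_a and alpha_b;
   the denominator is their Gram determinant. *)
pose x := - (2 * bil a j + c * bil b j) / (4 - c ^+ 2).
pose y := - (2 * bil b j + c * bil a j) / (4 - c ^+ 2).
have inv n c' d' Y : (c', d') = (a, b) \/ (c', d') = (b, a) ->
    (alt refl0 n c' d' Y).1 j l + x * (alt refl0 n c' d' Y).1 a l
       + y * (alt refl0 n c' d' Y).1 b l = Y.1 j l + x * Y.1 a l + y * Y.1 b l.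
  move=> cd; elim: n => //= n <-; set Z := alt _ _ _ _ _.
  have H e : e = a \/ e = b ->
     (refl0 e Z).1 j l + x * (refl0 e Z).1 a l + y * (refl0 e Z).1 b l =
     Z.1 j l + x * Z.1 a l + y * Z.1 b l.
    by case=> ->; rewrite !refl0_entry bil_diag ?bil_ab ?bil_ba -/c /x /y; field.
  by apply: H; case: cd => -[-> ->]; case: odd; auto.
have [Ea Eb] := ab X l.
have := inv M a b X (or_introl erefl); rewrite -(inv M b a X (or_intror erefl)) Ea Eb.
by move/addIr/addIr.
Qed.

End ReflectionAction.

Lemma altD (I A : Type) (g : I -> A -> A) n k a b x :
  alt g (n + k) a b x =
  alt g n (if odd k then b else a) (if odd k then a else b) (alt g k a b x).
Proof.
elim: n => //= n ->; rewrite oddD; congr (g _ _).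
by case: (odd n); case: (odd k).
Qed.

Section Cycle.

Variables (r : nat).
Hypothesis r_gt2 : (2 < r)%N.
Implicit Types i j : 'I_r.

Lemma ordS_neq i : ordS i != i.
Proof.
apply/eqP => /(congr1 val) /= E; have il := ltn_ord i.
have [iE|ir] := eqVneq i.+1 r; first by rewrite iE modnn in E; lia.
by rewrite modn_small in E; lia.
Qed.

Lemma ordSS_neq i : ordS (ordS i) != i.
Proof.
apply/eqP => /(congr1 val) /=; rewrite -addn1 modnDml => E; have il := ltn_ord i.
have [ir|ir] := ltnP (i.+1 + 1)%N r; first by rewrite modn_small in E; lia.
by rewrite -(subnK ir) modnDr modn_small in E; lia.
Qed.

Lemma ordSSS_neq i : (3 < r)%N -> ordS (ordS (ordS i)) != i.
Proof.
move=> r3; apply/eqP => /(congr1 val) /=.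
rewrite -addn1 modnDml addSnnS modnDml => E; have il := ltn_ord i.
have [ir|ir] := ltnP (i.+1 + 2)%N r; first by rewrite modn_small in E; lia.
by rewrite -(subnK ir) modnDr modn_small in E; lia.
Qed.

End Cycle.

(** * Length in the Coxeter group and signs of roots *)

Section Orbit.

Variables (K : realType) (r : nat) (m : 'I_r -> nat).
Hypothesis r_gt2 : (2 < r)%N.
Hypothesis m_gt1 : forall k, (1 < m k)%N.
Implicit Types (i j a b c : 'I_r).

(** Reflections in non-adjacent sides generate an infinite dihedral group, encoded by order 0. *)
Definition cox_order i j : nat :=
  if j == ordS i then m i else if i == ordS j then m j else 0.

Definition cox_form i j : K := if i == j then 2 else - cheb_arg K (cox_order i j).

Lemma cox_form_diag i : cox_form i i = 2.
Proof. by rewrite /cox_form eqxx. Qed.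

Lemma cox_orderC i j : cox_order i j = cox_order j i.
Proof.
rewrite /cox_order; case: (j =P ordS i) => [ji|//]; case: (i =P ordS j) => [ij|//].
by have := ordSS_neq r_gt2 i; rewrite -ji -ij eqxx.
Qed.

Lemma cox_formE i j : i != j -> cox_form i j = - cheb_arg K (cox_order i j).
Proof. by rewrite /cox_form => /negbTE ->. Qed.

Lemma cox_orderS i : cox_order i (ordS i) = m i.
Proof. by rewrite /cox_order eqxx. Qed.

Lemma cox_order_neq1 i j : cox_order i j != 1%N.
Proof.
by rewrite /cox_order; case: ifP => _; last case: ifP => _; rewrite // gtn_eqF.
Qed.

Local Notation ref0 := (refl0 cox_form).

(** The orbit of the identity matrix stands for W: no presentation is required, since braid
    relations and lengths are all read from the rows. *)
Definition orbit_pred : pred ('M[K]_r * bool) :=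
  fun X => `[< exists w, X = foldr ref0 (1%:M, false) w >].

Definition orbit := {X | orbit_pred X}.

Lemma orbit_refl_proof i (X : orbit) : orbit_pred (ref0 i (val X)).
Proof. by case: X => X /= /asboolP[w ->]; apply/asboolP; exists (i :: w). Qed.

Definition orefl i (X : orbit) : orbit := Sub (ref0 i (val X)) (orbit_refl_proof i X).

Lemma orbit_base_proof : orbit_pred (1%:M, false).
Proof. by apply/asboolP; exists [::]. Qed.

Definition obase : orbit := Sub (1%:M, false) orbit_base_proof.

Lemma oreflK i : involutive (orefl i).
Proof. by move=> X; apply: val_inj; rewrite /= refl0K //; exact: cox_form_diag. Qed.

Implicit Types X u : orbit.

Lemma orbit_word X : exists w, X = foldr orefl obase w.
Proof.
case: X => X Xp; have /asboolP[w XE] := Xp; exists w; apply: val_inj => /=.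
by rewrite XE; elim: w {XE} => //= i w ->.
Qed.

Lemma orbit_len_ex X : exists n, `[< exists w, size w = n /\ X = foldr orefl obase w >].
Proof. by have [w Xw] := orbit_word X; exists (size w); apply/asboolP; exists w. Qed.

Definition olen X := ex_minn (orbit_len_ex X).

Lemma olenP X : exists w, size w = olen X /\ X = foldr orefl obase w.
Proof. by rewrite /olen; case: ex_minnP => n /asboolP. Qed.

Lemma olen_min w : (olen (foldr orefl obase w) <= size w)%N.
Proof. by rewrite /olen; case: ex_minnP => n _; apply; apply/asboolP; exists w. Qed.

Lemma olen_refl_le i X : (olen (orefl i X) <= (olen X).+1)%N.
Proof. by have [w [<- {1}->]] := olenP X; exact: (olen_min (i :: w)). Qed.

Lemma odd_olen X : odd (olen X) = (val X).2.
Proof.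
have [w [<- ->]] := olenP X.
by elim: w => //= i w ->.
Qed.

Lemma olen_refl i X : olen (orefl i X) = (olen X).+1 \/ olen X = (olen (orefl i X)).+1.
Proof.
have := olen_refl_le i X; have := olen_refl_le i (orefl i X); rewrite oreflK.
have : olen (orefl i X) <> olen X.
  by move=> /(congr1 odd); rewrite !odd_olen /=; case: (_.2).
lia.
Qed.

Lemma olen_base : olen obase = 0%N.
Proof. by apply/eqP; rewrite -leqn0; exact: (olen_min [::]). Qed.

Lemma exists_odesc X : X <> obase -> exists i, (olen (orefl i X) < olen X)%N.
Proof.
have [[|i w] [<- ->]] := olenP X => // _; exists i.
by rewrite /= oreflK ltnS; exact: olen_min.
Qed.

Lemma olen_alt_le n a b u : (olen (alt orefl n a b u) <= olen u + n)%N.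
Proof.
elim: n => [|n IHn]; first by rewrite addn0.
by rewrite addnS; apply: leq_trans (olen_refl_le _ _) _; rewrite ltnS.
Qed.

Lemma val_alt n a b u : val (alt orefl n a b u) = alt ref0 n a b (val u).
Proof. by elim: n => //= n ->. Qed.

Lemma obraid a b u : a != b -> (0 < cox_order a b)%N ->
  alt orefl (cox_order a b) a b u = alt orefl (cox_order a b) b a u.
Proof.
move=> ab M0; apply: val_inj; rewrite !val_alt; apply: alt_braid.
- exact: cox_form_diag.
- by have := cox_order_neq1 a b; lia.
- exact: cox_formE.
- by rewrite cox_formE 1?eq_sym // cox_orderC.
Qed.

Lemma oalt_rows n a b u l : a != b ->
  (val (alt orefl n a b u)).1 (if odd n then b else a) l =
  (cheb (cheb_arg K (cox_order a b)) n.+1).1 * (val u).1 a l +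
  (cheb (cheb_arg K (cox_order a b)) n).1 * (val u).1 b l.
Proof.
move=> ab; rewrite val_alt.
have ba : b != a by rewrite eq_sym.
by have [] := alt_rows cox_form_diag n (val u) l (cox_formE ab)
  (etrans (cox_formE ba) (congr1 (fun n => - cheb_arg K n) (cox_orderC b a))).
Qed.

Lemma orow_neq0 X i : exists l, (val X).1 i l != 0.
Proof.
have uX : (val X).1 \in unitmx.
  have [w ->] := orbit_word X; elim: w => [|j w IHw] /=; first exact: unitmx1.
  by apply: refl0_unit => //; exact: cox_form_diag.
apply: contrapT => /forallNP X0.
have : row i (val X).1 = 0.
  by apply/rowP => l; rewrite !mxE; apply/eqP/negPn/negP; exact: X0.
move=> /(congr1 (mulmx^~ (invmx (val X).1))); rewrite mul0mx -row_mul mulmxV //.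
by move=> /rowP/(_ i); rewrite !mxE eqxx => /eqP; rewrite oner_eq0.
Qed.

Definition opos i X := forall l, 0 <= (val X).1 i l.

(** A braid move on the outermost letters makes the next reflection cancel the outermost one. *)
Lemma obraid_shorten n a b u : a != b -> (0 < cox_order a b <= n)%N ->
  (olen (orefl (if odd n then b else a) (alt orefl n a b u)) < olen u + n)%N.
Proof.
move=> ab /andP[M0 Mn]; set M := cox_order a b.
rewrite -(subnKC Mn) -/M; set k := (n - M)%N; rewrite altD; set a' := if odd k then b else a; set b' := if odd k then a else b.
have abM : cox_order a' b' = M.
  by rewrite /a' /b'; case: odd; rewrite // cox_orderC.
have ab' : a' != b' by rewrite /a' /b'; case: odd; rewrite // eq_sym.
have M1 : M = M.-1.+1 by move: M0; rewrite -/M; lia.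
rewrite -{2}abM obraid ?abM // {2}M1 /= oddD.
have -> : (if odd M (+) odd k then b else a) = (if odd M.-1 then a' else b').
  by rewrite {1}M1 /a' /b' /=; case: (odd M.-1); case: (odd k).
rewrite oreflK; apply: leq_ltn_trans (olen_alt_le _ _ _ _) _.
by have := olen_alt_le k a b u; lia.
Qed.

(** Strip the letters a and b as long as they lower X: what remains is the shortest element u of the
    dihedral coset, and the stripped letters alternate because the lengths add up. *)
Lemma odecomp a b X : a != b -> exists u n c d,
  [/\ (c, d) = (a, b) \/ (c, d) = (b, a), X = alt orefl n c d u, olen X = (olen u + n)%N,
     (olen u < olen (orefl a u))%N & (olen u < olen (orefl b u))%N].
Proof.
move=> ab; have [k] := ubnP (olen X); elim: k X => // k IHk X Xk.
have step e : e = a \/ e = b -> (olen (orefl e X) < olen X)%N ->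
  exists u n c d,
  [/\ (c, d) = (a, b) \/ (c, d) = (b, a), X = alt orefl n c d u, olen X = (olen u + n)%N,
     (olen u < olen (orefl a u))%N & (olen u < olen (orefl b u))%N].
  move=> eab Xe; have [|u [n [c [d [cd XE lX ua ub]]]]] := IHk (orefl e X); first by lia.
  have lX' : olen X = (olen u + n.+1)%N by have := olen_refl e X; lia.
  have XE' : X = orefl e (alt orefl n c d u) by rewrite -XE oreflK.
  have ecd : e = c \/ e = d by case: cd eab => -[-> ->]; tauto.
  have [eE|eN] := eqVneq e (if odd n then d else c).
    by exists u, n.+1, c, d; split=> //; rewrite XE' eE.
  case: n lX lX' XE XE' eN => [|n] lX lX' XE XE' eN.
    by exists u, 1%N, d, c; split; rewrite // ?XE' /=; case: cd ecd eN => -[-> ->] [->|->];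
      rewrite ?eqxx //; auto.
  have eE : e = if odd n then d else c.
    by move: eN => /=; case: ecd => ->; case: (odd n); rewrite ?eqxx.
  have := olen_alt_le n c d u; rewrite XE' /= -eE oreflK in lX'.
  lia.
have [Xa|Xa] := ltnP (olen (orefl a X)) (olen X); first by apply: (step a); auto.
have [Xb|Xb] := ltnP (olen (orefl b X)) (olen X); first by apply: (step b); auto.
exists X, 0%N, a, b; split; rewrite ?addn0 //; first by left.
  by case: (olen_refl a X); lia.
by case: (olen_refl b X); lia.
Qed.

Lemma orow_alt_ge0 n a b u : a != b ->
  (cox_order a b = 0 \/ n < cox_order a b)%N -> opos a u -> opos b u ->
  opos (if odd n then b else a) (alt orefl n a b u).
Proof.
move=> ab nM ua ub l; rewrite oalt_rows //.
have c0 k : (k <= n.+1)%N -> 0 <= (cheb (cheb_arg K (cox_order a b)) k).1.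
  by move=> kn; apply: cheb_ge0; [exact: cox_order_neq1 | case: nM; [left | right; lia]].
by rewrite addr_ge0 // mulr_ge0 // c0.
Qed.

(* Tits: the roots w^-1(alpha_i) are positive exactly when s_i w is longer. *)
Lemma asc_opos i X : (olen X < olen (orefl i X))%N -> opos i X.
Proof.
have [k] := ubnP (olen X); elim: k i X => // k IHk i X Xk Xi.
have [->|Xb] := pselect (X = obase); first by move=> l; rewrite mxE; case: eqP; rewrite ?ler01.
have [j Xj] := exists_odesc Xb.
have ij : i != j by apply/eqP => E; move: Xi Xj; rewrite E; lia.
have [u [n [c [d [cd XE lX ui uj]]]]] := odecomp X ij.
have n0 : (0 < n)%N by case: n XE lX => // XE; move: Xj uj; rewrite XE /=; lia.
have uk : (olen u < k)%N by lia.
have pi := IHk i u uk ui; have pj := IHk j u uk uj.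
have cdn : c != d by case: cd => -[-> ->]; rewrite // eq_sym.
(* The other letter would undo the last reflection and shorten X, whereas i lengthens it. *)
have iE : i = if odd n then d else c.
  have n1 : n = n.-1.+1 by lia.
  have lE : orefl (if odd n.-1 then d else c) X = alt orefl n.-1 c d u.
    by rewrite XE n1 /= oreflK.
  have : i <> if odd n.-1 then d else c.
    move=> E; move: Xi; rewrite E lE; have := olen_alt_le n.-1 c d u; lia.
  by rewrite n1 /=; case: cd => -[-> ->]; case: (odd n.-1).
(* From full dihedral length on, [obraid_shorten] would make i a descent. *)
have nM : (cox_order c d = 0 \/ n < cox_order c d)%N.
  have [M0|M0] := posnP (cox_order c d); [by left | right].
  rewrite ltnNge; apply/negP => Mn.
  have := @obraid_shorten n c d u cdn; rewrite M0 Mn -iE -XE -lX => /(_ isT).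
  by lia.
rewrite iE XE; by apply: orow_alt_ge0 => //; case: cd => -[E1 E2]; rewrite ?E1 ?E2.
Qed.

Lemma desc_row_le0 i X : (olen (orefl i X) < olen X)%N -> forall l, (val X).1 i l <= 0.
Proof.
move=> Xi l; have := @asc_opos i (orefl i X); rewrite oreflK => /(_ Xi l).
by rewrite /= refl0_entry cox_form_diag; lra.
Qed.

(** At a descent the row would be both nonnegative and nonpositive, but the matrix is invertible. *)
Lemma opos_asc i X : opos i X -> (olen X < olen (orefl i X))%N.
Proof.
move=> pX; case: (olen_refl i X) => [->//|E].
have Xi : (olen (orefl i X) < olen X)%N by rewrite E.
have [l] := orow_neq0 X i.
by rewrite eq_le pX (desc_row_le0 Xi).
Qed.

(** With a dihedral part shorter than the order, one of the two rows would be positive; with a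
    longer one, the lengths would not add up. So the dihedral part is the longest element, and the
    order is finite. *)
Lemma two_desc i j X : i != j -> (olen (orefl i X) < olen X)%N ->
  (olen (orefl j X) < olen X)%N -> exists u,
  [/\ (0 < cox_order i j)%N, X = alt orefl (cox_order i j) i j u,
    (olen u < olen (orefl i u))%N & (olen u < olen (orefl j u))%N].
Proof.
move=> ij Xi Xj; have [u [n [c [d [cd XE lX ui uj]]]]] := odecomp X ij.
have cdn : c != d by case: cd => -[-> ->]; rewrite // eq_sym.
have M : cox_order c d = cox_order i j by case: cd => -[-> ->]; rewrite // cox_orderC.
have nM : ~ (cox_order c d = 0 \/ n < cox_order c d)%N.
  move=> nM; have : opos (if odd n then d else c) X.
    rewrite XE; apply: orow_alt_ge0 => //;
    by apply: asc_opos; case: cd => -[E1 E2]; rewrite ?E1 ?E2.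
  by move=> /opos_asc; case: cd => -[-> ->]; case: odd; lia.
have M0 : (0 < cox_order c d)%N by lia.
have Mn : n = cox_order c d.
  apply/eqP; rewrite eqn_leq; apply/andP; split; last by lia.
  rewrite leqNgt; apply/negP => nM'; have n1 : n = n.-1.+1 by lia.
  have := @obraid_shorten n.-1 c d u cdn; rewrite M0 /=.
  have -> : (cox_order c d <= n.-1)%N by lia.
  have -> : orefl (if odd n.-1 then d else c) (alt orefl n.-1 c d u) = X by rewrite XE n1.
  by move=> /(_ isT); lia.
exists u; rewrite -M M0; split=> //; rewrite XE Mn.
by case: cd M0 => -[-> ->] // M0; rewrite obraid // eq_sym.
Qed.

Lemma olen_alt_asc i w n : (n <= m i)%N -> (olen w < olen (orefl i w))%N ->
  (olen w < olen (orefl (ordS i) w))%N ->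
  olen (alt orefl n i (ordS i) w) = (olen w + n)%N /\
  olen (alt orefl n (ordS i) i w) = (olen w + n)%N.
Proof.
move=> nm wi wS; have iS : i != ordS i by rewrite eq_sym ordS_neq.
have Si : ordS i != i by rewrite ordS_neq.
elim: n nm => [|n IHn] nm /=; first by rewrite addn0.
have [l1 l2] := IHn (ltnW nm).
have p1 : opos (if odd n then ordS i else i) (alt orefl n i (ordS i) w).
  by apply: orow_alt_ge0; rewrite ?cox_orderS //; [right | exact: asc_opos | exact: asc_opos].
have p2 : opos (if odd n then i else ordS i) (alt orefl n (ordS i) i w).
  by apply: orow_alt_ge0; rewrite 1?cox_orderC ?cox_orderS //;
     [right | exact: asc_opos | exact: asc_opos].
have := opos_asc p1; have := opos_asc p2; rewrite l1 l2 addnS.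
have := olen_refl_le (if odd n then ordS i else i) (alt orefl n i (ordS i) w).
have := olen_refl_le (if odd n then i else ordS i) (alt orefl n (ordS i) i w).
rewrite l1 l2; split; lia.
Qed.

Lemma oalt_bottom i w : (olen (orefl i w) < olen w)%N ->
  (olen (orefl (ordS i) w) < olen w)%N ->
  let u := alt orefl (m i) i (ordS i) w in
  (olen u < olen (orefl i u))%N /\ (olen u < olen (orefl (ordS i) u))%N.
Proof.
move=> wi wS; have iS : i != ordS i by rewrite eq_sym ordS_neq.
have [u [M0 wE ui uS]] := two_desc iS wi wS.
have -> : alt orefl (m i) i (ordS i) w = u; last by [].
rewrite -(cox_orderS i) wE.
have := @altK _ _ orefl (cox_order i (ordS i)) i (ordS i) u oreflK.
by case: odd => //; rewrite -obraid.
Qed.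

Lemma odesc_adjacent w i j : i != j -> (olen (orefl i w) < olen w)%N ->
  (olen (orefl j w) < olen w)%N -> j = ordS i \/ i = ordS j.
Proof.
move=> ij wi wj; have [u [M0 _ _ _]] := two_desc ij wi wj.
by move: M0; rewrite /cox_order; case: eqP => [->|_]; [left | case: eqP => // ->; right].
Qed.

(* A positive vector x with B x <= 0 can only grow along the group, hence is   *)
(* never sent to a negative one; three descents would do that in rank three.   *)
Lemma ono_three_desc w i :
  (3 < r)%N \/ (r = 3 /\ exists x : 'I_r -> K, (forall j, 0 < x j) /\
     forall j, \sum_l cox_form j l * x l <= 0) ->
  (olen (orefl i w) < olen w)%N -> (olen (orefl (ordS i) w) < olen w)%N ->
  (olen (orefl (ordS (ordS i)) w) < olen w)%N -> False.
Proof.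
case=> [r3|[r3 [x [x0 Bx]]]] wi wS wSS.
  have iSS : i != ordS (ordS i) by rewrite eq_sym ordSS_neq.
  case: (odesc_adjacent iSS wi wSS) => E.
    by have := ordS_neq r_gt2 (ordS i); rewrite E eqxx.
  by have := ordSSS_neq r_gt2 i r3; rewrite -E eqxx.
have grow X l : x l <= \sum_j x j * (val X).1 j l.
  have [k] := ubnP (olen X); elim: k X => // k IHk X Xk.
  have [->|Xb] := pselect (X = obase).
    rewrite (bigD1 l) //= mxE eqxx mulr1 big1 ?addr0 // => j /negbTE jl.
    by rewrite mxE jl mulr0.
  have [j Xj] := exists_odesc Xb.
  apply: le_trans (IHk (orefl j X) _) _; first by lia.
  have -> : \sum_j0 x j0 * (val (orefl j X)).1 j0 l =
     \sum_j0 x j0 * (val X).1 j0 l - (\sum_j0 cox_form j j0 * x j0) * (val X).1 j l.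
    rewrite mulr_suml -sumrB; apply: eq_bigr => j0 _.
    by rewrite refl0_entry; ring.
  by rewrite gerBl mulr_le0 // desc_row_le0.
pose l := i; have := grow w l; have := x0 l.
have neg j : (val w).1 j l <= 0.
  apply: desc_row_le0; have [->//|ji] := eqVneq j i.
  have [->//|jS] := eqVneq j (ordS i); have [->//|jSS] := eqVneq j (ordS (ordS i)).
  have : uniq [:: j; i; ordS i; ordS (ordS i)].
    rewrite /= !inE !negb_or ji jS jSS eq_sym ordS_neq // eq_sym ordSS_neq //.
    by rewrite eq_sym ordS_neq.
  (* A fourth index does not fit into ['I_3]. *)
  by move=> /card_uniqP E; have := max_card (mem [:: j; i; ordS i; ordS (ordS i)]);
     rewrite E card_ord /= r3.
have : \sum_j x j * (val w).1 j l <= 0.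
  by apply: sumr_le0 => j _; rewrite mulr_ge0_le0 // ltW.
lra.
Qed.

Lemma olen_eq0 w : (forall i, (olen w < olen (orefl i w))%N) -> w = obase.
Proof.
move=> asc; apply: contrapT => /exists_odesc [j wj]; have := asc j; lia.
Qed.

Lemma obraidS i w : alt orefl (m i) i (ordS i) w = alt orefl (m i) (ordS i) i w.
Proof.
rewrite -(cox_orderS i); apply: obraid; first by rewrite eq_sym ordS_neq.
by rewrite cox_orderS ltnW.
Qed.

Definition orbit_system
   (H : (3 < r)%N \/ (r = 3 /\ exists x : 'I_r -> K, (forall j, 0 < x j) /\
     forall j, \sum_l cox_form j l * x l <= 0)) : chamber_system m :=
  @ChamberSystem r m orbit orefl obase olen oreflK olen_refl olen_base olen_eq0
    odesc_adjacent (fun w i => @ono_three_desc w i H) obraidS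
    (fun i w n => @olen_alt_asc i w n) (fun i w => @oalt_bottom i w).

End Orbit.

Section TriangleVector.

Variables (K : realType) (m : 'I_3 -> nat).
Hypothesis m_gt1 : forall k, (1 < m k)%N.
Hypothesis angle_sum : \sum_(j < 3) (m j)%:R^-1 <= 1 :> K.

(* Side lengths of a Euclidean triangle two of whose angles are pi/m_0 and     *)
(* pi/m_1; the third one is then at least pi/m_2.                               *)
Lemma triangle_vector : exists x : 'I_3 -> K, (forall j, 0 < x j) /\
  forall j, \sum_l cox_form K m j l * x l <= 0.
Proof.
pose f n : nat := m (inord n).
have mE j : m j = f j by rewrite /f inord_val.
pose A n : K := pi / (f n)%:R.
have f1 n : (1 < f n)%N by exact: m_gt1.
have f0 n : 0 < (f n)%:R :> K by rewrite ltr0n ltnW.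
have Apos n : 0 < A n < pi.
  rewrite divr_gt0 ?pi_gt0 //= ltr_pdivrMr // ltr_pMr ?pi_gt0 //.
  by rewrite ltr1n.
have cE n : cheb_arg K (f n) = 2 * cos (A n) by rewrite /cheb_arg gtn_eqF // ltnW.
have sumA : A 0%N + A 1%N + A 2%N <= pi.
  rewrite -!mulrDr -[leRHS]mulr1 ler_pM2l ?pi_gt0 //.
  by move: angle_sum; rewrite !big_ord_recl big_ord0 !mE addr0 addrA.
pose B := pi - A 0%N - A 1%N.
have [A0 A0'] := andP (Apos 0%N); have [A1 A1'] := andP (Apos 1%N).
have [A2 A2'] := andP (Apos 2%N).
have B0 : 0 < B < pi by rewrite /B; apply/andP; split; lra.
have s0 := sin_gt0_pi (Apos 0%N); have s1 := sin_gt0_pi (Apos 1%N).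
have sB := sin_gt0_pi B0.
have AB : A 2%N <= B by rewrite /B; lra.
have cB : cos B <= cos (A 2%N).
  rewrite le_eqVlt; have [->|nE] := eqVneq B (A 2%N); first by rewrite eqxx.
  rewrite ltr_cos ?in_itv /= ?(ltW A2) ?(ltW A2') //; last first.
    by case/andP: B0 => /ltW -> /ltW ->.
  by rewrite lt_neqAle [A 2%N == B]eq_sym nE AB orbT.
have sBE : sin B = sin (A 0%N) * cos (A 1%N) + cos (A 0%N) * sin (A 1%N).
  by rewrite -sinD /B -addrA -opprD sinB sinpi cospi; ring.
have cBE : cos B = - (cos (A 0%N) * cos (A 1%N) - sin (A 0%N) * sin (A 1%N)).
  by rewrite -cosD /B -addrA -opprD cosB sinpi cospi; ring.
exists (fun j => nth 0 [:: sin (A 1%N); sin B; sin (A 0%N)] j); split.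
  by case=> [[|[|[|//]]] jp].
have e0 := cos2Dsin2 (A 0%N); have e1 := cos2Dsin2 (A 1%N).
case=> [[|[|[|//]]] jp]; rewrite !big_ord_recl big_ord0 /cox_form /cox_order /= !mE /= !cE.
- have -> : 2 * sin (A 1%N) + (- (2 * cos (A 0%N)) * sin B +
     (- (2 * cos (A 2%N)) * sin (A 0%N) + 0)) =
     2 * (sin (A 0%N) * (cos B - cos (A 2%N))).
    have -> : sin (A 1%N) = sin (A 0%N) * cos B + cos (A 0%N) * sin B.
      rewrite sBE cBE -[LHS]mul1r -e0; ring.
    ring.
  by rewrite pmulr_rle0 // pmulr_rle0 // subr_le0.
- by rewrite sBE le_eqVlt; apply/orP; left; apply/eqP; ring.
- have -> : - (2 * cos (A 2%N)) * sin (A 1%N) + (- (2 * cos (A 1%N)) * sin B +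
     (2 * sin (A 0%N) + 0)) = 2 * (sin (A 1%N) * (cos B - cos (A 2%N))).
    have -> : sin (A 0%N) = sin (A 1%N) * cos B + cos (A 1%N) * sin B.
      rewrite sBE cBE -[LHS]mul1r -e1; ring.
    ring.
  by rewrite pmulr_rle0 // pmulr_rle0 // subr_le0.
Qed.

End TriangleVector.

Lemma chamber_system_exists (K : realType) (r : nat) (m : 'I_r -> nat) :
  (2 < r)%N -> (forall j, (1 < m j)%N) ->
  2 <= \sum_(j < r) (1 - (m j)%:R^-1 : rat) -> inhabited (chamber_system m).
Proof.
move=> r2 m1 hs; suff H : (3 < r)%N \/ (r = 3 /\ exists x : 'I_r -> K,
    (forall j, 0 < x j) /\ forall j, \sum_l cox_form K m j l * x l <= 0).
  by split; exact: (orbit_system r2 m1 H).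
have [r3|r3] := ltnP 3 r; [by left | right].
have rE : r = 3 by lia.
move: m m1 hs; rewrite {r2 r3}rE => m m1 hs; split=> //; apply: triangle_vector => //.
rewrite sumrB sumr_const card_ord in hs.
have hs1 : \sum_(j < 3) (m j)%:R^-1 <= 1 :> rat by lra.
have := hs1; rewrite -(ler_rat K) rmorph_sum rmorph1 /=.
by under eq_bigr => i _ do rewrite fmorphV rmorph_nat.
Qed.

(** * The Hecke algebra and its even action *)

Section HeckePolynomials.

Import mpoly.

Variables (K : realType) (r : nat) (m : 'I_r -> nat).
Local Notation R := (qring K m).

Definition heigen (j : 'I_r) (k : 'I_(m j)) : R :=
  laurentC _ (root_exp K k.+1 (m j)) * qvar K k.

Definition hpoly (j : 'I_r) : {poly R} := \prod_(k < m j) ('X - (heigen k)%:P).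

Lemma size_hpoly j : size (hpoly j) = (m j).+1.
Proof. by rewrite size_prod_XsubC -[index_enum _]enumT size_enum_ord. Qed.

Lemma hpoly_monic j : (hpoly j)`_(m j) = 1.
Proof.
have /monicP := monic_prod_XsubC (index_enum 'I_(m j)) xpredT (@heigen j).
by rewrite lead_coefE -/(hpoly j) size_hpoly.
Qed.

Lemma laurentC_mul (c d : K[i]) :
  laurentC (qindex m) c * laurentC _ d = laurentC _ (c * d).
Proof. by apply: val_inj; rewrite /= rmorphM /= rmorphM. Qed.

Lemma root_exp_neq0 k n : root_exp K k n != 0.
Proof.
rewrite /root_exp eq_complex /=; apply/nandP.
set t := _ / _; have := cos2Dsin2 t.
have [->|] := eqVneq (cos t) 0; last by left.
have [->|] := eqVneq (sin t) 0; last by right.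
by rewrite expr0n addr0 => /eqP; rewrite eq_sym oner_eq0.
Qed.

Lemma heigen_inv j (k : 'I_(m j)) : invertible (heigen k).
Proof.
apply: invertibleM; last exact: laurentX_invertible.
exists (laurentC _ (root_exp K k.+1 (m j))^-1); rewrite laurentC_mul mulfV ?root_exp_neq0 //.
by apply: val_inj; rewrite /= !rmorph1.
Qed.

Lemma hpoly0_inv j : invertible (hpoly j)`_0.
Proof.
rewrite -horner_coef0 horner_prod; apply: (big_ind (@invertible R)).
- exact: invertible1.
- exact: invertibleM.
by move=> k _; rewrite hornerXsubC sub0r; apply/invertibleN/heigen_inv.
Qed.

Lemma hpoly_gen j (A : algType R) (c : A) :
  \prod_(k < m j) (c - (heigen k)%:A) = \sum_(q < (m j).+1) (hpoly j)`_q *: c ^+ q.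
Proof.
have <- : horner_alg c (hpoly j) = \prod_(k < m j) (c - (heigen k)%:A).
  rewrite rmorph_prod; apply: eq_bigr => k _.
  by rewrite rmorphB /= horner_algX horner_algC.
rewrite -[X in horner_alg c X](coefK (hpoly j)) poly_def size_hpoly linear_sum.
by apply: eq_bigr => q _; rewrite -mul_polyC rmorphM rmorphXn /= horner_algC horner_algX mulr_algl.
Qed.

End HeckePolynomials.

(** * From a module with rotations to a module with reflections *)

Section OperatorAction.

Variables (R : comNzRingType) (r : nat) (m : 'I_r -> nat) (p : 'I_r -> nat -> R).
Variables (N : lmodType R) (c cV : 'I_r -> {linear N -> N}).
Hypothesis cK : forall j, cancel (c j) (cV j).
Hypothesis cVK : forall j, cancel (cV j) (c j).
Hypothesis c_rel : forall j x, poly_act (p j) (m j) (c j) x = 0.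
Hypothesis c_prod : forall x, foldr (fun j => c j) x (enum 'I_r) = x.

(* The products c_0 ... c_(n-1) realize the elements s_0^-1 s_n. *)
Definition sigma n x := foldr (fun j => c j) x (take n (enum 'I_r)).
Definition sigmaV n x := foldl (fun y j => cV j y) x (take n (enum 'I_r)).

Lemma sigmaK n : cancel (sigma n) (sigmaV n).
Proof.
move=> x; rewrite /sigma /sigmaV; elim: (take _ _) x => //= j s IHs x.
by rewrite cK IHs.
Qed.

Lemma sigmaVK n : cancel (sigmaV n) (sigma n).
Proof.
move=> x; rewrite /sigma /sigmaV; elim: (take _ _) x => //= j s IHs x.
by rewrite IHs cVK.
Qed.

Lemma sigmaS (j : 'I_r) x : sigma (ordS j) x = sigma j (c j x).
Proof.
have E : sigma j.+1 x = sigma j (c j x).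
  by rewrite /sigma (take_nth j) ?size_enum_ord // foldr_rcons nth_ord_enum.
rewrite -E; have [jr|jr] := eqVneq j.+1 r.
  rewrite [val (ordS j)](_ : _ = 0%N) /= ?jr ?modnn //.
  by rewrite /sigma take0 take_oversize ?size_enum_ord //= c_prod.
by rewrite [val (ordS j)]modn_small //; have := ltn_ord j; lia.
Qed.

Lemma sigmaVS (j : 'I_r) x : sigmaV (ordS j) x = cV j (sigmaV j x).
Proof.
by apply: (can_inj (sigmaK (ordS j))); rewrite sigmaVK sigmaS cVK sigmaVK.
Qed.

Lemma sigma_linear n a x y : sigma n (a *: x + y) = a *: sigma n x + sigma n y.
Proof.
by rewrite /sigma; elim: (take _ _) => //= j s ->; rewrite linearPZ.
Qed.

Lemma sigmaV_linear n a x y : sigmaV n (a *: x + y) = a *: sigmaV n x + sigmaV n y.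
Proof.
by apply: (can_inj (sigmaK n)); rewrite sigmaVK sigma_linear !sigmaVK.
Qed.

Lemma sigma0 n : sigma n 0 = 0.
Proof. by have := sigma_linear n (-1) 0 0; rewrite !scaleN1r !addNr. Qed.

Lemma sigmaV0 n : sigmaV n 0 = 0.
Proof. by have := sigmaV_linear n (-1) 0 0; rewrite !scaleN1r !addNr. Qed.

Local Notation V := (N * N)%type.

(** The second factor stands for s_0 N. With sigma_i = s_0 s_i, one has s_i x = s_0 (sigma_i x) and
    s_i (s_0 y) = sigma_i^-1 y; the rotation s_(k+1) s_k on s_0 y becomes the conjugate of c_k by
    sigma_k. *)
Definition op_refl_fun (i : 'I_r) (x : V) : V := (sigmaV i x.2, sigma i x.1).
Definition op_rot_fun (k : 'I_r) (x : V) : V :=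
  (c k x.1, sigma k (c k (sigmaV k x.2))).

Lemma op_refl_linear i : linear (op_refl_fun i).
Proof.
by move=> a [x1 x2] [y1 y2]; rewrite /op_refl_fun /= sigmaV_linear sigma_linear.
Qed.

Lemma op_rot_linear i : linear (op_rot_fun i).
Proof.
move=> a [x1 x2] [y1 y2].
by rewrite /op_rot_fun /= sigmaV_linear !linearPZ sigma_linear.
Qed.

HB.instance Definition _ i :=
  GRing.isLinear.Build R V V *:%R (op_refl_fun i) (op_refl_linear i).
HB.instance Definition _ i :=
  GRing.isLinear.Build R V V *:%R (op_rot_fun i) (op_rot_linear i).

Definition op_refl i : {linear V -> V} := op_refl_fun i.
Definition op_rot i : {linear V -> V} := op_rot_fun i.
Definition op_parity (b : bool) (x : V) : Prop := if b then x.1 = 0 else x.2 = 0.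

Lemma op_reflE i x : op_refl i x = (sigmaV i x.2, sigma i x.1). Proof. by []. Qed.

Lemma op_rotE k x : op_rot k x = (c k x.1, sigma k (c k (sigmaV k x.2))).
Proof. by []. Qed.

Lemma op_reflK i : involutive (op_refl i).
Proof. by case=> x y; rewrite !op_reflE /= sigmaK sigmaVK. Qed.

Lemma op_rot_refl k x : op_rot k (op_refl k x) = op_refl k (op_rot k x).
Proof. by rewrite !op_reflE !op_rotE /= !sigmaK. Qed.

Lemma op_rot_reflS k x : op_rot k (op_refl (ordS k) x) = op_refl (ordS k) (op_rot k x).
Proof.
by rewrite !op_reflE !op_rotE /= !sigmaS !sigmaVS !sigmaK cVK cK.
Qed.

Lemma op_parity_refl b i x : op_parity b x -> op_parity (~~ b) (op_refl i x).
Proof.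
by rewrite op_reflE; case: b => /= ->; rewrite ?sigma0 ?sigmaV0.
Qed.

Lemma op_rot_parity b k x : op_parity b x -> op_rot k x =
  if b then op_refl (ordS k) (op_refl k x) else op_refl k (op_refl (ordS k) x).
Proof.
rewrite !op_reflE op_rotE; case: b => /= ->; rewrite ?(sigma0, sigmaV0, linear0) ?sigmaS //.
by rewrite sigmaK.
Qed.

Lemma op_rot_rel k x : poly_act (p k) (m k) (op_rot k) x = 0.
Proof.
have E q : iter q (op_rot k) x = (iter q (c k) x.1, sigma k (iter q (c k) (sigmaV k x.2))).
  elim: q => [|q IHq]; first by rewrite /= sigmaVK -surjective_pairing.
  by rewrite iterS IHq op_rotE /= sigmaK.
have F (f g : nat -> N) n (a : nat -> R) : \sum_(q < n) a q *: (f q, g q) =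
    (\sum_(q < n) a q *: f q, \sum_(q < n) a q *: g q).
  by elim: n => [|n IHn]; rewrite ?big_ord0 // !big_ord_recr /= IHn.
have sum n (f : nat -> N) (a : nat -> R) : sigma k (\sum_(q < n) a q *: f q) =
    \sum_(q < n) a q *: sigma k (f q).
  elim: n => [|n IHn]; first by rewrite !big_ord0 sigma0.
  by rewrite !big_ord_recr /= addrC sigma_linear IHn addrC.
rewrite /poly_act; under eq_bigr do rewrite E.
rewrite (F (fun q => iter q (c k) x.1) (fun q => sigma k (iter q (c k) (sigmaV k x.2)))).
have := c_rel k x.1; rewrite /poly_act => ->.
rewrite -(sum _ (fun q => iter q (c k) (sigmaV k x.2))).
by have := c_rel k (sigmaV k x.2); rewrite /poly_act => ->; rewrite sigma0.
Qed.

Definition operator_action : polygonal_action m p V :=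
  @PolygonalAction r m R p V op_refl op_rot op_parity op_reflK op_rot_refl op_rot_reflS
    op_parity_refl op_rot_parity op_rot_rel.

End OperatorAction.

(* Unfolding the operations of the monoid algebra or of its quotients makes      *)
(* failing unification attempts diverge.                                         *)
Local Opaque fgmul fgscale fgadd fgopp quotalg_mul quotalg_scale.

Lemma alg_mulDr (R : comNzRingType) (A : algType R) (a x y : A) b :
  a * (b *: x + y) = b *: (a * x) + a * y.
Proof. by rewrite mulrDr scalerAr. Qed.

Section WordAction.

Variables (R : comNzRingType) (T : choiceType) (M : lmodType R).
Variable op : T -> {linear M -> M}.
Local Notation A := {malg R[{fmonom T}]}.
Implicit Types (x y : A) (v : M).

Definition word_op (k : {fmonom T}) v : M := foldr (fun t => op t) v (k : seq T).

Lemma word_op_linear k : linear (word_op k).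
Proof.
move=> a v1 v2; rewrite /word_op; elim: (fmonom_val k) => //= t s ->.
by rewrite linearPZ.
Qed.

Definition free_act x v : M := lin (word_op^~ v) x.

Lemma free_act_linearl v a x y :
  free_act (a *: x + y) v = a *: free_act x v + free_act y v.
Proof. exact: lin_is_linear. Qed.

Lemma free_act_linearr x a v1 v2 : free_act x (a *: v1 + v2) =
  a *: free_act x v1 + free_act x v2.
Proof.
rewrite /free_act /lin scaler_sumr -big_split; apply: eq_bigr => k _ /=.
by rewrite word_op_linear scalerDr !scalerA mulrC.
Qed.

Lemma free_act0 v : free_act 0 v = 0.
Proof. by have := free_act_linearl v (-1) 0 0; rewrite !scaleN1r !addNr. Qed.

Lemma free_actr0 x : free_act x 0 = 0.
Proof. by have := free_act_linearr x (-1) 0 0; rewrite !scaleN1r !addNr. Qed.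

Lemma free_actU k v : free_act << k >> v = word_op k v.
Proof. exact: linU. Qed.

Lemma free_act1 v : free_act 1 v = v.
Proof. by rewrite free_actU /word_op fm1. Qed.

Lemma free_act_gen t v : free_act << fmu t >> v = op t v.
Proof. by rewrite free_actU /word_op fmuE. Qed.

Lemma free_actM x y v : free_act (x * y) v = free_act x (free_act y v).
Proof.
apply: (@malg_linear_ind _ _ (fun x => free_act (x * y) v = free_act x (free_act y v))).
- by rewrite mul0r !free_act0.
- move=> a x1 x2 E1 E2.
  have -> : (a *: x1 + x2) * y = a *: (x1 * y) + x2 * y by rewrite mulrDl -scalerAl.
  rewrite (free_act_linearl v a (x1 * y)) (free_act_linearl _ a x1).
  exact: (f_equal2 (fun u w => a *: u + w) E1 E2).
move=> k1 _.
apply: (@malg_linear_ind _ _ (fun y => free_act (<< k1 >> * y) v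
   = free_act << k1 >> (free_act y v))).
- by rewrite mulr0 free_act0 free_actr0.
- move=> a x1 x2 E1 E2.
  have -> : << k1 >> * (a *: x1 + x2) = a *: (<< k1 >> * x1) + << k1 >> * x2.
    by rewrite mulrDr; congr (_ + _); exact/esym/(@freealg_scalerAr R T a << k1 >> x1).
  rewrite (free_act_linearl v a (<< k1 >> * x1)) (free_act_linearl v a x1).
  rewrite free_act_linearr.
  exact: (f_equal2 (fun u w => a *: u + w) E1 E2).
move=> k2 _; have -> : << k1 >> * << k2 >> = << mmul k1 k2 >> :> A.
  by rewrite malgM_def fgmulUU mulr1.
by rewrite !free_actU /word_op -foldr_cat fmM.
Qed.

Lemma free_actX x q v : free_act (x ^+ q) v = iter q (free_act x) v.
Proof. by elim: q => [|q IHq]; rewrite ?free_act1 // exprS free_actM IHq. Qed.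

Lemma free_act_sum (I : Type) (s : seq I) (a : I -> R) (F : I -> A) v :
  free_act (\sum_(i <- s) a i *: F i) v = \sum_(i <- s) a i *: free_act (F i) v.
Proof.
elim: s => [|i s IHs]; first by rewrite !big_nil free_act0.
by rewrite !big_cons free_act_linearl IHs.
Qed.

Lemma free_act_prod (I : Type) (s : seq I) (F : I -> A) v :
  free_act (\prod_(i <- s) F i) v = foldr (fun i => free_act (F i)) v s.
Proof.
elim: s => [|i s IHs]; first by rewrite big_nil free_act1.
by rewrite big_cons free_actM IHs.
Qed.

End WordAction.

(** * The Hecke algebra as a left module and its universal property *)

Section HeckeModule.

Variables (K : realType) (r : nat) (m : 'I_r -> nat).
Local Notation R := (qring K m).
Local Notation A := (hecke_free K m).
Local Notation T := ('I_r + 'I_r)%type.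
Local Notation H := (hecke K m).

Definition hpi (x : A) : H := quot_pi (@hecke_rel K r m) x.

Lemma hpi_linear a (x y : A) : hpi (a *: x + y) = a *: hpi x + hpi y.
Proof.
apply: (etrans (quot_piD _ _ _)).
exact: (congr1 (fun z : H => z + hpi y) (quot_piZ _ a x)).
Qed.

Lemma hpiK (h : H) : hpi (repr h) = h.
Proof. exact: quot_pi_repr. Qed.

Lemma hpi_eq (x y : A) : hpi x = hpi y -> x - y \in ideal_gen (@hecke_rel K r m).
Proof. by move/quot_piP. Qed.

Lemma hpi_rel (x y b : A) : hecke_rel (x - y) -> hpi (x * b) = hpi (y * b).
Proof.
move=> xy; apply/quot_piP; rewrite -mulrBl.
by apply: ideal_genMr; exact: ideal_gen_rel.
Qed.

Lemma hpi_rel1 (x b : A) : hecke_rel (x - 1) -> hpi (x * b) = hpi b.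
Proof. by move=> /hpi_rel E; exact: (etrans (E b) (congr1 hpi (mul1r b))). Qed.

Lemma hpi0 : hpi 0 = 0.
Proof.
have E : hpi (-1 *: 0 + 0) = hpi 0 by congr hpi; rewrite scaler0 addr0.
by have := hpi_linear (-1) 0 0; rewrite E scaleN1r addNr.
Qed.

Definition hmul_fun (a : A) (h : H) : H := hpi (a * repr h).

Lemma hmulE a (x : A) : hmul_fun a (hpi x) = hpi (a * x).
Proof.
apply/quot_piP; rewrite -mulrBr; apply: ideal_genMl; apply: hpi_eq.
exact: hpiK.
Qed.

Lemma hmul_linear a : linear (hmul_fun a).
Proof.
move=> b h1 h2.
have E : hpi (b *: repr h1 + repr h2) = b *: h1 + h2.
  apply: (etrans (hpi_linear _ _ _)).
  exact: (f_equal2 (fun u w : H => b *: u + w) (hpiK h1) (hpiK h2)).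
apply: (etrans (congr1 (hmul_fun a) (esym E))); apply: (etrans (hmulE _ _)).
exact: (etrans (congr1 hpi (alg_mulDr _ _ _ _)) (hpi_linear _ _ _)).
Qed.

HB.instance Definition _ a := GRing.isLinear.Build R H H *:%R (hmul_fun a) (hmul_linear a).

Definition hmul a : {linear H -> H} := hmul_fun a.
Definition hone : H := hpi 1.

Definition hgen (j : 'I_r) := hmul (cgen K m j).
Definition hgenV (j : 'I_r) := hmul (cgenV K m j).

Lemma hgenK j : cancel (hgen j) (hgenV j).
Proof.
move=> h; rewrite -(hpiK h); move: (repr h) => x.
rewrite [hgen j _]hmulE [hgenV j _]hmulE mulrA.
exact: hpi_rel1 (@hecke_rel_invl K r m j).
Qed.

Lemma hgenVK j : cancel (hgenV j) (hgen j).
Proof.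
move=> h; rewrite -(hpiK h); move: (repr h) => x.
rewrite [hgenV j _]hmulE [hgen j _]hmulE mulrA.
exact: hpi_rel1 (@hecke_rel_invr K r m j).
Qed.

Lemma hgen_rel j h : poly_act (fun q => (hpoly K m j)`_q) (m j) (hgen j) h = 0.
Proof.
rewrite -(hpiK h); move: (repr h) => x.
have E q : iter q (hgen j) (hpi x) = hpi (cgen K m j ^+ q * x).
  elim: q => [|q IHq]; first exact: (congr1 hpi (esym (mul1r x))).
  rewrite iterS IHq; apply: (etrans (hmulE _ _)); apply: (congr1 hpi).
  by rewrite exprS mulrA.
have F n (a : nat -> R) (f : nat -> A) :
    \sum_(q < n) a q *: hpi (f q * x) = hpi ((\sum_(q < n) a q *: f q) * x).
  elim: n => [|n IHn]; first by rewrite !big_ord0 (congr1 hpi (mul0r x)) hpi0.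
  rewrite !big_ord_recr /= IHn addrC -hpi_linear; apply: (congr1 hpi).
  by rewrite addrC mulrDl scalerAl.
rewrite /poly_act (eq_bigr (fun q : 'I_(m j).+1 => (hpoly K m j)`_q *: hpi (cgen K m j ^+ q * x)));
  last by move=> q _; rewrite E.
rewrite (F _ (fun q => (hpoly K m j)`_q) (fun q => cgen K m j ^+ q)) -hpoly_gen.
apply: (etrans (hpi_rel (y := 0) x _)); last by rewrite (congr1 hpi (mul0r x)) hpi0.
by rewrite subr0; exact: hecke_rel_poly.
Qed.

Lemma hgen_prod h : foldr (fun j => hgen j) h (enum 'I_r) = h.
Proof.
rewrite -(hpiK h); move: (repr h) => x.
have E (s : seq 'I_r) : foldr (fun j => hgen j) (hpi x) s =
   hpi ((\prod_(j <- s) cgen K m j) * x).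
  elim: s => [|j s IHs]; first by rewrite big_nil; exact: (congr1 hpi (esym (mul1r x))).
  rewrite [LHS]/= IHs; apply: (etrans (hmulE _ _)); apply: (congr1 hpi).
  by rewrite big_cons mulrA.
rewrite E enumT; apply: hpi_rel1; exact: hecke_rel_prod.
Qed.

Definition hecke_action := operator_action hgenK hgenVK hgen_rel hgen_prod.

Lemma hecke_ind (Q : H -> Prop) : Q 0 ->
  (forall a h1 h2, Q h1 -> Q h2 -> Q (a *: h1 + h2)) -> Q hone ->
  (forall j h, Q h -> Q (hgen j h)) -> (forall j h, Q h -> Q (hgenV j h)) ->
  forall h, Q h.
Proof.
move=> Q0 QP Q1 Qg QgV h; rewrite -(hpiK h); move: (repr h) => x.
apply: (@malg_linear_ind _ _ (fun x => Q (hpi x)) x).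
- by have := hpi_linear (-1) 0 0; rewrite scaleN1r addNr scaleN1r addNr => ->.
- by move=> a x1 x2 q1 q2; rewrite hpi_linear; exact: QP.
move=> [k] _; elim: k => [|t k IHk].
  have -> : << FMonom [::] >> = 1 :> A by rewrite -fmoneE.
  exact: Q1.
have -> : << FMonom (t :: k) >> = freegen R t * << FMonom k >> :> A.
  rewrite /freegen malgM_def fgmulUU mulr1; congr (<< _ *g _ >>).
  by rewrite fmuE -[mmul _ _]/(fmmul _ _) fmmulE.
by case: t => j; [move: (Qg j _ IHk) | move: (QgV j _ IHk)]; rewrite [_ (hpi _)]hmulE.
Qed.

(** The relations are asked only on a stable submodule [E], in the application the even vectors,
    because S_k S_(k+1) is the rotation only there. *)
Lemma hecke_universal (M : lmodType R) (f fV : 'I_r -> {linear M -> M})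
  (E : M -> Prop) (v0 : M) : E v0 ->
  E 0 -> (forall a v1 v2, E v1 -> E v2 -> E (a *: v1 + v2)) ->
  (forall j v, E v -> E (f j v)) -> (forall j v, E v -> E (fV j v)) ->
  (forall j v, E v -> f j (fV j v) = v) -> (forall j v, E v -> fV j (f j v) = v) ->
  (forall j v, E v -> poly_act (fun q => (hpoly K m j)`_q) (m j) (f j) v = 0) ->
  (forall v, E v -> foldr (fun j => f j) v (enum 'I_r) = v) ->
  exists psi : {linear H -> M}, [/\ psi hone = v0,
    forall j h, psi (hgen j h) = f j (psi h) &
    forall j h, psi (hgenV j h) = fV j (psi h)].
Proof.
move=> Ev0 E0 EP Ef EfV fK fVK frel fprod.
pose op (t : T) : {linear M -> M} := match t with inl j => f j | inr j => fV j end.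
pose rho (x : A) v := free_act op x v.
have Erho x v : E v -> E (rho x v).
  move=> Ev; rewrite /rho /free_act /lin.
  apply: (big_ind E E0) => [v1 v2 e1 e2|k _].
    by rewrite -[v1]scale1r; exact: EP.
  rewrite -[X in E X]addr0; apply: EP => //; rewrite /word_op.
  by elim: (fmonom_val k) => //= -[j|j] s IHs; [exact: Ef | exact: EfV].
have rhoM x y v : rho (x * y) v = rho x (rho y v) by exact: free_actM.
have rho_lin a x y v : rho (a *: x + y) v = a *: rho x v + rho y v.
  exact: free_act_linearl.
have rhoB x y v : rho (x - y) v = rho x v - rho y v.
  by have := rho_lin (-1) y x v; rewrite !scaleN1r addrC => ->; rewrite addrC.
have rho1 v : rho 1 v = v by exact: free_act1.
have rho_c j v : rho (cgen K m j) v = f j v by exact: (free_act_gen op (inl j)).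
have rho_cV j v : rho (cgenV K m j) v = fV j v by exact: (free_act_gen op (inr j)).
have rho_rel s v : hecke_rel s -> E v -> rho s v = 0.
  case=> [j|j|j|] Ev; rewrite ?rhoB ?rho1.
  - by rewrite rhoM rho_c rho_cV fK // subrr.
  - by rewrite rhoM rho_c rho_cV fVK // subrr.
  - apply: (etrans (congr1 (rho^~ v) (hpoly_gen j (cgen K m j)))).
    have -> : rho (\sum_(q < (m j).+1) (hpoly K m j)`_q *: cgen K m j ^+ q) v =
       \sum_(q < (m j).+1) (hpoly K m j)`_q *: rho (cgen K m j ^+ q) v.
      exact: free_act_sum.
    rewrite -[RHS](frel j v Ev) /poly_act; apply: eq_bigr => q _; congr (_ *: _).
    have -> : rho (cgen K m j ^+ q) v = iter q (rho (cgen K m j)) v by exact: free_actX.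
    by elim: {q}(nat_of_ord q) => //= q ->; rewrite rho_c.
  have -> : rho (\prod_(j < r) cgen K m j) v =
      foldr (fun j => rho (cgen K m j)) v (index_enum 'I_r) by exact: free_act_prod.
  rewrite -[index_enum _]enumT.
  rewrite -[X in _ - X](fprod v Ev); apply/eqP; rewrite subr_eq0; apply/eqP.
  by elim: (enum _) => //= j s' IHs; rewrite IHs rho_c.
have rho_ideal x v : x \in ideal_gen (@hecke_rel K r m) -> E v -> rho x v = 0.
  move=> /asboolP[s [sS ->]] Ev; elim: s sS => [|t s IHs] sS.
    by rewrite big_nil; exact: free_act0.
  have := rho_lin 1 (t.1.1 * t.1.2 * t.2) (\sum_(u <- s) u.1.1 * u.1.2 * u.2) v.
  rewrite !scale1r big_cons => ->; rewrite IHs ?addr0; last first.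
    by move=> u us; apply: sS; rewrite inE us orbT.
  rewrite !rhoM (rho_rel t.1.2 (rho t.2 v)); last exact: Erho.
    exact: free_actr0.
  by apply: sS; rewrite mem_head.
pose psi_fun (h : H) := rho (repr h) v0.
have psiE x : psi_fun (hpi x) = rho x v0.
  apply/eqP; rewrite -subr_eq0 -rhoB rho_ideal //; apply: hpi_eq; exact: hpiK.
have psi_lin : linear psi_fun.
  by move=> a h1 h2; rewrite -{1}(hpiK h1) -{1}(hpiK h2) -hpi_linear psiE rho_lin.
pose Psi : {linear H -> M} := HB.pack psi_fun (GRing.isLinear.Build R H M *:%R psi_fun psi_lin).
exists Psi; split=> [|j h|j h].
- exact: (etrans (psiE 1)).
- by rewrite -(hpiK h) [hgen j _]hmulE; apply: (etrans (psiE _)); rewrite rhoM -psiE rho_c.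
- by rewrite -(hpiK h) [hgenV j _]hmulE; apply: (etrans (psiE _)); rewrite rhoM -psiE rho_cV.
Qed.

End HeckeModule.

(** Neighbouring factors cancel by involutivity, and [ordS] closes the cycle. *)
Lemma foldr_telescope (r : nat) (r_gt0 : (0 < r)%N) (V : Type) (g : 'I_r -> V -> V) :
  (forall i, involutive (g i)) -> let h := fun j x => g j (g (ordS j) x) in
  (forall (i : 'I_r) x, foldr h x (take i (enum 'I_r)) = g (Ordinal r_gt0) (g i x)) /\
  (forall x, foldr h x (enum 'I_r) = x).
Proof.
move=> gK h; pose o0 := Ordinal r_gt0; rewrite -/o0.
have H (i : 'I_r) x : foldr h x (take i (enum 'I_r)) = g o0 (g i x).
  case: i => n; elim: n x => [|n IHn] x nr.
    by rewrite take0 (_ : Ordinal nr = o0) ?gK //; exact: val_inj.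
  have nr' : (n < r)%N by exact: ltnW.
  rewrite [val _]/= (take_nth o0) ?size_enum_ord // foldr_rcons (IHn _ nr').
  have -> : nth o0 (enum 'I_r) n = Ordinal nr' by apply: val_inj; rewrite /= nth_enum_ord.
  have -> : h (Ordinal nr') x = g (Ordinal nr') (g (Ordinal nr) x).
    by rewrite /h; congr (g _ (g _ _)); apply: val_inj; rewrite /= modn_small.
  by rewrite gK.
split=> // x; have r1 : (r.-1 < r)%N by rewrite prednK.
have sE : enum 'I_r = rcons (take r.-1 (enum 'I_r)) (Ordinal r1).
  have tk : take r.-1.+1 (enum 'I_r) = enum 'I_r.
    by apply: take_oversize; rewrite size_enum_ord prednK.
  rewrite -{1}tk (take_nth o0) ?size_enum_ord //; congr (rcons _ _).
  by apply: val_inj; rewrite /= nth_enum_ord.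
rewrite sE foldr_rcons -[X in take X]/(val (Ordinal r1)) H /h.
have -> : ordS (Ordinal r1) = o0 by apply: val_inj; rewrite /= prednK // modnn.
by rewrite !gK.
Qed.

Local Opaque act.

(** * Freeness from a chamber system *)

Section HeckeFree.

Variables (K : realType) (r : nat) (m : 'I_r -> nat) (W : chamber_system m).
Hypothesis r_gt0 : (0 < r)%N.
Hypothesis m_gt1 : forall k, (1 < m k)%N.
Local Notation R := (qring K m).
Local Notation H := (hecke K m).
Local Notation M := {malg R[W]}.
Local Notation len := (@len r m W).
Local Notation p := (fun (j : 'I_r) (q : nat) => (hpoly K m j)`_q).
Local Notation act := (@act r m W R p).
Local Notation V := (H * H)%type.
Local Notation c := (@hgen K r m).
Local Notation cV := (@hgenV K r m).

Lemma p_monic (j : 'I_r) : p j (m j) = 1. Proof. exact: hpoly_monic. Qed.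
Lemma p0_inv (j : 'I_r) : invertible (p j 0). Proof. exact: hpoly0_inv. Qed.


(** [psi] applies an element of H to the neutral chamber, and b w is the even component of
    [phi << w >>]. The even vectors have an image under [phi] that contains 1 and is closed under
    all c_j and their inverses, so the b w span. *)
Lemma chamber_pairing : exists psi : {linear H -> M}, exists b : W -> H,
  (forall w, ~~ odd (len w) -> psi (b w) = << w >>) /\
  (forall h, exists v : M, (forall w, v@_w != 0 -> ~~ odd (len w)) /\
     h = \sum_(w <- msupp v) v@_w *: b w).
Proof.
pose o0 := Ordinal r_gt0.
have AK : forall i, involutive (act i) by exact: (@actK r m W m_gt1 R p p0_inv).
have pU (w : W) : parity (odd (len w)) (<< w >> : M) by exact: parityU.
have [f fE] : exists f : 'I_r -> {linear M -> M},
    forall j v, f j v = act j (act (ordS j) v).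
  by exists (fun j => act j \o act (ordS j)).
have [fV fVE] : exists f : 'I_r -> {linear M -> M},
    forall j v, f j v = act (ordS j) (act j v).
  exists (fun j => act (ordS j) \o act j) => j v; exact: erefl.
have pact b i v : parity b v -> parity (~~ b) (act i v).
  exact: (@parity_act r m W m_gt1 R p p0_inv).
have Ef j v : parity false v -> parity false (f j v).
  move=> Ev; rewrite fE; exact: (pact true j _ (pact false (ordS j) _ Ev)).
have EfV j v : parity false v -> parity false (fV j v).
  move=> Ev; rewrite fVE; exact: (pact true (ordS j) _ (pact false j _ Ev)).
have [act_take act_foldr] := foldr_telescope r_gt0 AK.
have [psi [psi1 psic psicV]] : exists psi : {linear H -> M}, [/\ psi (hone K m) = << base W >>,
    forall j h, psi (c j h) = f j (psi h) & forall j h, psi (cV j h) = fV j (psi h)].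
  apply: (@hecke_universal K r m M f fV (parity false)) => //.
  - by have := pU (base W); rewrite len_base.
  - exact: parity0.
  - by move=> a v1 v2; exact: parityZD.
  - by move=> j v _; rewrite fE fVE !AK.
  - by move=> j v _; rewrite fE fVE !AK.
  - move=> j v Ev; rewrite -[RHS](@rot_rel r m W m_gt1 R p p_monic p0_inv j v).
    apply: eq_bigr => q _; congr (_ *: _).
    have : iter q (f j) v = iter q (rot W p j) v /\ parity false (iter q (f j) v).
      elim: {q}(nat_of_ord q) => // q [E1 E2]; rewrite !iterS -E1; split; last exact: Ef.
      by rewrite (rotE _ j E2).
    by case.
  move=> v _; rewrite -[RHS]act_foldr.
  by elim: (enum _) => //= j s IHs; rewrite fE IHs.
have [phi [phi1 phia phip]] := @chamber_universal r m W m_gt1 R p p_monic p0_inv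
   V (hecke_action K m) (hone K m, 0) (erefl _).
have refl1 i x : (pa_refl (hecke_action K m) i x).1 = sigmaV cV i x.2 := erefl _.
have refl2 i x : (pa_refl (hecke_action K m) i x).2 = sigma c i x.1 := erefl _.
have psi_sigma (i : 'I_r) h : psi (sigma c i h) = act o0 (act i (psi h)).
  rewrite -act_take /sigma; elim: (take _ _) => // j s IHs.
  by rewrite [foldr _ _ _]/= psic IHs fE.
have psi_sigmaV (i : 'I_r) h : psi (sigmaV cV i h) = act i (act o0 (psi h)).
  have := psi_sigma i (sigmaV cV i h).
  by rewrite (sigmaVK (@hgenVK K r m)) => ->; rewrite !AK.
(* For odd w the second component represents s_0 times an element, whence the reflection
   [act o0]. *)
have psi_phi n w : (len w < n)%N ->
   if odd (len w) then psi (phi << w >>).2 = act o0 << w >>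
   else psi (phi << w >>).1 = << w >>.
  elim: n w => // n IHn w wn; have [->|wb] := eqVneq w (base W).
    by rewrite len_base phi1 psi1.
  have [i wi ti] := exists_primary (elimN eqP wb).
  have wE : act i << refl i w >> = << w >>.
    by rewrite act_primary ?reflK // desc_refl wi.
  have phiw : phi << w >> = pa_refl (hecke_action K m) i (phi << refl i w >>).
    by rewrite -phia wE.
  have lw : (len (refl i w) < n)%N by have := len_desc wi; lia.
  have := IHn (refl i w) lw; rewrite odd_len_refl phiw refl1 refl2.
  case: (odd (len w)) => E.
    apply: (etrans (psi_sigma i _)).
    apply: (etrans (congr1 (fun z => act o0 (act i z)) E)).
    exact: (congr1 (act o0) wE).
  apply: (etrans (psi_sigmaV i _)).
  apply: (etrans (congr1 (fun z => act i (act o0 z)) E)).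
  exact: (etrans (congr1 (act i) (AK o0 _)) wE).
exists psi, (fun w => (phi << w >>).1); split=> [w ow|h].
  by have := psi_phi _ w (leqnn _); rewrite (negbTE ow).
suff [v Ev ->] : exists2 v : M, parity false v & h = (phi v).1.
  exists v; split=> [w vw|]; first by rewrite (parity_supp Ev vw).
  rewrite {1}[v]malg_sumU linear_sum.
  apply: (etrans (big_morph (fun x : V => x.1) (fun x y => erefl _) (erefl _) _ _ _)).
  by apply: eq_bigr => w _; rewrite linearZZ.
move: h; apply: hecke_ind.
- by exists 0; [exact: parity0 | rewrite linear0].
- move=> a h1 h2 [v1 E1 ->] [v2 E2 ->]; exists (a *: v1 + v2); first exact: parityZD.
  by rewrite linearPZ.
- by exists << base W >>; [have := pU (base W); rewrite len_base | rewrite phi1].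
- move=> j h [v Ev ->]; exists (f j v); first exact: Ef.
  rewrite fE !phia refl1 refl2 (sigmaS (@hgen_prod K r m)).
  by rewrite (sigmaK (@hgenK K r m)).
- move=> j h [v Ev ->]; exists (fV j v); first exact: EfV.
  rewrite fVE !phia refl1 refl2.
  rewrite (sigmaVS (@hgenK K r m) (@hgenVK K r m) (@hgen_prod K r m)).
  by rewrite (sigmaK (@hgenK K r m)).
Qed.

(** The coordinates of [psi] are functionals dual to the family b, which gives independence. *)
Lemma hecke_free_of_chambers : free_module R H.
Proof.
have [psi [b [psi_b span]]] := chamber_pairing.
exists (fun h => exists2 w, ~~ odd (len w) & h = b w); split.
  move=> s a us sB s0 h hs; have [w ow hE] := sB h hs.
  have term (g : H) : (psi (a g *: g))@_w = a g * (psi g)@_w.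
    by rewrite linearZZ mcoeffZ.
  have psih : psi h = << w >> by rewrite hE; exact: psi_b.
  have E0 : \sum_(g <- s) a g * (psi g)@_w = 0.
    have := congr1 (fun v : M => v@_w) (congr1 psi s0).
    rewrite linear0 mcoeff0 linear_sum raddf_sum /= => E'; rewrite -[RHS]E'.
    by apply: eq_bigr => g _; rewrite term.
  rewrite (bigD1_seq h hs us) /= psih mcoeff_gen eqxx mulr1 in E0.
  rewrite -[LHS]addr0 -[RHS]E0; congr (_ + _); apply/esym.
  rewrite big_seq_cond; apply: big1 => g /andP[gs gh].
  have [x ox gE] := sB g gs.
  have -> : psi g = << x >> by rewrite gE; exact: psi_b.
  rewrite mcoeff_gen; case: (x =P w) => [xw|_]; last exact: mulr0.
  by move: gh; rewrite gE hE xw eqxx.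
move=> h; have [v [vo hE]] := span h.
(* Coefficients must be functions of the vector g; the coordinates of [psi g] select the w with g =
   b w. *)
exists [seq b w | w <- msupp v], (fun g => \sum_(w <- msupp v) v@_w * (psi g)@_w); split.
  by move=> _ /mapP[w wv ->]; exists w; rewrite ?vo // mcoeff_neq0.
rewrite big_map hE; apply: eq_big_seq => w wv.
apply: (congr1 (fun z => z *: b w)).
have -> : psi (b w) = << w >> by apply: psi_b; apply: vo; rewrite mcoeff_neq0.
rewrite (bigD1_seq w wv) ?fset_uniq //= mcoeff_gen eqxx mulr1 big1 ?addr0 // => x xw.
by rewrite mcoeff_gen eq_sym (negbTE xw) mulr0.
Qed.

End HeckeFree.

(** * Spherical triangles *)

Fixpoint altw (I : Type) n (a b : I) : seq I :=
  if n is n'.+1 then (if odd n' then b else a) :: altw n' a b else [::].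

Lemma size_altw (I : Type) n (a b : I) : size (altw n a b) = n.
Proof. by elim: n => //= n ->. Qed.

Lemma foldr_altw (I X : Type) (g : I -> X -> X) n a b x :
  foldr g x (altw n a b) = alt g n a b x.
Proof. by elim: n => //= n ->. Qed.

Lemma map_altw (I J : Type) (f : I -> J) n a b :
  map f (altw n a b) = altw n (f a) (f b).
Proof. by elim: n => //= n ->; case: (odd n). Qed.

(** * Words modulo shorter words *)

Section Words.

Variables (R : comNzRingType) (r : nat) (m : 'I_r -> nat) (p : 'I_r -> nat -> R).
Hypothesis p_monic : forall k, p k (m k) = 1.
Hypothesis p0_inv : forall k, invertible (p k 0).
Variables (V : lmodType R) (A : polygonal_action m p V) (v0 : V).
Hypothesis par0 : pa_parity A false v0.
Implicit Types (w u : seq 'I_r) (i j k : 'I_r) (v x y : V).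

Definition wd w : V := foldr (fun i => pa_refl A i) v0 w.

Definition wspan n v : Prop := exists s : seq (R * seq 'I_r),
  all (fun z => size z.2 < n)%N s /\ v = \sum_(z <- s) z.1 *: wd z.2.

Lemma wspan0 n : wspan n 0.
Proof. by exists [::]; rewrite big_nil. Qed.

Lemma wspanD n v y : wspan n v -> wspan n y -> wspan n (v + y).
Proof. by move=> [s [ss ->]] [t [ts ->]]; exists (s ++ t); rewrite all_cat ss ts big_cat. Qed.

Lemma wspanZ n a v : wspan n v -> wspan n (a *: v).
Proof.
move=> [s [ss ->]]; exists [seq (a * z.1, z.2) | z <- s]; rewrite all_map big_map.
by rewrite scaler_sumr; split=> //; apply: eq_bigr => z _; rewrite scalerA.
Qed.

Lemma wspanN n v : wspan n v -> wspan n (- v).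
Proof. by rewrite -scaleN1r; exact: wspanZ. Qed.

Lemma wspan_sum n (I : Type) (t : seq I) (P : pred I) (F : I -> V) :
  (forall z, P z -> wspan n (F z)) -> wspan n (\sum_(i <- t | P i) F i).
Proof. by move=> nF; apply: (big_ind (wspan n) (wspan0 n) (@wspanD n)). Qed.

Lemma wspan_leq n n' v : (n <= n')%N -> wspan n v -> wspan n' v.
Proof.
move=> nn [s [ss ->]]; exists s; split=> //; apply: sub_all ss => z zn.
exact: leq_trans zn nn.
Qed.

Lemma wspan_wd n w : (size w < n)%N -> wspan n (wd w).
Proof. by move=> wn; exists [:: (1, w)]; rewrite big_seq1 scale1r /= wn. Qed.

Lemma wspan_refl n i v : wspan n v -> wspan n.+1 (pa_refl A i v).
Proof.
move=> [s [ss ->]]; rewrite linear_sum big_seq; apply: wspan_sum => z zs.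
by rewrite linearZZ; apply: wspanZ; apply: (@wspan_wd _ (i :: z.2)); exact: (allP ss).
Qed.

Definition redundant w := wspan (size w) (wd w).

(** Equality up to a unit in the graded module associated with word length. *)
Definition weqv w u := size w = size u /\
  exists2 a, invertible a & wspan (size w) (wd w - a *: wd u).

Lemma weqv_refl w : weqv w w.
Proof.
by split=> //; exists 1; [exact: invertible1 | rewrite scale1r subrr; exact: wspan0].
Qed.

Lemma weqv_sym w u : weqv w u -> weqv u w.
Proof.
move=> [wu [a ua ws]]; split=> //; exists (inverse a); first exact: invertible_inverse.
rewrite -wu; have -> : wd u - inverse a *: wd w = - inverse a *: (wd w - a *: wd u).
  by rewrite scaleNr scalerBr scalerA mulVr_inverse // scale1r opprB.
exact: wspanZ.
Qed.

Lemma weqv_trans w u t : weqv w u -> weqv u t -> weqv w t.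
Proof.
move=> [wu [a ua ws]] [ut [b ub us]]; split; first by rewrite wu.
exists (a * b); first exact: invertibleM.
have -> : wd w - (a * b) *: wd t = (wd w - a *: wd u) + a *: (wd u - b *: wd t).
  by rewrite scalerBr scalerA addrA subrK.
by apply: wspanD => //; apply: wspanZ; rewrite wu.
Qed.

Lemma weqv_cons i w u : weqv w u -> weqv (i :: w) (i :: u).
Proof.
move=> [wu [a ua ws]]; split; first by rewrite /= wu.
by exists a => //; have := wspan_refl i ws; rewrite linearB linearZZ.
Qed.

Lemma redundant_eqv w u : weqv w u -> redundant u -> redundant w.
Proof.
move=> [wu [a ua ws]] ru; rewrite /redundant -[wd w](subrK (a *: wd u)).
by apply: wspanD => //; apply: wspanZ; rewrite wu.
Qed.

Lemma redundant_cat t w : redundant w -> redundant (t ++ w).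
Proof. by move=> rw; elim: t => //= i t; exact: wspan_refl. Qed.

Lemma redundant_double i w : redundant (i :: i :: w).
Proof. by rewrite /redundant /= pa_reflK; apply: wspan_wd; rewrite ltnS leqnSn. Qed.

Lemma parity_wd w : pa_parity A (odd (size w)) (wd w).
Proof. by elim: w => //= i w IHw; exact: pa_parity_refl. Qed.

Lemma wd_alt n a b w : wd (altw n a b ++ w) = alt (pa_refl A) n a b (wd w).
Proof. by rewrite /wd foldr_cat foldr_altw. Qed.

(** In the symmetric form of the relation the extreme terms are the two alternating words, with
    coefficients 1 and p_k(0); all others are shorter. *)
Lemma weqv_braidS k w : (0 < m k)%N ->
  weqv (altw (m k) k (ordS k) ++ w) (altw (m k) (ordS k) k ++ w).
Proof.
move=> mk; suff H : weqv (altw (m k) (if odd (size w) then k else ordS k)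
    (if odd (size w) then ordS k else k) ++ w)
   (altw (m k) (if odd (size w) then ordS k else k)
    (if odd (size w) then k else ordS k) ++ w).
  by case: odd H => // /weqv_sym.
have := pa_line k (parity_wd w); set a := if _ then _ else _; set b := if _ then _ else _.
rewrite big_ord_recr /= p_monic scale1r {2}/line -addnn leq_addr addnK => E.
split; first by rewrite !size_cat !size_altw.
exists (- p k 0); first exact: invertibleN.
rewrite !wd_alt scaleNr opprK size_cat size_altw.
have [n mE] : exists n, m k = n.+1 by exists (m k).-1; rewrite prednK.
have sumE (F : nat -> V) : \sum_(q < m k) F q = F 0 + \sum_(q < n) F q.+1.
  by rewrite mE big_ord_recl.
move: E; rewrite (sumE (fun q => p k q *: line (pa_refl A) (m k) a b q (wd w))) line0.
rewrite -addrA [_ + alt _ _ _ _ _]addrC addrA => /eqP.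
rewrite addr_eq0 => /eqP E; rewrite addrC E; apply: wspanN.
apply: wspan_sum => q _; apply: wspanZ; rewrite /line.
have qn := ltn_ord q; case: leqP => mq; rewrite -wd_alt; apply: wspan_wd;
  by rewrite size_cat size_altw; lia.
Qed.

Lemma weqv_braid a b w : a != b -> (0 < cox_order m a b)%N ->
  weqv (altw (cox_order m a b) a b ++ w) (altw (cox_order m a b) b a ++ w).
Proof.
move=> ab; rewrite /cox_order; case: eqP => [-> m0|_]; first exact: weqv_braidS.
by case: eqP => // -> m0; apply: weqv_sym; exact: weqv_braidS.
Qed.

Lemma wspan_bound N : (forall w, (N <= size w)%N -> redundant w) ->
  forall w, wspan N (wd w).
Proof.
move=> H w; have [k] := ubnP (size w); elim: k w => // k IHk w wk.
have [wN|Nw] := ltnP (size w) N; first exact: wspan_wd.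
have [s [ss ->]] := H w Nw; rewrite big_seq; apply: wspan_sum => z zs.
apply/wspanZ/IHk; have := allP ss _ zs => /= zw; lia.
Qed.

End Words.

(* Left cosets of the dihedral parabolic <1, 2> in a Coxeter group on the       *)
(* letters 0, 1, 2: [coset_table] checks that a letter times a representative   *)
(* is, up to braid moves, shorter, a representative, or a representative times  *)
(* 1 or 2. An order 0 means that the corresponding braid move is not used.      *)
Section CosetTable.

Variable o : nat -> nat -> nat.

Definition braid_head (w : seq nat) : seq (seq nat) :=
  [seq altw (o z.1 z.2) z.2 z.1 ++ drop (o z.1 z.2) w
   | z <- [:: (0, 1); (1, 0); (0, 2); (2, 0); (1, 2); (2, 1)]%N
   & (0 < o z.1 z.2)%N && (take (o z.1 z.2) w == altw (o z.1 z.2) z.1 z.2)].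

Fixpoint braid_moves (w : seq nat) : seq (seq nat) :=
  braid_head w ++ (if w is l :: w' then map (cons l) (braid_moves w') else [::]).

Definition braid_class (n : nat) (w : seq nat) : seq (seq nat) :=
  iter n (fun s => undup (s ++ flatten (map braid_moves s))) [:: w].

Fixpoint has_double (w : seq nat) : bool :=
  if w is l :: w' then (if w' is l' :: _ then l == l' else false) || has_double w'
  else false.

Definition coset_ok (t : seq (seq nat)) (w : seq nat) : bool :=
  [|| has_double w, w \in t |
      [&& (last 0 w == 1) || (last 0 w == 2) & take (size w).-1 w \in t]]%N.

Definition coset_table (t : seq (seq nat)) : bool :=
  ([::] \in t) &&
  all (fun x => all (fun l => has (coset_ok t) (braid_class 10 (l :: x))) [:: 0; 1; 2]%N) t.

End CosetTable.

(** * Normal forms from a coset table *)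

Section CosetEnumeration.

Variables (R : comNzRingType) (r : nat) (m : 'I_r -> nat) (p : 'I_r -> nat -> R).
Hypothesis p_monic : forall k, p k (m k) = 1.
Hypothesis p0_inv : forall k, invertible (p k 0).
Variables (V : lmodType R) (A : polygonal_action m p V) (v0 : V).
Hypothesis par0 : pa_parity A false v0.

Variables (f : nat -> 'I_r) (o : nat -> nat -> nat) (t : seq (seq nat)).
Hypothesis f_inj : forall a b, (a < 3)%N -> (b < 3)%N -> f a = f b -> a = b.
Hypothesis f_surj : forall i, exists2 a, (a < 3)%N & i = f a.
Hypothesis o_diag : forall a, o a a = 0%N.
Hypothesis oE : forall a b, (0 < o a b)%N ->
  [/\ (a < 3)%N, (b < 3)%N & cox_order m (f a) (f b) = o a b].
Hypothesis t_ok : coset_table o t.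
Hypothesis order12 : (0 < cox_order m (f 1) (f 2))%N.

Local Notation weqv := (weqv A v0).
Local Notation redundant := (redundant A v0).

Lemma braid_move_eqv w w' u : w' \in braid_moves o w ->
  weqv (map f w ++ u) (map f w' ++ u).
Proof.
have head w1 w2 : w2 \in braid_head o w1 -> weqv (map f w1 ++ u) (map f w2 ++ u).
  move=> /mapP[[a b]]; rewrite mem_filter => /andP[/andP[/= o0 /eqP wE] _] ->.
  have [a3 b3 cE] := oE o0.
  have ab : f a != f b by apply/eqP => /f_inj E; move: o0; rewrite E ?o_diag.
  rewrite -{1}(cat_take_drop (o a b) w1) wE !map_cat -!catA !map_altw -cE.
  by apply: weqv_braid; rewrite // cE.
elim: w w' => [|l w IHw] w' /=; first by rewrite cats0; exact: head.
rewrite mem_cat => /orP[/head//|/mapP[w2 w2m ->]] /=.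
by apply: weqv_cons; exact: IHw.
Qed.

Lemma braid_class_eqv n w w' u : w' \in braid_class o n w ->
  weqv (map f w ++ u) (map f w' ++ u).
Proof.
elim: n w' => [|n IHn] w' /=; first by rewrite inE => /eqP ->; exact: weqv_refl.
rewrite mem_undup mem_cat => /orP[/IHn//|/flattenP[s /mapP[w1 /IHn e1 ->]]].
by move=> /(braid_move_eqv u); exact: weqv_trans.
Qed.

Lemma double_redundant w u : has_double w -> redundant (map f w ++ u).
Proof.
elim: w => //= l [//|l' w] IHw /orP[/eqP ->|]; first exact: redundant_double.
by move=> /IHw; exact: (redundant_cat [:: f l]).
Qed.

Definition dihedral_word (u : seq 'I_r) := all (fun i => (i == f 1) || (i == f 2)) u.

(** Letters are prepended one by one: the table absorbs each into the representative x, and a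
    surplus letter 1 or 2 moves into the dihedral suffix u. *)
Lemma coset_normal_form w : redundant w \/
  exists x u, [/\ x \in t, dihedral_word u & weqv w (map f x ++ u)].
Proof.
have /andP[t0 /allP tt] := t_ok.
elim: w => [|i w [rw|[x [u [xt ud e]]]]].
- by right; exists [::], [::]; split=> //; exact: weqv_refl.
- by left; exact: (redundant_cat [:: i]).
have [a a3 ->] := f_surj i.
have /allP/(_ a) := tt x xt; have -> : a \in [:: 0; 1; 2]%N by case: a a3 => [|[|[|]]].
move=> /(_ isT) /hasP[w' w'c]; have e1 := weqv_trans (weqv_cons (f a) e)
  (braid_class_eqv u w'c).
rewrite /coset_ok => /or3P[dw|w't|/andP[lw w't]].
- by left; apply: redundant_eqv e1 _; exact: double_redundant.
- by right; exists w', u.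
right; exists (take (size w').-1 w'), (f (last 0%N w') :: u); split=> //.
  by rewrite /dihedral_word /= -/(dihedral_word u) ud andbT; case/orP: lw => /eqP ->;
     rewrite eqxx ?orbT.
suff E : w' = rcons (take (size w').-1 w') (last 0%N w').
  by move: e1; rewrite {1}E map_rcons cat_rcons.
by case: (lastP w') lw => // s l _; rewrite size_rcons last_rcons /= -cats1 take_size_cat ?cats1.
Qed.

(** A word in two letters either has a double letter or alternates. With n + 1 alternating letters,
    a braid move on the last n creates a double letter. *)
Lemma dihedral_redundant u : dihedral_word u ->
  (cox_order m (f 1) (f 2) < size u)%N -> redundant u.
Proof.
set n := cox_order m (f 1) (f 2).
have f12 : f 1 != f 2 by apply/eqP => E; have := f_inj (isT : 1 < 3)%N (isT : 2 < 3)%N E.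
have H v : dihedral_word v -> redundant v \/
    v = altw (size v) (f 1) (f 2) \/ v = altw (size v) (f 2) (f 1).
  elim: v => [|i v IHv]; first by right; left.
  move=> /andP[iE /IHv [rv|vE]]; first by left; exact: (redundant_cat [:: i]).
  case: v vE {IHv} => [|j v] vE.
    by right => /=; case/orP: iE => /eqP ->; auto.
  have [->|ij] := eqVneq i j; first by left; exact: redundant_double.
  have step a b : j :: v = altw (size v).+1 a b -> (i == a) || (i == b) ->
      i :: j :: v = altw (size v).+2 a b.
    move=> vE' iab; have jE : j = if odd (size v) then b else a by case: vE'.
    rewrite vE'; congr (_ :: _); move: ij; rewrite jE [odd _.+1]/=.
    by case/orP: iab => /eqP ->; case: (odd _); rewrite /= ?eqxx.
  right; case: vE => vE; [left | right]; apply: step => //.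
  by rewrite orbC.
have n0 : (0 < n)%N by [].
elim: u => // i u IHu ud; rewrite /= ltnS leq_eqVlt => /orP[/eqP nu|nu]; last first.
  by apply: (redundant_cat [:: i]); apply: IHu => //; case/andP: ud.
case: (H _ ud) => [//|]; rewrite [size _]/= -nu => H'.
have e12 : weqv (altw n (f 1) (f 2)) (altw n (f 2) (f 1)).
  by have := weqv_braid p_monic p0_inv par0 [::] f12 n0; rewrite !cats0.
have red a b : weqv (altw n a b) (altw n b a) -> redundant (altw n.+1 a b).
  move=> e; apply: redundant_eqv (weqv_cons _ e) _.
  by case: (n) n0 => // n' _; rewrite /= ; case: (odd n'); exact: redundant_double.
by case: H' => ->; apply: red => //; exact: weqv_sym.
Qed.

Lemma wspan_coset : exists N, forall w, wspan A v0 N (wd A v0 w).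
Proof.
have [B BP] : exists B, forall x, x \in t -> (size x <= B)%N.
  elim: (t) => [|y s [B BP]]; first by exists 0%N.
  exists (size y + B)%N => x; rewrite inE => /orP[/eqP ->|/BP xB]; first exact: leq_addr.
  exact: leq_trans xB (leq_addl _ _).
(* A word of this length leaves more letters for u than the dihedral order. *)
exists (B + (cox_order m (f 1) (f 2)).+1)%N; apply: wspan_bound => w wN.
have [//|[x [u [xt ud e]]]] := coset_normal_form w.
apply: redundant_eqv (e) _; apply: redundant_cat; apply: dihedral_redundant => //.
case: e => wE _; rewrite size_cat size_map in wE.
have xB : (size x <= B)%N := BP x xt.
rewrite wE in wN; rewrite -(leq_add2l B); apply: leq_trans wN _.
by rewrite leq_add2r.
Qed.

End CosetEnumeration.

Definition triangle_order (o01 o02 o12 : nat) (a b : nat) : nat :=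
  nth 0%N (nth [::] [:: [:: 0; o01; o02]; [:: o01; 0; o12]; [:: o02; o12; 0]]%N a) b.

(** The letter 0 has orders u and v with the letters 1 and 2, whose mutual order is w: either 0
    commutes with both, or the Coxeter diagram is of type A_3, B_3 or H_3. *)
Definition good_triple (u v w : nat) : Prop :=
  (u = 2 /\ v = 2 \/ u = 3 /\ v = 2 /\ 3 <= w <= 5)%N.

Lemma spherical_triple a b c : (1 < a)%N -> (1 < b)%N -> (1 < c)%N ->
  (a * b * c < a * b + b * c + c * a)%N ->
  good_triple a c b \/ good_triple c a b \/ good_triple a b c \/
  good_triple b a c \/ good_triple c b a \/ good_triple b c a.
Proof.
move=> a1 b1 c1 abc; rewrite /good_triple.
have Ha : (a = 2 \/ a = 3 \/ 4 <= a)%N by lia.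
have Hb : (b = 2 \/ b = 3 \/ 4 <= b)%N by lia.
have Hc : (c = 2 \/ c = 3 \/ 4 <= c)%N by lia.
case: Ha => [?|[?|a4]]; case: Hb => [?|[?|b4]]; case: Hc => [?|[?|c4]];
  subst; try lia; exfalso; nia.
Qed.

Section Spherical.

Variables (R : comNzRingType) (m : 'I_3 -> nat) (p : 'I_3 -> nat -> R).
Hypothesis m_gt1 : forall k, (1 < m k)%N.
Hypothesis p_monic : forall k, p k (m k) = 1.
Hypothesis p0_inv : forall k, invertible (p k 0).
Variables (V : lmodType R) (A : polygonal_action m p V) (v0 : V).
Hypothesis par0 : pa_parity A false v0.

Lemma wspan_triangle (x y z : 'I_3) (t : seq (seq nat)) (o01 o02 o12 : nat) :
  uniq [:: x; y; z] ->
  (0 < o01 -> cox_order m x y = o01)%N -> (0 < o02 -> cox_order m x z = o02)%N ->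
  (0 < o12 -> cox_order m y z = o12)%N -> (0 < cox_order m y z)%N ->
  coset_table (triangle_order o01 o02 o12) t ->
  exists N, forall w, wspan A v0 N (wd A v0 w).
Proof.
move=> xyz e01 e02 e12 yz0 tt; pose f n := nth x [:: x; y; z] n.
apply: (@wspan_coset _ _ _ _ p_monic p0_inv _ _ _ par0 f
  (triangle_order o01 o02 o12) t) => //.
- move=> a b a3 b3 /eqP; rewrite nth_uniq //; exact: eqP.
- move=> i; have : i \in [:: x; y; z].
    have /card_uniqP E := xyz; apply: contraT => iN.
    have : uniq [:: i; x; y; z] by rewrite cons_uniq iN.
    by move=> /card_uniqP E'; have := max_card (mem [:: i; x; y; z]); rewrite E' card_ord.
  by move=> /(nthP x)[a a3 <-]; exists a.
- by case=> [|[|[|[|a]]]] //; rewrite /triangle_order nth_default // nth_nil.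
have C i j : cox_order m i j = cox_order m j i by exact: cox_orderC.
case=> [|[|[|a]]] [|[|[|b]]]; rewrite /triangle_order /f //= ?nth_nil //;
  rewrite ?nth_default // => o0; split=> //;
  by rewrite ?e01 ?e02 ?e12 // C ?e01 ?e02 ?e12.
Qed.

(** The tables list 2, 4, 6 and 12 representatives, the indices of the dihedral subgroup of order
    2w: in the last three cases 24/6, 48/8 and 120/10. *)
Lemma wspan_good (x y z : 'I_3) : uniq [:: x; y; z] -> (0 < cox_order m y z)%N ->
  good_triple (cox_order m x y) (cox_order m x z) (cox_order m y z) ->
  exists N, forall w, wspan A v0 N (wd A v0 w).
Proof.
move=> xyz yz0 [[xy xz]|[xy [xz w35]]].
  (* The last order is 0 since w is arbitrary here; the two commutations suffice. *)
  by apply: (@wspan_triangle x y z [:: [::]; [:: 0]]%N 2 2 0 xyz).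
have : (cox_order m y z = 3 \/ cox_order m y z = 4 \/ cox_order m y z = 5)%N by lia.
case=> [yz|[yz|yz]].
- by apply: (@wspan_triangle x y z
    [:: [::]; [:: 0]; [:: 1; 0]; [:: 2; 1; 0]]%N 3 2 3 xyz); rewrite ?yz.
- by apply: (@wspan_triangle x y z
    [:: [::]; [:: 0]; [:: 1; 0]; [:: 2; 1; 0]; [:: 1; 2; 1; 0]; [:: 0; 1; 2; 1; 0]]%N
    3 2 4 xyz); rewrite ?yz.
by apply: (@wspan_triangle x y z
  [:: [::]; [:: 0]; [:: 1; 0]; [:: 2; 1; 0]; [:: 1; 2; 1; 0]; [:: 0; 1; 2; 1; 0];
      [:: 2; 1; 2; 1; 0]; [:: 2; 0; 1; 2; 1; 0]; [:: 1; 2; 0; 1; 2; 1; 0];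
      [:: 2; 1; 2; 0; 1; 2; 1; 0]; [:: 1; 2; 1; 2; 0; 1; 2; 1; 0];
      [:: 0; 1; 2; 1; 2; 0; 1; 2; 1; 0]]%N 3 2 5 xyz); rewrite ?yz.
Qed.

Lemma wspan_spherical : \sum_(j < 3) (1 - (m j)%:R^-1 : rat) < 2 ->
  exists N, forall w, wspan A v0 N (wd A v0 w).
Proof.
pose i0 : 'I_3 := ord0; pose i1 : 'I_3 := ordS i0; pose i2 : 'I_3 := ordS i1.
have i2S : ordS i2 = i0 by exact: val_inj.
move=> hs; have C i j : cox_order m i j = cox_order m j i by exact: cox_orderC.
have e01 : cox_order m i0 i1 = m i0 by exact: cox_orderS.
have e12 : cox_order m i1 i2 = m i1 by exact: cox_orderS.
have e20 : cox_order m i2 i0 = m i2 by rewrite -{1}i2S; exact: cox_orderS.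
have m0 k : (0 < m k)%N by exact: ltnW.
have abc : (m i0 * m i1 * m i2 < m i0 * m i1 + m i1 * m i2 + m i2 * m i0)%N.
  have m0' k : 0 < (m k)%:R :> rat by rewrite ltr0n.
  have : 1 < (m i0)%:R^-1 + (m i1)%:R^-1 + (m i2)%:R^-1 :> rat.
    move: hs; rewrite !big_ord_recl big_ord0.
    have -> : lift ord0 ord0 = i1 :> 'I_3 by exact: val_inj.
    have -> : lift ord0 (lift ord0 ord0) = i2 :> 'I_3 by exact: val_inj.
    by rewrite -/i0; lra.
  have -> : (m i0)%:R^-1 + (m i1)%:R^-1 + (m i2)%:R^-1 =
    ((m i0 * m i1 + m i1 * m i2 + m i2 * m i0)%:R / (m i0 * m i1 * m i2)%:R : rat).
    rewrite !natrD !natrM; field.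
    by have := m0' i0; have := m0' i1; have := m0' i2; rewrite !lt0r => /andP[-> _] /andP[-> _] /andP[-> _].
  by rewrite ltr_pdivlMr ?mul1r ?ltr_nat // ltr0n !muln_gt0 !m0.
have e10 := e01; have e21 := e12; have e02 := e20.
rewrite C in e10; rewrite C in e21; rewrite C in e02.
have [g|[g|[g|[g|[g|g]]]]] := spherical_triple (m_gt1 i0) (m_gt1 i1) (m_gt1 i2) abc.
- by apply: (@wspan_good i0 i1 i2); rewrite ?e01 ?e02 ?e12.
- by apply: (@wspan_good i0 i2 i1); rewrite ?e01 ?e02 ?e21.
- by apply: (@wspan_good i1 i0 i2); rewrite ?e10 ?e12 ?e02.
- by apply: (@wspan_good i1 i2 i0); rewrite ?e10 ?e12 ?e20.
- by apply: (@wspan_good i2 i0 i1); rewrite ?e20 ?e21 ?e01.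
- by apply: (@wspan_good i2 i1 i0); rewrite ?e20 ?e21 ?e10.
Qed.

End Spherical.

From mathcomp Require Import mpoly.

(** * Nontriviality and determinants *)

Section LaurentEvaluation.

Variables (I : finType) (F : fieldType).
Local Notation L := (laurent I F).
Local Notation P := (mpoly #|I| F).
Local Notation ev1 := (meval (fun=> 1 : F)).

Lemma laurentP (x : L) : exists ep : multinom #|I| * P,
  val x * tofrac ('X_[ep.1] : P) = tofrac ep.2.
Proof. by case: x => x; rewrite /= => xP; have /asboolP[e [q xE]] := xP; exists (e, q). Qed.

(** The numerator is chosen, but the value does not depend on it, because monomials become 1 at q =
    1. *)
Definition laurent_eval (x : L) : F := ev1 (projT1 (cid (laurentP x))).2.

Lemma ev1X e : ev1 ('X_[e] : P) = 1.
Proof. by rewrite mevalX big1 // => i _; rewrite expr1n. Qed.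

Lemma laurent_evalE (x : L) e (q : P) :
  val x * tofrac ('X_[e] : P) = tofrac q -> laurent_eval x = ev1 q.
Proof.
move=> xE; rewrite /laurent_eval; case: cid => -[f q'] /= xE'.
have : tofrac (q * 'X_[f]) = tofrac (q' * 'X_[e]).
  by rewrite !rmorphM /= -xE -xE' mulrAC.
move=> /eqP; rewrite tofrac_eq => /eqP /(congr1 ev1).
by rewrite !mevalM !ev1X !mulr1.
Qed.

Lemma laurent_evalB : {morph laurent_eval : x y / x - y}.
Proof.
move=> x y; have [[e q] /= xE] := laurentP x; have [[f q'] /= yE] := laurentP y.
rewrite (laurent_evalE xE) (laurent_evalE yE).
rewrite (@laurent_evalE (x - y) (e + f)%MM (q * 'X_[f] - q' * 'X_[e])).
  by rewrite mevalB !mevalM !ev1X !mulr1.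
rewrite [val (x - y)](_ : _ = val x - val y) // mpolyXD [RHS]rmorphB !rmorphM /= -xE -yE mulrBl.
congr (_ - _).
  by rewrite mulrA.
by rewrite [tofrac _ * tofrac _]mulrC mulrA.
Qed.

Lemma laurent_evalM : {morph laurent_eval : x y / x * y}.
Proof.
move=> x y; have [[e q] /= xE] := laurentP x; have [[f q'] /= yE] := laurentP y.
rewrite (laurent_evalE xE) (laurent_evalE yE).
rewrite (@laurent_evalE (x * y) (e + f)%MM (q * q')); first by rewrite mevalM.
by rewrite mpolyXD !rmorphM /= -xE -yE mulrACA.
Qed.

Lemma laurent_eval_poly q : laurent_eval (laurent_poly q) = ev1 q.
Proof.
by apply: (@laurent_evalE _ 0%MM); rewrite mpolyX0 rmorph1 mulr1.
Qed.

Lemma laurent_eval1 : laurent_eval 1 = 1.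
Proof.
rewrite -[RHS](@meval1 #|I| F (fun=> 1)) -laurent_eval_poly; congr laurent_eval.
by apply: val_inj; rewrite /= rmorph1.
Qed.

HB.instance Definition _ :=
  GRing.isZmodMorphism.Build L F laurent_eval laurent_evalB.
HB.instance Definition _ :=
  GRing.isMonoidMorphism.Build L F laurent_eval (laurent_eval1, laurent_evalM).

Definition eval_module : Type := F.
HB.instance Definition _ := GRing.Zmodule.on eval_module.

Definition eval_scale (a : L) (z : eval_module) : eval_module := laurent_eval a * z.

Lemma eval_scaleA a b z : eval_scale a (eval_scale b z) = eval_scale (a * b) z.
Proof. by rewrite /eval_scale laurent_evalM mulrA. Qed.

Lemma eval_scale1 : left_id 1 eval_scale.
Proof. by move=> z; rewrite /eval_scale laurent_eval1 mul1r. Qed.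

Lemma eval_scaleDr : right_distributive eval_scale +%R.
Proof. by move=> a x y; exact: mulrDr. Qed.

Lemma eval_scaleDl z : {morph eval_scale^~ z : a b / a + b}.
Proof. by move=> a b; rewrite /eval_scale rmorphD mulrDl. Qed.

HB.instance Definition _ := GRing.Zmodule_isLmodule.Build L eval_module
  eval_scaleA eval_scale1 eval_scaleDr eval_scaleDl.

End LaurentEvaluation.

Section Nontrivial.

Variables (K : realType) (r : nat) (m : 'I_r -> nat).
Hypothesis m_gt0 : forall k, (0 < m k)%N.

Lemma root_exp_full n : (0 < n)%N -> root_exp K n n = 1.
Proof.
move=> n0; rewrite /root_exp mulfK ?pnatr_eq0 -?lt0n //.
by rewrite [2 * pi]mulrC mulr_natr cos2pi sin2pi.
Qed.

Lemma hpoly_eval1 j : laurent_eval (hpoly K m j).[1] = 0.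
Proof.
have mj : (m j).-1.+1 = m j by rewrite prednK.
(* The last index stands for the exponent m j, where the root of unity is 1. *)
pose k := cast_ord mj ord_max.
rewrite /hpoly horner_prod (big_morph _ (@laurent_evalM _ _) (@laurent_eval1 _ _)).
have prod0 (G : 'I_(m j) -> K[i]) : G k = 0 -> \prod_i G i = 0.
  by move=> Gk; rewrite (bigD1 k) //= Gk mul0r.
apply: prod0; rewrite hornerXsubC laurent_evalB laurent_eval1.
have -> : laurent_eval (heigen K k) = root_exp K k.+1 (m j).
  by rewrite /heigen laurent_evalM; do 2!rewrite laurent_eval_poly; rewrite mevalC mevalXU mulr1.
have -> : k.+1 = m j by exact: mj.
by rewrite root_exp_full // subrr.
Qed.

(* At q = 1 the algebra acts on a line by c_j = 1. *)
Lemma hone_neq0 : hone K m != 0.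
Proof.
pose N : lmodType (laurent (qindex m) K[i]) := eval_module K[i].
pose id1 (j : 'I_r) : {linear N -> N} := idfun.
have [psi [psi1 _ _]] : exists psi : {linear hecke K m -> N}, [/\ psi (hone K m) = (1 : K[i]),
    forall j h, psi (hgen K m j h) = id1 j (psi h) &
    forall j h, psi (hgenV K m j h) = id1 j (psi h)].
  apply: (@hecke_universal K r m N id1 id1 (fun=> True)) => //.
    move=> j v _; rewrite /poly_act.
    have E q : iter q idfun v = v by elim: q.
    under eq_bigr do rewrite E.
    rewrite -scaler_suml.
    have -> : \sum_(q < (m j).+1) (hpoly K m j)`_q = (hpoly K m j).[1].
      by rewrite horner_coef size_hpoly; apply: eq_bigr => q _; rewrite expr1n mulr1.
    by have := hpoly_eval1 j => E1; rewrite /GRing.scale /= /eval_scale E1 mul0r.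
  by move=> v _; elim: (enum _).
apply/eqP => h0; move: psi1; rewrite h0 linear0 => /eqP.
by rewrite eq_sym oner_eq0.
Qed.

End Nontrivial.

(** * Finite bases and matrices *)

Section FiniteBasis.

Variables (R : comNzRingType) (V : lmodType R).

Definition finite_basis n (b : 'I_n -> V) : Prop :=
  (forall v, exists a : 'I_n -> R, v = \sum_i a i *: b i) /\
  (forall a : 'I_n -> R, \sum_i a i *: b i = 0 -> forall i, a i = 0).

(** Each of the finitely many generators involves finitely many basis vectors; together these
    already span. *)
Lemma free_fg_finite_basis (L : seq V) : free_module R V ->
  (forall v, exists s : seq (R * V),
     (forall z, z \in s -> z.2 \in L) /\ v = \sum_(z <- s) z.1 *: z.2) ->
  exists n (b : 'I_n -> V), finite_basis b.
Proof.
move=> [B [Bind Bspan]] Lspan.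
pose spn (S : seq V) v := exists a : V -> R, v = \sum_(x <- S) a x *: x.
have spn_sub S S' v : uniq S -> uniq S' -> {subset S <= S'} -> spn S v -> spn S' v.
  move=> uS uS' SS' [a ->]; exists (fun x => if x \in S then a x else 0).
  rewrite [RHS](bigID (mem S)) /= [X in _ + X]big1 ?addr0; last first.
    by move=> x /negbTE ->; rewrite scale0r.
  rewrite -[in RHS]big_filter (perm_big [seq x <- S' | x \in S]) /=.
    by rewrite !big_filter; apply: eq_bigr => x ->.
  apply: uniq_perm => //; rewrite ?filter_uniq // => x.
  by rewrite mem_filter; case: (boolP (x \in S)) => // /SS' ->.
have [S [uS SB SL]] : exists S : seq V,
    [/\ uniq S, forall x, x \in S -> B x & forall g, g \in L -> spn S g].
  elim: L {Lspan} => [|g L [S [uS SB SL]]]; first by exists [::].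
  have [s [a [sB gE]]] := Bspan g.
  (* A spanning sum may repeat vectors, so coefficients are multiplied by multiplicities. *)
  have sg : spn (undup s) g.
    exists (fun x => a x *+ count_mem x s); rewrite gE -big_undup_iterop_count /=.
    apply: eq_bigr => x _; rewrite -scalerMnl Monoid.iteropE.
    by elim: (count_mem x s) => [//|c IHc]; rewrite iterS IHc mulrS.
  exists (undup (s ++ S)); split; first exact: undup_uniq.
    by move=> x; rewrite mem_undup mem_cat => /orP[/sB|/SB].
  move=> h; rewrite inE => /orP[/eqP ->|hL].
    apply: spn_sub sg; rewrite ?undup_uniq // => x.
    by rewrite !mem_undup mem_cat => ->.
  apply: spn_sub (SL h hL); rewrite ?undup_uniq // => x xS.
  by rewrite mem_undup mem_cat xS orbT.
have spnE a : \sum_(i < size S) a (tnth (in_tuple S) i) *: tnth (in_tuple S) i =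
    \sum_(x <- S) a x *: x.
  by rewrite [RHS](big_tuple _ _ (in_tuple S)).
exists (size S), (tnth (in_tuple S)); split=> [v|a a0 i].
  have [s [sL ->]] := Lspan v.
  suff [a aE] : spn S (\sum_(z <- s) z.1 *: z.2).
    by exists (fun i => a (tnth (in_tuple S) i)); rewrite aE spnE.
  elim: s sL => [|z s IHs] sL.
    exists (fun=> 0); rewrite big_nil big1 // => x _; exact: scale0r.
  have [a aE] := SL _ (sL z (mem_head _ _)).
  have [|c cE] := IHs; first by move=> u us; apply: sL; rewrite inE us orbT.
  exists (fun x => z.1 * a x + c x); rewrite big_cons cE {1}aE scaler_sumr -big_split.
  by apply: eq_bigr => x _; rewrite scalerDl scalerA.
(* Independence of B is stated for coefficients that are functions of the vector; 0 is the default
   outside S. *)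
pose c x := if insub (index x S) is Some i then a i else 0.
have cE (k : 'I_(size S)) : c (tnth (in_tuple S) k) = a k.
  rewrite /c (tnth_nth 0) /= index_uniq //; case: insubP => [k' _ kk'|]; last by rewrite ltn_ord.
  by congr a; exact: val_inj.
rewrite -cE; apply: (Bind S c uS SB); last exact: mem_tnth.
by rewrite -spnE -[RHS]a0; apply: eq_bigr => k _; rewrite cE.
Qed.

Variables (n : nat) (b : 'I_n -> V).
Hypothesis basis : finite_basis b.

(** Images of basis vectors are rows, so composition reverses the product of matrices; determinants
    do not notice. *)
Definition represents (X : 'M[R]_n) (f : V -> V) : Prop :=
  forall i, f (b i) = \sum_k X i k *: b k.

Lemma represents_exists f : exists X, represents X f.
Proof.
pose a i := projT1 (cid (basis.1 (f (b i)))).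
have aE i : f (b i) = \sum_k a i k *: b k by exact: projT2 (cid (basis.1 (f (b i)))).
by exists (\matrix_(i, k) a i k) => i; rewrite aE; apply: eq_bigr => k _; rewrite mxE.
Qed.

Lemma represents_uniq X Y f : represents X f -> represents Y f -> X = Y.
Proof.
move=> Xf Yf; apply/matrixP => i k; apply/eqP; rewrite -subr_eq0; apply/eqP.
apply: (basis.2 (fun k => X i k - Y i k)).
under eq_bigr do rewrite scalerBl.
by rewrite sumrB -Xf -Yf subrr.
Qed.

Lemma represents_comp X Y f (g : {linear V -> V}) :
  represents X f -> represents Y g -> represents (X *m Y) (fun v => g (f v)).
Proof.
move=> Xf Yg i; rewrite Xf linear_sum.
under eq_bigr do rewrite linearZZ Yg scaler_sumr.
rewrite exchange_big; apply: eq_bigr => k _; rewrite mxE scaler_suml.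
by apply: eq_bigr => l _; rewrite scalerA.
Qed.

Lemma represents1 : represents 1%:M id.
Proof.
move=> i; rewrite (bigD1 i) //= mxE eqxx scale1r big1 ?addr0 // => k ki.
by rewrite mxE eq_sym (negbTE ki) scale0r.
Qed.

Lemma represents_foldr (I : Type) (s : seq I) (X : I -> 'M[R]_n) (f : I -> {linear V -> V}) :
  (forall j, represents (X j) (f j)) ->
  exists2 Y, represents Y (fun v => foldr (fun j => f j) v s) &
    \det Y = \prod_(j <- s) \det (X j).
Proof.
move=> Xf; elim: s => [|j s [Y Ys dY]].
  by exists 1%:M; [exact: represents1 | rewrite det1 big_nil].
exists (Y *m X j); first exact: represents_comp.
by rewrite det_mulmx dY big_cons mulrC.
Qed.

End FiniteBasis.

Lemma represents_poly_act (R : comNzRingType) (V : lmodType R) n (b : 'I_n.+1 -> V)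
    (X : 'M_n.+1) (f : {linear V -> V}) (p : {poly R}) d :
  finite_basis b -> size p = d.+1 ->
  represents b X f -> (forall v, poly_act (fun q => p`_q) d f v = 0) -> horner_mx X p = 0.
Proof.
move=> basis sp Xf pf.
have Xq q : represents b (X ^+ q) (iter q f).
  elim: q => [|q IHq]; first by move=> i; exact: represents1.
  by rewrite exprSr; exact: represents_comp.
apply: (represents_uniq basis (f := fun=> 0)); last first.
  by move=> i; rewrite big1 // => k _; rewrite mxE scale0r.
move=> i; rewrite -[LHS](pf (b i)) /poly_act.
under eq_bigr do rewrite Xq scaler_sumr.
rewrite exchange_big; apply: eq_bigr => k _.
rewrite -[p in horner_mx X p](coefK p) poly_def sp rmorph_sum summxE scaler_suml.
apply: eq_bigr => q _; rewrite -mul_polyC rmorphM rmorphXn /= horner_mx_X horner_mx_C.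
by rewrite [_%:M * _]mul_scalar_mx mxE scalerA.
Qed.

(** Simple roots make A diagonalizable, and the diagonal entries are eigenvalues, hence roots of the
    annihilating product. *)
Lemma det_split_annihilator (F : fieldType) n (A : 'M[F]_n.+1) (s : seq F) :
  uniq s -> horner_mx A (\prod_(x <- s) ('X - x%:P)) = 0 ->
  exists a : 'I_n.+1 -> F, (forall i, a i \in s) /\ \det A = \prod_i a i.
Proof.
move=> us As.
have Amin : mxminpoly A %| \prod_(x <- s) ('X - x%:P) by exact: mxminpoly_min.
have [|P Pu] := (mxpoly.diagonalizableP A).2; first by exists s.
case/diagonalizable_forPex => D /(simmxP Pu) PAD.
exists (fun i => D 0 i); split=> [i|].
  rewrite -root_prod_XsubC; apply: (root_dvdp Amin).
  rewrite -eigenvalue_root_min; apply/eigenvalueP; exists (row i P).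
    by apply/rowP => k; rewrite -row_mul PAD mul_diag_mx !mxE.
  apply/eqP => Pi0; have : row i (P *m invmx P) = 0 by rewrite row_mul Pi0 mul0mx.
  rewrite mulmxV // => /rowP /(_ i); rewrite !mxE eqxx => /eqP.
  by rewrite oner_eq0.
move: Pu; rewrite unitmxE unitfE => dP; apply: (mulIf dP).
by rewrite -det_diag -!det_mulmx -PAD det_mulmx mulrC -det_mulmx.
Qed.

Section Determinants.

Variables (K : realType) (r : nat) (m : 'I_r -> nat).
Local Notation R := (qring K m).
Local Notation P := (mpoly #|qindex m| K[i]).
Local Notation Frac := {fraction P}.

Definition heigen_poly (j : 'I_r) (k : 'I_(m j)) : P :=
  mpolyC _ (root_exp K k.+1 (m j)) * 'X_(enum_rank (Tagged (fun j => 'I_(m j)) k)).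

Lemma heigen_polyE j (k : 'I_(m j)) : laurent_val (heigen K k) = tofrac (heigen_poly k).
Proof. by rewrite /heigen_poly rmorphM. Qed.

Lemma heigen_poly_inj j : injective (@heigen_poly j).
Proof.
move=> k k' kk'; apply/eqP; apply: contraT => nkk'.
pose t (k : 'I_(m j)) := Tagged (fun j => 'I_(m j)) k.
have := congr1 (meval (fun i => (i == enum_rank (t k))%:R)) kk'.
rewrite !mevalM !mevalC !mevalXU eqxx mulr1 (inj_eq enum_rank_inj) eq_Tagged /=.
rewrite eq_sym (negbTE nkk') mulr0 => /eqP.
by rewrite (negbTE (root_exp_neq0 _ _ _)).
Qed.

Lemma heigen_poly0 j (k : 'I_(m j)) : meval (fun=> 0) (heigen_poly k) = 0.
Proof. by rewrite mevalM mevalXU mulr0. Qed.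

(* The determinants would be products of monomials without constant term. *)
Lemma no_finite_basis (V : lmodType R) n (b : 'I_n.+1 -> V) (f : 'I_r -> {linear V -> V}) :
  (0 < r)%N -> finite_basis b ->
  (forall j v, poly_act (fun q => (hpoly K m j)`_q) (m j) (f j) v = 0) ->
  (forall v, foldr (fun j => f j) v (enum 'I_r) = v) -> False.
Proof.
move=> r_gt0 basis frel fprod.
pose X j := projT1 (cid (represents_exists basis (f j))).
have Xf j : represents b (X j) (f j) by exact: projT2 (cid (represents_exists basis (f j))).
pose g : {rmorphism laurent (qindex m) K[i] -> Frac} := \val.
have prod0 (I : finType) (Q : I -> P) k :
    meval (fun=> 0) (Q k) = 0 -> meval (fun=> 0) (\prod_i Q i) = 0.
  by move=> Qk; rewrite (bigD1 k) //= mevalM Qk mul0r.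
have dX j : exists2 q : P, g (\det (X j)) = tofrac q & meval (fun=> 0) q = 0.
  pose s := [seq tofrac (heigen_poly k) | k <- enum 'I_(m j)].
  have us : uniq s.
    rewrite map_inj_uniq ?enum_uniq // => k k' /eqP; rewrite tofrac_eq => /eqP.
    exact: heigen_poly_inj.
  have gp : map_poly g (hpoly K m j) = \prod_(x <- s) ('X - x%:P).
    rewrite big_map big_enum map_prod_XsubC; apply: eq_bigr => k _.
    exact: (congr1 (fun z => 'X - z%:P) (heigen_polyE k)).
  have Xs : horner_mx (map_mx g (X j)) (\prod_(x <- s) ('X - x%:P)) = 0.
    rewrite -gp -map_horner_mx.
    have -> := represents_poly_act basis (size_hpoly K m j) (Xf j) (frel j).
    exact: map_mx0.
  have [a [as_ dE]] := det_split_annihilator us Xs.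
  have aE i : exists2 q : P, a i = tofrac q & meval (fun=> 0) q = 0.
    by have /mapP[k _ ->] := as_ i; exists (heigen_poly k) => //; exact: heigen_poly0.
  pose q i := projT1 (cid2 (aE i)).
  have qE i : a i = tofrac (q i) by rewrite /q; case: cid2.
  have q0 i : meval (fun=> 0) (q i) = 0 by rewrite /q; case: cid2.
  (* The rank is positive, so there is at least one factor, and it vanishes at the origin. *)
  exists (\prod_i q i); last by apply: (prod0 _ _ ord0).
  by rewrite -det_map_mx dE rmorph_prod; apply: eq_bigr => i _; rewrite qE.
have [Y Yf dY] := represents_foldr (enum 'I_r) Xf.
have Y1 : Y = 1%:M.
  apply: (represents_uniq basis Yf) => i; rewrite fprod; exact: represents1.
pose q j := projT1 (cid2 (dX j)).
have qE j : g (\det (X j)) = tofrac (q j) by rewrite /q; case: cid2.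
have q0 j : meval (fun=> 0) (q j) = 0 by rewrite /q; case: cid2.
have dR : \prod_(j < r) \det (X j) = 1 by rewrite -[RHS](det1 _ n.+1) -Y1 dY big_enum.
have : tofrac (\prod_(j < r) q j) = tofrac 1.
  rewrite [RHS]rmorph1 -[RHS](rmorph1 g) -dR [LHS]rmorph_prod [RHS]rmorph_prod.
  by apply: eq_bigr => j _; rewrite qE.
(* The determinants have product 1, yet the left side vanishes when all variables are set to 0. *)
move=> /eqP; rewrite tofrac_eq => /eqP /(congr1 (meval (fun=> 0))).
rewrite meval1 (prod0 _ _ (Ordinal r_gt0)) // => /eqP.
by rewrite eq_sym oner_eq0.
Qed.

End Determinants.

Section Spherical.

Variables (K : realType) (m : 'I_3 -> nat).
Hypothesis m_gt1 : forall k, (1 < m k)%N.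
Hypothesis m_lt2 : \sum_(j < 3) (1 - (m j)%:R^-1 : rat) < 2.
Local Notation R := (qring K m).
Local Notation H := (hecke K m).
Local Notation A := (hecke_action K m).
Local Notation word := (wd A (hone K m, 0)).

Lemma hecke_wspan h : exists n, wspan A (hone K m, 0) n ((h, 0) : (H * H)%type).
Proof.
have refl2 j w n : wspan A (hone K m, 0) n w ->
    exists n', wspan A (hone K m, 0) n' (pa_refl A j w).
  by move=> nw; exists n.+1; exact: wspan_refl.
have s0 i j : sigma (hgen K m) i (sigmaV (hgenV K m) j (0 : H)) = 0.
  apply: (etrans (congr1 (sigma (hgen K m) i) (sigmaV0 (@hgenK K 3 m) (@hgenVK K 3 m) _))).
  exact: sigma0.
move: h; apply: hecke_ind.
- by exists 0%N; exact: wspan0.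
- move=> a h1 h2 [n1 w1] [n2 w2]; exists (maxn n1 n2).
  have -> : (a *: h1 + h2, 0) = a *: (h1, 0) + (h2, 0) :> (H * H)%type.
    apply: (congr1 (pair _)); exact: (esym (etrans (addr0 _) (scaler0 _ _))).
  apply: wspanD; last by apply: wspan_leq w2; exact: leq_maxr.
  by apply: wspanZ; apply: wspan_leq w1; exact: leq_maxl.
- exists 1%N; exists [:: (1, [::])]; split=> //.
  by rewrite big_seq1 scale1r.
- move=> j h [n wn].
  have [n1 w1] := refl2 (ordS j) _ _ wn; have [n2 w2] := refl2 j _ _ w1.
  exists n2; have <- : pa_refl A j (pa_refl A (ordS j) (h, 0)) = (hgen K m j h, 0).
    apply: (@f_equal2 _ _ _ pair (sigmaV (hgenV K m) j (sigma (hgen K m) (ordS j) h))); last exact: s0.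
    apply: (etrans (congr1 (sigmaV (hgenV K m) j) (sigmaS (@hgen_prod K 3 m) j h))).
    exact: (sigmaK (@hgenK K 3 m)).
  exact: w2.
move=> j h [n wn].
have [n1 w1] := refl2 j _ _ wn; have [n2 w2] := refl2 (ordS j) _ _ w1.
exists n2; have <- : pa_refl A (ordS j) (pa_refl A j (h, 0)) = (hgenV K m j h, 0).
  apply: (@f_equal2 _ _ _ pair (sigmaV (hgenV K m) (ordS j) (sigma (hgen K m) j h))); last exact: s0.
  apply: (etrans (sigmaVS (@hgenK K 3 m) (@hgenVK K 3 m) (@hgen_prod K 3 m) j _)).
  exact: (congr1 (hgenV K m j) (sigmaK (@hgenK K 3 m) j h)).
exact: w2.
Qed.

Lemma hecke_fg : exists L : seq H, forall h : H, exists s : seq (R * H),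
     (forall z, z \in s -> z.2 \in L) /\ h = \sum_(z <- s) z.1 *: z.2.
Proof.
have [N wN] := @wspan_spherical R m (fun j q => (hpoly K m j)`_q) m_gt1
  (hpoly_monic K m) (hpoly0_inv K m) (H * H)%type A (hone K m, 0) (erefl _) m_lt2.
exists [seq (word w).1 | w <- flatten [seq [seq tval t | t : n.-tuple 'I_3] | n <- iota 0 N]] => h.
have [n [s [_ hE]]] := hecke_wspan h.
have [t [tN hE']] : wspan A (hone K m, 0) N ((h, 0) : (H * H)%type).
  by rewrite hE; apply: wspan_sum => z _; apply: wspanZ; exact: wN.
exists [seq (z.1, (word z.2).1) | z <- t]; split.
  move=> _ /mapP[z zt ->]; apply: (map_f (fun w => (word w).1)).
  apply/flattenP; exists [seq tval t | t : (size z.2).-tuple 'I_3].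
    by apply: map_f; rewrite mem_iota; exact: (allP tN).
  by apply/mapP; exists (in_tuple z.2); rewrite ?mem_enum.
rewrite big_map; have := congr1 (fun x : (H * H)%type => x.1) hE' => /= ->.
apply: (etrans (big_morph (fun x : (H * H)%type => x.1) (fun x y => erefl _) (erefl _) _ _ _)).
by apply: eq_bigr.
Qed.

Lemma hecke_not_free : ~ free_module R H.
Proof.
move=> Hfree; have [L Lspan] := hecke_fg.
have [[|n] [b basis]] := free_fg_finite_basis Hfree Lspan.
  (* An empty basis would make the unit of the algebra zero. *)
  have [a aE] := basis.1 (hone K m); have := hone_neq0 K (fun k => ltnW (m_gt1 k)).
  by rewrite aE big_ord0 eqxx.
exact: (no_finite_basis (isT : (0 < 3)%N) basis (@hgen_rel K 3 m) (@hgen_prod K 3 m)).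
Qed.

End Spherical.

(** Each term is at least 1/2, so four of them already give 2. *)
Lemma angle_sum_lt2 r (m : 'I_r -> nat) : (2 < r)%N -> (forall j, 1 < m j)%N ->
  \sum_(j < r) (1 - (m j)%:R^-1 : rat) < 2 -> r = 3%N.
Proof.
move=> r3 m_gt1 lt2; apply/eqP; rewrite eqn_leq r3 andbT leqNgt; apply/negP => r4.
have : \sum_(j < r) (2^-1 : rat) <= \sum_(j < r) (1 - (m j)%:R^-1).
  apply: ler_sum => j _; have mj : (m j)%:R^-1 <= 2^-1 :> rat.
    by rewrite lef_pV2 ?posrE ?ltr0n ?ler_nat // ltnW.
  by lra.
rewrite sumr_const card_ord => /le_lt_trans /(_ lt2).
rewrite -[_ *+ r]mulr_natr ltr_pdivrMl // -natrM ltr_nat.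
by lia.
Qed.

Theorem theorem7p27 (K : realType) (r : nat) (m : 'I_r -> nat)
    (hr : (3 <= r)%N) (hm : forall j : 'I_r, (2 <= m j)%N) :
  free_module (qring K m) (hecke K m) <->
  2 <= \sum_(j < r) (1 - (m j)%:R^-1 : rat).
Proof.
split=> [Hfree|m_ge2]; last first.
  have [W] := chamber_system_exists K hr hm m_ge2.
  exact: (hecke_free_of_chambers K W (ltnW (ltnW hr)) hm).
rewrite leNgt; apply/negP => m_lt2; have r3 := angle_sum_lt2 hr hm m_lt2.
by move: m hm m_lt2 Hfree; rewrite r3 => m hm m_lt2; exact: hecke_not_free.
Qed.
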